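(* Let $\omega=(A,B,1/p,q,r,s)\in\Omega$ and fix $A,B$. Assume that $\lambda_n=\lambda_n(\omega)$ is a simple eigenvalue of $\omega$ for some $n\in\mathbb N_0$ and that $w_n$ is a normalized eigenfunction of $\lambda_n$. Then there is a simple closed curve $\Gamma$ in $\mathbb C$ with $\lambda_n(\omega)$ in its interior and a neighborhood $O$ of $\omega$ in $\Omega$ such that for any $\rho\in O$ the Sturm–Liouville problem $\rho$ has exactly one eigenvalue in the interior of $\Gamma$, and this eigenvalue is simple. Moreover: (1) Fix $q,r,s$ and consider $\lambda_n$ as a function of $1/p$, $p>0$ a.e. on $J$. Then $\lambda_n$ is Fréchet differentiable at $1/p$ in $V$ and its Fréchet derivative is the bounded linear transformation given by $$\lambda_n'(1/p)h=-\int_a^b|w_n^{[1]}|^2h,\qquad h\in L^1(J,\mathbb R).$$ (2) Fix $1/p,q,r$ and consider $\lambda_n$ as a function of $s$. Then $\lambda_n$ is Fréchet differentiable at $s$ in $L^1(J,\mathbb R)$ and its Fréchet derivative is the bounded linear transformation given by $$\lambda_n'(s)h=2\int_a^b\mathrm{Re}\big(w_n\overline{w_n^{[1]}}\big)h,\qquad h\in L^1(J,\mathbb R).$$ (3) Fix $1/p,s,r$ and consider $\lambda_n$ as a function of $q$. Then $\lambda_n$ is Fréchet differentiable at $q$ in $L^1(J,\mathbb R)$ and its Fréchet derivative is the bounded linear transformation given by $$\lambda_n'(q)h=\int_a^b|w_n|^2h,\qquad h\in L^1(J,\mathbb R).$$ (4) Fix $1/p,s,q$ and consider $\lambda_n$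 as a function of $r$, $r>0$ a.e. on $J$. Then $\lambda_n$ is Fréchet differentiable at $r$ in $V$ and its Fréchet derivative is the bounded linear transformation given by $$\lambda_n'(r)h=-\lambda_n(r)\int_a^b|w_n|^2h,\qquad h\in L^1(J,\mathbb R).$$
   Context: Let $J=(a,b)$ with $-\infty<a<b<\infty$. $\Omega$ is the set of all $\omega=(A,B,1/p,q,r,s)$ such that $p,q,r,s$ are real-valued, $1/p,q,r,s\in L^1(J,\mathbb R)$, $p>0$ and $r>0$ a.e. on $J$, and $A,B$ are complex $2\times2$ matrices with $(A|B)$ of rank $2$ and $AEA^*=BEB^*$, $E=\begin{pmatrix}0&-1\\1&0\end{pmatrix}$. The metric on $\Omega$ is $$d(\omega,\omega_0)=\|A-A_0\|+\|B-B_0\|+\int_a^b\left(\left|\tfrac1p-\tfrac1{p_0}\right|+|q-q_0|+|r-r_0|+|s-s_0|\right),$$ with any matrix norm. The Sturm–Liouville problem $\omega$ consists of $-(y^{[1]})'+sy^{[1]}+qy=\lambda ry$ on $J$, where $y^{[1]}=p(y'+sy)$ and solutions have $y,y^{[1]}$ absolutely continuous on $[a,b]$, and $AY(a)+BY(b)=0$ with $Y=(y,y^{[1]})^T$. An eigenvalue is a $\lambda$ with a nontrivial solution (eigenfunction) satisfying the boundary condition; eigenvalues are real and, counted with multiplicity, are ordered as a non-decreasing sequence $\lambda_0,\lambda_1,\ldots\to+\infty$ (algebraic and geometric multiplicities coincide). Normalized means $\int_a^b|w|^2r=1$. Fréchet differentiability in $L^1(J,\mathbb R)$ has the usual meaning.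 For functions of $1/p$ or $r$, let $V=\{f\in L^1(J,\mathbb R):f\ge0\text{ a.e. on }J\}$; a (nonlinear) functional $\lambda_n$ on $V$ (here defined for a.e. positive functions) is called Fréchet differentiable at a point $f_0$ in $V$ if there is a bounded linear functional $F$ such that for $h\in V$, $|\lambda_n(f_0+h)-\lambda_n(f_0)-F(h)|=o(\|h\|_{L^1})$ as $h\to0$; one writes $\lambda_n'(f_0)=F$. *)

(* Defs.v *)
From mathcomp Require Import all_boot all_order all_algebra.
From mathcomp Require Import all_classical all_reals all_analysis.
From mathcomp Require Import complex.

Set Implicit Arguments.
Unset Strict Implicit.
Unset Printing Implicit Defensive.

Import Order.TTheory GRing.Theory Num.Theory numFieldNormedType.Exports.

Local Open Scope classical_set_scope.
Local Open Scope ring_scope.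
Local Open Scope complex_scope.

Notation normc := ComplexField.Normc.normc.

(* Elements of L^1(a,b) are represented by functions on the whole line; only
   their restrictions to ]a, b[, up to null sets, play a role. *)

Definition L1 (R : realType) (a b : R) : set (R -> R) :=
  [set f : R -> R | (@lebesgue_measure R).-integrable `]a, b[ (EFin \o f)].

Definition L1norm (R : realType) (a b : R) (f : R -> R) : R :=
  \int[@lebesgue_measure R]_(x in `]a, b[) `|f x|.

Definition L1nonneg (R : realType) (a b : R) : set (R -> R) :=
  [set f : R -> R | L1 a b f /\
    {ae @lebesgue_measure R, forall x, x \in `]a, b[ -> 0 <= f x}].

Definition bounded_linear_L1 (R : realType) (a b : R)
    (F : (R -> R) -> R) : Prop :=
  (forall (c : R) (f g : R -> R), L1 a b f -> L1 a b g ->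
     F (fun x => c * f x + g x) = c * F f + F g) /\
  (exists M : R, forall f, L1 a b f -> `|F f| <= M * L1norm a b f).

(* [F] is the Frechet derivative at [f0] of the functional [L], the increments
   being taken in [H] ([H := L1 a b] for the usual notion, [H := L1nonneg a b]
   for differentiability in the cone of nonnegative functions). *)
Definition frechet_derivative (R : realType) (a b : R) (H : set (R -> R))
    (L : (R -> R) -> R) (f0 : R -> R) (F : (R -> R) -> R) : Prop :=
  bounded_linear_L1 a b F /\
  forall e : R, 0 < e -> exists2 d : R, 0 < d &
    forall h, H h -> L1norm a b h < d ->
      `|L (fun x => f0 x + h x) - L f0 - F h| <= e * L1norm a b h.

Definition absolutely_continuous (R : realType) (a b : R)
    (f : R -> R[i]) : Prop :=
  forall e : R, 0 < e -> exists2 d : R, 0 < d &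
    forall (m : nat) (u v : 'I_m -> R),
      (forall i, a <= u i /\ u i <= v i /\ v i <= b) ->
      (forall i j, i != j -> v i <= u j \/ v j <= u i) ->
      \sum_i (v i - u i) < d ->
      \sum_i normc (f (v i) - f (u i)) < e.

Definition cderive (R : realType) (f : R -> R[i]) (x : R) : R[i] :=
  derive1 (fun t => complex.Re (f t)) x +i* derive1 (fun t => complex.Im (f t)) x.

(* The component [sl_invp] is the function 1/p. *)
Record sl_problem (R : realType) := SLProblem {
  sl_A : 'M[R[i]]_2;
  sl_B : 'M[R[i]]_2;
  sl_invp : R -> R;
  sl_q : R -> R;
  sl_r : R -> R;
  sl_s : R -> R }.

Definition sl_p (R : realType) (w : sl_problem R) (x : R) : R :=
  (sl_invp w x)^-1.

Definition set_invp (R : realType) (w : sl_problem R) (f : R -> R) :=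
  SLProblem (sl_A w) (sl_B w) f (sl_q w) (sl_r w) (sl_s w).
Definition set_q (R : realType) (w : sl_problem R) (f : R -> R) :=
  SLProblem (sl_A w) (sl_B w) (sl_invp w) f (sl_r w) (sl_s w).
Definition set_r (R : realType) (w : sl_problem R) (f : R -> R) :=
  SLProblem (sl_A w) (sl_B w) (sl_invp w) (sl_q w) f (sl_s w).
Definition set_s (R : realType) (w : sl_problem R) (f : R -> R) :=
  SLProblem (sl_A w) (sl_B w) (sl_invp w) (sl_q w) (sl_r w) f.

Definition symplecticE (R : realType) : 'M[R[i]]_2 :=
  \matrix_(i, j) (if (i == 0) && (j == 1) then -1
                  else if (i == 1) && (j == 0) then 1 else 0).

Definition adjoint_mx (R : realType) (M : 'M[R[i]]_2) : 'M[R[i]]_2 :=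
  map_mx conjc M^T.

Definition Omega (R : realType) (a b : R) : set (sl_problem R) :=
  [set w : sl_problem R | [/\ L1 a b (sl_invp w), L1 a b (sl_q w),
               L1 a b (sl_r w) & L1 a b (sl_s w)] /\
    [/\ {ae @lebesgue_measure R, forall x, x \in `]a, b[ -> 0 < sl_p w x},
        {ae @lebesgue_measure R, forall x, x \in `]a, b[ -> 0 < sl_r w x},
        \rank (row_mx (sl_A w) (sl_B w)) = 2%N &
        sl_A w *m symplecticE R *m adjoint_mx (sl_A w) =
        sl_B w *m symplecticE R *m adjoint_mx (sl_B w)]].

Definition entry_norm (R : realType) (M : 'M[R[i]]_2) : R :=
  \sum_i \sum_j normc (M i j).

Definition sl_dist (R : realType) (a b : R) (w w0 : sl_problem R) : R :=
  entry_norm (sl_A w - sl_A w0) + entry_norm (sl_B w - sl_B w0) +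
  \int[@lebesgue_measure R]_(x in `]a, b[)
    (`|sl_invp w x - sl_invp w0 x| + `|sl_q w x - sl_q w0 x| +
     `|sl_r w x - sl_r w0 x| + `|sl_s w x - sl_s w0 x|).

Definition Omega_nbhs (R : realType) (a b : R) (w : sl_problem R)
    (O : set (sl_problem R)) : Prop :=
  O `<=` Omega a b /\
  exists2 e : R, 0 < e &
    forall rho, Omega a b rho -> sl_dist a b rho w < e -> O rho.

(* [u] is the absolutely continuous representative on [a, b] of the
   quasi-derivative p(y' + sy), which is itself only defined a.e. *)
Definition sl_solution (R : realType) (a b : R) (w : sl_problem R)
    (lam : R[i]) (y u : R -> R[i]) : Prop :=
  [/\ absolutely_continuous a b y,
      absolutely_continuous a b u,
      {ae @lebesgue_measure R, forall x, x \in `]a, b[ ->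
         u x = (sl_p w x)%:C * (cderive y x + (sl_s w x)%:C * y x)} &
      {ae @lebesgue_measure R, forall x, x \in `]a, b[ ->
         - cderive u x + (sl_s w x)%:C * u x + (sl_q w x)%:C * y x =
         lam * (sl_r w x)%:C * y x}].

Definition boundary_vec (R : realType) (y u : R -> R[i]) (t : R) :
    'cV[R[i]]_2 :=
  \col_(i < 2) (if i == 0 then y t else u t).

Definition boundary_condition (R : realType) (a b : R) (w : sl_problem R)
    (y u : R -> R[i]) : Prop :=
  sl_A w *m boundary_vec y u a + sl_B w *m boundary_vec y u b = 0.

Definition eigenfunction (R : realType) (a b : R) (w : sl_problem R)
    (lam : R[i]) (y u : R -> R[i]) : Prop :=
  [/\ sl_solution a b w lam y u, boundary_condition a b w y u &
      exists2 x, x \in `[a, b] & y x != 0].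

Definition is_eigenvalue (R : realType) (a b : R) (w : sl_problem R)
    (lam : R[i]) : Prop :=
  exists y u, eigenfunction a b w lam y u.

Definition eigenspace (R : realType) (a b : R) (w : sl_problem R)
    (lam : R[i]) : set (R -> R[i]) :=
  [set y : R -> R[i] | exists2 u, sl_solution a b w lam y u &
                      boundary_condition a b w y u].

(* The eigenspace, as a space of functions on [a, b], has a basis of [k]
   elements; [k = 0] means that [lam] is not an eigenvalue. *)
Definition multiplicity (R : realType) (a b : R) (w : sl_problem R)
    (lam : R[i]) (k : nat) : Prop :=
  exists f : 'I_k -> R -> R[i],
    [/\ forall i, eigenspace a b w lam (f i),
        forall c : 'I_k -> R[i],
          (forall x, x \in `[a, b] -> \sum_i c i * f i x = 0) ->
          forall i, c i = 0 &
        forall y, eigenspace a b w lam y ->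
          exists c : 'I_k -> R[i],
            forall x, x \in `[a, b] -> y x = \sum_i c i * f i x].

Definition simple_eigenvalue (R : realType) (a b : R) (w : sl_problem R)
    (lam : R[i]) : Prop :=
  is_eigenvalue a b w lam /\ multiplicity a b w lam 1.

(* [l] is the term of index [n] (starting from 0) in the nondecreasing
   enumeration, with multiplicities, of the eigenvalues: [t] is the list of the
   terms of index 0, ..., n. It contains every eigenvalue below [l] exactly as
   often as its multiplicity, and [l] itself at most that often. *)
Definition nth_eigenvalue (R : realType) (a b : R) (w : sl_problem R)
    (n : nat) (l : R) : Prop :=
  exists t : seq R,
    [/\ size t = n.+1, sorted <=%R t, last 0 t = l,
        forall mu : R, mu < l -> multiplicity a b w mu%:C (count_mem mu t) &
        exists2 k, multiplicity a b w l%:C k & (count_mem l t <= k)%N].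

(* There is at most one n-th eigenvalue; 0 is a dummy value. *)
Definition lambda (R : realType) (a b : R) (n : nat) (w : sl_problem R) : R :=
  xget 0 [set l | nth_eigenvalue a b w n l].

(* [R[i]^o] carries the usual topology of the complex plane. *)
Definition simple_closed_curve (R : realType) (G : set R[i]) : Prop :=
  exists g : R -> R[i]^o,
    [/\ {within `[0, 1], continuous g}, g 0 = g 1,
        {in `[0, 1[ &, injective g} & G = g @` `[0, 1]].

(* The points of the bounded component of the complement of the curve. *)
Definition curve_interior (R : realType) (G : set R[i]) : set R[i] :=
  [set z : R[i] | ~ G z /\
    exists M : R, forall u,
      connected_component (~` G : set R[i]^o) z u ->
      normc u <= M].

(* Main.v *)
(* Solutions are combinations Phi c of a fundamental system which depends
   continuously on the coefficients (in L^1) and on lam, and the multiplicity of lam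
   is the nullity of X(lam) = A + B Phi(b, lam).  The Lagrange identity turns X into
   a Hermitian 2 x 2 matrix with the same nullity that is strictly increasing in lam;
   its two ordered eigenvalues are continuous and increasing, so the number of
   eigenvalues in a small interval with regular endpoints is locally constant.
   Together with a lower bound of the spectrum that is uniform near a given problem
   (an energy estimate for fixed A, B), the number of eigenvalues below a regular
   point is locally constant, hence the n-th eigenvalue is continuous.  For an
   eigenfunction z of a nearby problem with eigenvalue mu, the Lagrange identity for
   w and z reads
     (mu - l) Re int r w^* z =
       Re int (- dP w1^* z1 + ds (w^* z1 + w1^* z) + (dq - mu dr) w^* z),
   where P = 1/p and dP, ds, dq, dr are the increments of the coefficients.  Since z
   can be chosen to converge uniformly to w, the derivatives follow. *)

From HB Require Import structures.
Require Import Defs.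
From mathcomp Require Import all_boot all_order all_algebra.
From mathcomp Require Import all_classical all_reals all_analysis.
From mathcomp Require Import complex ring lra measurable_realfun.

Set Implicit Arguments.
Unset Strict Implicit.
Unset Printing Implicit Defensive.

Import Order.TTheory GRing.Theory Num.Theory numFieldNormedType.Exports.

Local Open Scope classical_set_scope.
Local Open Scope ring_scope.
Local Open Scope complex_scope.

(** * Absolutely continuous functions are indefinite integrals *)

(** The index n is the delicate point: when [A] and [B] vary, an eigenvalue may escape to minus
    infinity and shift the whole numbering. The lower bound of the spectrum and the stability of the
    count below a point are therefore stated for problems with the same boundary matrices, whereas
    the curve needs only the count in a small interval and admits every nearby problem. As
    eigenvalues are real, only the real diameter of the disc matters, and increasing real functions
    with the intermediate value theorem replace the zeros of a characteristic determinant. The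
    Hermitian matrix is X (Y + t X)^-1 N, where Y is the complementary boundary expression, N = A
    A^* + B B^* is invertible by the rank condition, and the real t makes Y + t X invertible. A
    given t is only known to work locally, hence charts around each pair of a problem and a lam.
    Absolute continuity is given by epsilon and delta, but the calculus is done with indefinite
    integrals; the passage uses total variations and the Radon-Nikodym theorem. *)

Section RealAC.
Context {R : realType}.
Implicit Types (a b : R) (f g : R -> R).

(** Families are indexed by an arbitrary finite type instead of ['I_m], so that the intervals of
    several partitions form one family indexed by a dependent sum. *)
Definition ac a b f := forall e : R, 0 < e -> exists2 d : R, 0 < d &
  forall (I : finType) (u v : I -> R),
    (forall i, a <= u i /\ u i <= v i /\ v i <= b) ->
    (forall i j, i != j -> v i <= u j \/ v j <= u i) ->
    \sum_i (v i - u i) < d -> \sum_i `|f (v i) - f (u i)| < e.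

Lemma itv_partition_nth_mono a b s i j : itv_partition a b s ->
  (i <= j)%N -> (j <= size s)%N -> nth b (a :: s) i <= nth b (a :: s) j.
Proof.
move=> abs ij js; have := abs => -[/= pas _].
have: sorted <=%R (a :: s) by rewrite /= (sub_path _ pas)// => x y /ltW.
move=> /(sorted_leq_nth le_trans lexx b) H.
by apply: H; rewrite ?inE/= ?ltnS// (leq_trans ij).
Qed.

Lemma itv_partition_sum a b s : itv_partition a b s ->
  \sum_(k < size s) (nth b (a :: s) k.+1 - nth b (a :: s) k) = b - a.
Proof.
move=> abs; rewrite -(big_mkord xpredT (fun k => nth b (a :: s) k.+1 - nth b (a :: s) k)).
rewrite telescope_sumr//= (itv_partition_nth_size b abs).
by [].
Qed.

(* The total variation of [f] over each interval of a family is approximated by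
   a partition; the intervals of all these partitions form one family. *)
Lemma ac_total_variation_sum a b f e : ac a b f -> 0 < e -> exists2 d : R, 0 < d &
  forall (I : finType) (u v : I -> R),
    (forall i, a <= u i /\ u i <= v i /\ v i <= b) ->
    (forall i j, i != j -> v i <= u j \/ v j <= u i) ->
    \sum_i (v i - u i) < d ->
    forall s : I -> seq R, (forall i, itv_partition (u i) (v i) (s i)) ->
    \sum_i variation (u i) (v i) f (s i) < e.
Proof.
move=> H e0; have [d d0 Hd] := H e e0; exists d => // I u v h1 h2 h3 s hs.
pose T := {i : I & 'I_(size (s i))}.
pose p i k := nth (v i) (u i :: s i) k.
pose u' (t : T) := p (tag t) (tagged t).
pose v' (t : T) := p (tag t) (tagged t).+1.
have -> : \sum_i variation (u i) (v i) f (s i) = \sum_(t : T) `|f (v' t) - f (u' t)|.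
  pose F i (k : 'I_(size (s i))) := `|f (p i k.+1) - f (p i k)|.
  rewrite -(@sig_big_dep _ _ _ _ _ xpredT (fun _ => xpredT) F)/=.
  by apply: eq_bigr => i _; rewrite /variation /= big_mkord.
apply: Hd.
- move=> [i k]; rewrite /u' /v' /p/=; have [h4 [h5 h6]] := h1 i.
  split; last split.
  + by apply: (le_trans h4); apply: itv_partition_nth_ge => //; rewrite ltnS ltnW.
  + exact: (@itv_partition_nth_mono _ _ _ k k.+1 (hs i) (leqnSn k) (ltn_ord k)).
  + by apply: le_trans h6; apply: (@itv_partition_nth_le _ _ _ _ _ k.+1) => //; rewrite ltnS.
- move=> [i k] [j l]; rewrite /u' /v' /p/=; have [eij|nij] := eqVneq i j.
    subst j => nkl; have nkl' : (k != l :> nat).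
      by apply: contra nkl => /eqP/val_inj ->.
    have [kl|kl] := ltnP k l.
      by left; apply: (@itv_partition_nth_mono _ _ _ k.+1 l (hs i)) => //; exact: ltnW.
    right; apply: (@itv_partition_nth_mono _ _ _ l.+1 k (hs i)) => //.
      by rewrite ltn_neqAle eq_sym nkl'.
    exact: ltnW.
  move=> _; have [h|h] := h2 _ _ nij; [left|right].
    apply: (@le_trans _ _ (v i)).
      by apply: (@itv_partition_nth_le _ _ _ _ _ k.+1) => //; rewrite ltnS.
    apply: (le_trans h); apply: itv_partition_nth_ge => //.
    by rewrite ltnS ltnW.
  apply: (@le_trans _ _ (v j)).
    by apply: (@itv_partition_nth_le _ _ _ _ _ l.+1) => //; rewrite ltnS.
  apply: (le_trans h); apply: itv_partition_nth_ge => //.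
  by rewrite ltnS ltnW.
- apply: le_lt_trans h3.
  pose F i (k : 'I_(size (s i))) := p i k.+1 - p i k.
  rewrite -(@sig_big_dep _ _ _ _ _ xpredT (fun _ => xpredT) F)/=.
  by apply: ler_sum => i _; rewrite itv_partition_sum.
Qed.

Notation TV := total_variation.

(** For e = 1, every interval shorter than d has variation at most 1; additivity then carries
    finiteness from [a] to [b] in steps of d / 2. *)
Lemma ac_bounded_variation a b f : a <= b -> ac a b f -> bounded_variation a b f.
Proof.
move=> ab acf; have [d d0 Hd] := ac_total_variation_sum acf ltr01.
have small x y : a <= x -> x <= y -> y <= b -> y - x < d -> TV x y f \is a fin_num.
  move=> ax xy yb yxd; apply/bounded_variationP => //.
  exists 1 => _ [s hs <-]; apply/ltW.
  have := @Hd 'I_1 (fun=> x) (fun=> y) _ _ _ (fun=> s) (fun=> hs).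
  rewrite !big_ord1; apply => //.
  by move=> i j; rewrite (ord1 i) (ord1 j) eqxx.
have step n x : a <= x -> x <= b -> x - a < n%:R * (d / 2) -> TV a x f \is a fin_num.
  elim: n x => [|n IH] x ax xb.
    by rewrite mul0r subr_lt0 ltNge ax.
  move=> h; pose y := Num.max a (x - d / 2).
  have ay : a <= y by rewrite le_max lexx.
  have yx : y <= x by rewrite ge_max ax/= lerBlDr lerDl ltW// divr_gt0.
  rewrite (total_variationD f ay yx) fin_numD; apply/andP; split.
    have [->|ya] := eqVneq y a.
      by rewrite total_variationxx.
    apply: IH => //; first exact: le_trans xb.
    have -> : y = x - d / 2.
      by move: ya; rewrite /y maxEle; case: ifP => //; rewrite eqxx.
    move: h; rewrite -addn1 natrD mulrDl mul1r; lra.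
  apply: small => //.
  have : x - d / 2 <= y by rewrite le_max lexx orbT.
  lra.
apply/bounded_variationP => //.
have [n hn] : exists n : nat, b - a < n%:R * (d / 2).
  exists (Num.bound ((b - a) / (d / 2))).
  rewrite -ltr_pdivrMr ?divr_gt0//.
  apply: le_lt_trans (archi_boundP _); first by rewrite lexx.
  by rewrite divr_ge0 ?subr_ge0// divr_ge0// ltW.
exact: step hn.
Qed.

(** The increment of the total variation over an interval is the total variation on that interval,
    and a partition reaches it up to an error [eta]; the partitions chosen for all intervals are
    estimated together. *)
Lemma ac_total_variation a b f : a <= b -> ac a b f ->
  ac a b (fun x => fine (TV a x f)).
Proof.
move=> ab acf e e0; have BV := ac_bounded_variation ab acf.
have e20 : 0 < e / 2 by rewrite divr_gt0.
have [d d0 Hd] := ac_total_variation_sum acf e20; exists d => // I u v h1 h2 h3.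
have fin x y : a <= x -> x <= y -> y <= b -> TV x y f \is a fin_num.
  move=> ax xy yb; apply/bounded_variationP => //.
  by apply: (bounded_variationr ax xy); apply: bounded_variationl BV => //; exact: le_trans xy.
have E i : `|fine (TV a (v i) f) - fine (TV a (u i) f)| = fine (TV (u i) (v i) f).
  have [h4 [h5 h6]] := h1 i.
  rewrite (total_variationD f h4 h5) fineD ?fin//; last exact: le_trans h6.
  rewrite addrC addKr ger0_norm// fine_ge0// total_variation_ge0//.
under eq_bigr do rewrite E.
(* The errors of all intervals add up to at most e / 4; the [+ 1] keeps the denominator positive for
   an empty family. *)
pose eta := (e / 4) / (#|I|%:R + 1).
have eta0 : 0 < eta by rewrite !divr_gt0// ltr_wpDl.
have /choice[s hs] : forall i, exists s, itv_partition (u i) (v i) s /\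
    fine (TV (u i) (v i) f) <= variation (u i) (v i) f s + eta.
  move=> i; have [h4 [h5 h6]] := h1 i.
  have := fin _ _ h4 h5 h6; have [->|uv] := eqVneq (u i) (v i).
    move=> _; exists [::]; split; first by split.
    by rewrite total_variationxx /= addr_ge0// ?variation_ge0// ltW.
  move=> hf; have /= := @ub_ereal_sup_adherent _ ([set x%:E | x in variations (u i) (v i) f]) eta eta0 hf.
  move=> [_ [_ [s hs <-] <-]] h; exists s; split => //.
  rewrite -lee_fin EFinD fineK// -leeBlDr//.
  by apply/ltW: h.
apply: (@le_lt_trans _ _ (\sum_i (variation (u i) (v i) f (s i) + eta))).
  by apply: ler_sum => i _; have [] := hs i.
rewrite big_split/=.
have {}Hd : \sum_i variation (u i) (v i) f (s i) < e / 2.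
  by apply: Hd => // i; have [] := hs i.
have : \sum_(i : I) eta <= e / 4.
  rewrite sumr_const -[leLHS]mulr_natr /eta mulrAC ler_pdivrMr ?ltr_wpDl//.
  rewrite ler_pM2l ?divr_gt0//; lra.
lra.
Qed.

Lemma acB a b f g : ac a b f -> ac a b g -> ac a b (fun x => f x - g x).
Proof.
move=> F G e e0; have e20 : 0 < e / 2 by rewrite divr_gt0.
have [d1 d10 H1] := F _ e20; have [d2 d20 H2] := G _ e20.
exists (Num.min d1 d2); first by rewrite lt_min d10.
move=> I u v h1 h2; rewrite lt_min => /andP[h3 h4].
have := H1 I u v h1 h2 h3; have := H2 I u v h1 h2 h4.
move=> k1 k2; rewrite [e]splitr; apply: le_lt_trans (ltrD k2 k1).
rewrite -big_split/=; apply: ler_sum => i _.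
rewrite (_ : _ - _ - _ = (f (v i) - f (u i)) - (g (v i) - g (u i))); last by ring.
exact: ler_normB.
Qed.

End RealAC.

(** * Densities of monotone absolutely continuous functions *)

Section MonotoneAC.
Context {R : realType}.
Implicit Types (a b : R) (f g : R -> R).
Notation leb := (@lebesgue_measure R).

Lemma measure_itvoo (u v : R) : u <= v -> leb `]u, v[%classic = (v - u)%:E.
Proof.
move=> uv; rewrite lebesgue_measure_itv/= lte_fin.
by move: uv; rewrite le_eqVlt => /predU1P[->|->]; rewrite ?ltxx ?subrr.
Qed.

(** Puts the components of an open set of small measure into the form to which an absolute
    continuity estimate applies; finite measure rules out the unbounded intervals. *)
Lemma open_interval_bounded (X : set R) : open X -> is_interval X ->
  (leb X < +oo)%E -> exists uv : R * R, uv.1 <= uv.2 /\ X = `]uv.1, uv.2[%classic.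
Proof.
move=> oX iX fX; have [X0|/set0P X0] := eqVneq X set0.
  by exists (0, 0); split => //=; rewrite X0 set_itvoo0.
have XE : X = X° by exact/esym/interior_id.
have [hl|hl] := pselect (has_lbound X); have [hu|hu] := pselect (has_ubound X).
- exists (inf X, sup X); split => /=.
    have [x Xx] := X0; apply: (@le_trans _ _ x).
      exact: ge_inf.
    exact: ub_le_sup.
  by rewrite {1}XE interval_bounded_interior.
- move: fX; rewrite XE interval_right_unbounded_interior// -set_itvoy lebesgue_measure_itv/=.
  by rewrite ltry.
- move: fX; rewrite XE interval_left_unbounded_interior// -set_itvNyo lebesgue_measure_itv/=.
  by rewrite ltNyr.
- move: fX; rewrite (interval_unbounded_setT iX hl hu).
  by rewrite -set_itvNyy lebesgue_measure_itv/=.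
Qed.

Lemma lebesgue_stieltjes_itvoc (F : cumulative R R) (u v : R) : u <= v ->
  lebesgue_stieltjes_measure F `]u, v]%classic = (F v - F u)%:E.
Proof.
move=> uv; rewrite /lebesgue_stieltjes_measure/= /measure_extension/=.
rewrite measurable_mu_extE//; last exact: is_ocitv.
exact: wlength_itv_bnd.
Qed.

(** Projection of the line onto [a, b]. Composition with it extends a function on [a, b] by
    constants, as a cumulative function must be defined on the whole line. *)
Definition clamp a b (x : R) := Num.max a (Num.min b x).

Lemma clamp_ge a b x : a <= clamp a b x.
Proof. by rewrite le_max lexx. Qed.

Lemma clamp_le a b x : a <= b -> clamp a b x <= b.
Proof. by move=> ab; rewrite ge_max ab ge_min lexx. Qed.

Lemma clamp_mono a b x y : x <= y -> clamp a b x <= clamp a b y.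
Proof.
move=> xy; rewrite /clamp ge_max le_max lexx/= le_max; apply/orP; right.
by rewrite le_min ge_min lexx/= ge_min xy orbT.
Qed.

Lemma clamp_id a b x : a <= x -> x <= b -> clamp a b x = x.
Proof. by move=> ax xb; rewrite /clamp (min_idPr xb) (max_idPr ax). Qed.

Lemma clamp_dist a b x y : x <= y -> clamp a b y - clamp a b x <= y - x.
Proof.
move=> xy; rewrite /clamp !maxEle !minEle.
by do ![case: ifPn; rewrite -?ltNge]; lra.
Qed.

(* A degenerate interval may be moved to [b, b], where it meets no other one. *)
Lemma ac_clamp a b f : a <= b -> ac a b f -> forall e : R, 0 < e ->
  exists2 d : R, 0 < d & forall (I : finType) (u v : I -> R),
    (forall i, u i <= v i) ->
    (forall i j, i != j -> u i < v i -> u j < v j -> v i <= u j \/ v j <= u i) ->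
    \sum_i (v i - u i) < d ->
    \sum_i `|f (clamp a b (v i)) - f (clamp a b (u i))| < e.
Proof.
move=> ab H e e0; have [d d0 Hd] := H e e0; exists d => // I u v h1 h2 h3.
pose w (x : I -> R) i := if u i < v i then clamp a b (x i) else b.
have wE : \sum_i `|f (clamp a b (v i)) - f (clamp a b (u i))| =
    \sum_i `|f (w v i) - f (w u i)|.
  apply: eq_bigr => i _; rewrite /w; case: ifPn => //.
  by rewrite -leNgt => vu; rewrite (@le_anti _ _ (u i) (v i)) ?h1// !subrr.
rewrite wE; apply: Hd.
- move=> i; rewrite /w; case: ifP => _; last by rewrite ab lexx.
  by rewrite clamp_ge clamp_mono// clamp_le.
- move=> i j ij; rewrite /w; case: ifPn => ci; case: ifPn => cj.
  + by have [h|h] := h2 i j ij ci cj; [left|right]; apply: clamp_mono.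
  + by left; rewrite clamp_le.
  + by right; rewrite clamp_le.
  + by left.
- apply: le_lt_trans h3; apply: ler_sum => i _; rewrite /w.
  by case: ifPn => _; [exact: clamp_dist|rewrite subrr subr_ge0].
Qed.

(** The Lebesgue-Stieltjes measure of the extended function is dominated by Lebesgue measure: a null
    set lies in an open set of measure below d, whose components are disjoint intervals, and
    absolute continuity bounds the total increment over them by e. The density is the Radon-Nikodym
    derivative. *)
Lemma ac_monotone_density a b f : a < b -> ac a b f ->
  {in `[a, b] &, {homo f : x y / x <= y}} ->
  exists g : R -> R, leb.-integrable setT (EFin \o g) /\
    forall x, a <= x -> x <= b -> f x - f a = \int[leb]_(t in `]a, x]) g t.
Proof.
move=> ab acf fmono; have ab' := ltW ab; pose G x := f (clamp a b x).
have Gac := ac_clamp ab' acf.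
have Gmono : nondecreasing G.
  move=> x y xy; apply: fmono; rewrite ?in_itv/= ?clamp_ge ?clamp_le//.
  exact: clamp_mono.
have Gcont : continuous G.
  move=> x; apply/(@cvgrPdist_lt R R^o) => e e0; have [d d0 Hd] := Gac e e0.
  near=> y; have h : `|x - y| < d by near: y; exists d.
  have [yx|xy] := leP y x.
    have := @Hd 'I_1 (fun=> y) (fun=> x) (fun=> yx).
    rewrite !big_ord1; apply; last exact: le_lt_trans (ler_norm _) h.
    by move=> i j; rewrite (ord1 i) (ord1 j) eqxx.
  have := @Hd 'I_1 (fun=> x) (fun=> y) (fun=> ltW xy).
  rewrite !big_ord1 distrC; apply.
    by move=> i j; rewrite (ord1 i) (ord1 j) eqxx.
  by rewrite (le_lt_trans (ler_norm _))// distrC.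
have Grc : forall x, G @ at_right x --> G x.
  by move=> x; apply: cvg_within_filter; exact: Gcont.
pose F : cumulative R R := HB.pack G (isCumulative.Build R _ R G Gmono Grc).
pose mu : {measure set (measurableTypeR R) -> \bar R} := lebesgue_stieltjes_measure F.
have muoc u v : u <= v -> mu `]u, v]%classic = (G v - G u)%:E.
  exact: (@lebesgue_stieltjes_itvoc F).
have dom : content_dominates leb mu.
  move=> A mA A0; apply/eqP; rewrite eq_le measure_ge0 andbT.
  apply/lee_addgt0Pr => e e0; rewrite add0e.
  have [d d0 Hd] := Gac e e0.
  have [] := @lebesgue_regularity_outer R A d mA _ d0; first by rewrite A0.
  move=> U [oU AU Ud].
  have lU : (leb U < d%:E)%E.
    apply: le_lt_trans Ud; rewrite -[leRHS]add0e -[in leRHS]A0.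
    rewrite -[in leLHS](setDUK AU); apply: measureU2 => //.
    by apply: measurableD => //; exact: open_measurable.
  apply: (@le_trans _ _ (mu U)).
    by apply: le_measure; rewrite ?inE//; exact: open_measurable.
  have mU := open_measurable oU.
  pose I := open_disjoint_itv oU.
  have UI := open_disjoint_itv_bigcup oU.
  have oI n : open (I n) by exact: open_disjoint_itv_open.
  have tI : trivIset setT I by exact: open_disjoint_itv_trivIset.
  have fI n : (leb (I n) < +oo)%E.
    apply: le_lt_trans (lt_trans lU (ltry _)); apply: le_measure; rewrite ?inE//.
      exact: open_measurable.
    by rewrite UI; exact: bigcup_sup.
  have /choice[uv huv] : forall n, exists uv : R * R, uv.1 <= uv.2 /\ I n = `]uv.1, uv.2[%classic.
    by move=> n; apply: open_interval_bounded => //; exact: open_disjoint_itv_is_interval.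
  have cvgU : mu \o (fun n => \big[setU/set0]_(i < n.+1) I i) @ \oo --> mu U.
    rewrite UI -bigcup_bigsetU_bigcup; apply: nondecreasing_cvg_mu.
    - by move=> n; apply: bigsetU_measurable => i _; exact: open_measurable.
    - apply: bigcup_measurable => k _; apply: bigsetU_measurable => i _.
      exact: open_measurable.
    - by move=> m n mn; apply/subsetPset; apply: subset_bigsetU.
  have tId (D : set nat) : trivIset D I by exact: sub_trivIset tI.
  (* Absolute continuity speaks of finite families only; continuity from below of the measure passes
     to all components. *)
  suff H n : (mu (\big[setU/set0]_(i < n) I i) <= e%:E)%E.
    rewrite -(cvg_lim _ cvgU)//; apply: lime_le.
      by apply/cvg_ex; exists (mu U).
    by apply: nearW => n; exact: H.
  have mI i : measurable (I i) by exact: open_measurable.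
  rewrite (measure_bigsetU mu mI tI).
  have sl : (\sum_(i < n) ((uv i).2 - (uv i).1)%:E < d%:E)%E.
    apply: le_lt_trans lU.
    apply: (@le_trans _ _ (leb (\big[setU/set0]_(i < n) I i))).
      rewrite (measure_bigsetU leb mI tI); apply: lee_sum => i _.
      have [h1 h2] := huv i; rewrite -measure_itvoo//.
      by rewrite h2.
    apply: le_measure; rewrite ?inE//; first by apply: bigsetU_measurable => i _; exact: mI.
    rewrite UI; move=> x; rewrite -bigcup_mkord => -[k _ Ik]; by exists k.
  apply: (@le_trans _ _ (\sum_(i < n) (G (uv i).2 - G (uv i).1)%:E)%E).
    apply: lee_sum => i _; have [h1 h2] := huv i.
    rewrite -muoc// h2; apply: le_measure; rewrite ?inE//.
    exact: subset_itv_oo_oc.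
  move: sl; rewrite !sumEFin lte_fin lee_fin => sl; apply/ltW.
  apply: le_lt_trans (Hd 'I_n (fun i => (uv i).1) (fun i => (uv i).2) _ _ sl).
  - by apply: ler_sum => i _; rewrite ler_norm.
  - by move=> i; have [] := huv i.
  - move=> i j ij; have [h1 h2] := huv i; have [h3 h4] := huv j.
    have ijn : (i != j :> nat) by apply: contra ij => /eqP/val_inj ->.
    move=> ci cj; apply: contrapT => /not_orP[/negP k1 /negP k2].
    move: k1 k2; rewrite -!ltNge => k1 k2.
    pose x := Num.max (uv i).1 (uv j).1; pose y := Num.min (uv i).2 (uv j).2.
    have xy : x < y by rewrite gt_max !lt_min ci cj k1 k2.
    have [z1 z2] := midf_lt xy.
    move: z1 z2; rewrite gt_max lt_min => /andP[z1 z2] /andP[z3 z4].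
    have : (I i `&` I j) ((x + y) / 2).
      by split; [rewrite h2|rewrite h4]; rewrite /= in_itv/= ?z1 ?z2 ?z3 ?z4.
    by move/trivIsetP : tI => /(_ i j Logic.I Logic.I ijn) ->.
(* The measure is restricted to ]a, b] to become finite, as the Radon-Nikodym theorem is applied to
   a finite measure. *)
have mufin : (mu `]a, b]%classic < +oo)%E by rewrite muoc// ltry.
have mab : measurable (`]a, b]%classic : set (measurableTypeR R)) by exact: measurable_itv.
pose nu : {finite_measure set (measurableTypeR R) -> \bar R}  := @mfrestr _ (measurableTypeR R) R _ mu mab mufin.
have dom' : nu `<< leb.
  apply/null_content_dominatesP => A mA A0; apply/eqP; rewrite eq_le measure_ge0 andbT.
  rewrite -(dom A mA A0); apply: le_measure; rewrite ?inE//.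
  exact: measurableI.
have [g [g0 gfin gint gE]] := @radon_nikodym_sigma_finite _ _ _ leb nu dom'.
exists (fine \o g); have gK : EFin \o (fine \o g) = g.
  by apply/funext => x /=; rewrite fineK.
split; first by rewrite gK.
move=> x ax xb; rewrite /Rintegral; under eq_integral do rewrite fineK//.
rewrite -gE//; have -> : nu `]a, x]%classic = mu `]a, x]%classic.
  by rewrite /nu/= /mfrestr /mrestr setIidl//; apply: subset_itvl; rewrite bnd_simp.
by rewrite muoc// /G !clamp_id// ltW.
Unshelve. all: by end_near. Qed.

End MonotoneAC.

(** * Integrals over open intervals *)

Section Integral.
Context {R : realType}.
Implicit Types (a b x y z : R) (f g h : R -> R).
Notation leb := (@lebesgue_measure R).

Definition intg x y g : R := \int[leb]_(t in `]x, y[) g t.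

Definition aeon a b (P : R -> Prop) := {ae leb, forall x, x \in `]a, b[ -> P x}.

Lemma aeonS a b (P Q : R -> Prop) : (forall x, x \in `]a, b[ -> P x -> Q x) ->
  aeon a b P -> aeon a b Q.
Proof. by move=> PQ; rewrite /aeon; apply: (@filterS _ _ (ae_filter_ringOfSetsType leb)) => x h xab; exact: PQ (h xab). Qed.

Lemma aeonS2 a b (P1 P2 Q : R -> Prop) :
  (forall x, x \in `]a, b[ -> P1 x -> P2 x -> Q x) ->
  aeon a b P1 -> aeon a b P2 -> aeon a b Q.
Proof.
by move=> PQ; rewrite /aeon; apply: (@filterS2 _ _ (ae_filter_ringOfSetsType leb)) => x h1 h2 xab; exact: PQ (h1 xab) (h2 xab).
Qed.

Lemma aeonW a b (P : R -> Prop) : (forall x, x \in `]a, b[ -> P x) -> aeon a b P.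
Proof. by move=> h; apply: aeW. Qed.

Lemma aeon_sub a b c d (P : R -> Prop) : a <= c -> d <= b -> aeon a b P -> aeon c d P.
Proof.
move=> ac db; rewrite /aeon; apply: (@filterS _ _ (ae_filter_ringOfSetsType leb)) => x h; rewrite in_itv/= => /andP[cx xd].
by apply: h; rewrite in_itv/= (le_lt_trans ac)// (lt_le_trans xd).
Qed.

Lemma L1_sub a b c d g : a <= c -> d <= b -> L1 a b g -> L1 c d g.
Proof.
move=> ac db; apply: integrableS => //.
by apply: subset_itv; rewrite bnd_simp.
Qed.

Lemma L1_meas a b g : L1 a b g -> measurable_fun `]a, b[ g.
Proof. by move=> /(measurable_int leb)/measurable_EFinP. Qed.

Lemma L1D a b f g : L1 a b f -> L1 a b g -> L1 a b (fun x => f x + g x).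
Proof. by move=> hf hg; exact: (integrableD _ hf hg). Qed.

Lemma L1Z a b (k : R) f : L1 a b f -> L1 a b (fun x => k * f x).
Proof. by move=> hf; exact: (integrableZl _ k hf). Qed.

Lemma L1N a b f : L1 a b f -> L1 a b (fun x => - f x).
Proof. by move=> hf; exact: (integrableN hf). Qed.

Lemma L1B a b f g : L1 a b f -> L1 a b g -> L1 a b (fun x => f x - g x).
Proof. by move=> hf hg; exact: (L1D hf (L1N hg)). Qed.

Lemma L1_norm a b f : L1 a b f -> L1 a b (fun x => `|f x|).
Proof. by move=> hf; exact: (integrable_norm hf). Qed.

Lemma L1_cst a b (k : R) : L1 a b (fun=> k).
Proof.
apply/integrableP; split; first exact: measurable_cst.
rewrite /= integral_cst//= lebesgue_measure_itv/=; case: ifP => _.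
  by rewrite -EFinD -EFinM ltry.
by rewrite mule0 ltry.
Qed.

Lemma L1_le a b f g : measurable_fun `]a, b[ f -> L1 a b g ->
  (forall x, x \in `]a, b[ -> `|f x| <= `|g x|) -> L1 a b f.
Proof.
move=> mf hg fg; apply: (le_integrable _ _ _ hg) => //.
  exact/measurable_EFinP.
Qed.

Lemma L1_Ml a b f g (M : R) : measurable_fun `]a, b[ f ->
  (forall x, x \in `]a, b[ -> `|f x| <= M) -> L1 a b g ->
  L1 a b (fun x => f x * g x).
Proof.
move=> mf fM hg; apply: (@L1_le _ _ _ (fun x => M * g x)); last 2 first.
- exact: L1Z.
- move=> x xab; rewrite !normrM ler_wpM2r//.
  by apply: (le_trans (fM _ xab)); rewrite ler_norm.
- exact: measurable_funM (L1_meas hg).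
Qed.

Lemma intgD a b f g : L1 a b f -> L1 a b g ->
  intg a b (fun x => f x + g x) = intg a b f + intg a b g.
Proof. by move=> hf hg; rewrite /intg RintegralD. Qed.

Lemma intgB a b f g : L1 a b f -> L1 a b g ->
  intg a b (fun x => f x - g x) = intg a b f - intg a b g.
Proof. by move=> hf hg; rewrite /intg RintegralB. Qed.

Lemma intgZ a b k f : L1 a b f -> intg a b (fun x => k * f x) = k * intg a b f.
Proof. by move=> hf; rewrite /intg RintegralZl. Qed.

Lemma intgN a b f : L1 a b f -> intg a b (fun x => - f x) = - intg a b f.
Proof.
move=> hf; rewrite -mulN1r -intgZ//; congr (intg _ _ _).
by apply/funext => x; rewrite mulN1r.
Qed.

Lemma eq_intg a b f g : (forall x, x \in `]a, b[ -> f x = g x) ->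
  intg a b f = intg a b g.
Proof. by move=> h; apply: eq_Rintegral => x; rewrite inE/=; exact: h. Qed.

Lemma intg_ge0_ae a b f : L1 a b f -> aeon a b (fun x => 0 <= f x) -> 0 <= intg a b f.
Proof.
move=> hf f0; have mf := L1_meas hf; rewrite /intg/Rintegral.
rewrite (@ae_eq_integral _ _ _ leb `]a, b[ (fun x => `|f x|%:E))//.
- by apply/fine_ge0/integral_ge0 => x _; rewrite lee_fin.
- exact/measurable_EFinP.
- apply/measurable_EFinP; exact: measurableT_comp.
- by apply: (@filterS _ _ (ae_filter_ringOfSetsType leb) _ _ _ f0) => x h /= xab; rewrite ger0_norm// h.
Qed.

Lemma le_intg_ae a b f g : L1 a b f -> L1 a b g ->
  aeon a b (fun x => f x <= g x) -> intg a b f <= intg a b g.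
Proof.
move=> hf hg fg; rewrite -subr_ge0 -intgB//; apply: intg_ge0_ae; first exact: L1B.
by apply: aeonS fg => x _; rewrite subr_ge0.
Qed.

Lemma le_intg a b f g : L1 a b f -> L1 a b g ->
  (forall x, x \in `]a, b[ -> f x <= g x) -> intg a b f <= intg a b g.
Proof. by move=> hf hg fg; apply: le_intg_ae => //; apply: aeonW. Qed.

Lemma eq_intg_ae a b f g : L1 a b f -> L1 a b g ->
  aeon a b (fun x => f x = g x) -> intg a b f = intg a b g.
Proof.
move=> hf hg fg; apply/eqP; rewrite eq_le !le_intg_ae//.
  by apply: aeonS fg => x _ ->.
by apply: aeonS fg => x _ ->.
Qed.

Lemma norm_intg a b f : L1 a b f -> `|intg a b f| <= intg a b (fun x => `|f x|).
Proof. by move=> hf; exact: le_normr_Rintegral. Qed.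

Lemma intgxx x g : intg x x g = 0.
Proof. by rewrite /intg set_itv_ge ?bnd_simp ?ltxx// Rintegral_set0. Qed.

Lemma intg_cat x y z g : x <= y -> y <= z -> L1 x z g ->
  intg x z g = intg x y g + intg y z g.
Proof.
move=> xy yz hg.
move: (xy); rewrite le_eqVlt => /predU1P[->|xy']; first by rewrite intgxx add0r.
move: (yz); rewrite le_eqVlt => /predU1P[<-|yz']; first by rewrite intgxx addr0.
rewrite /intg -(@Rintegral_itvB _ _ (BRight x) (BLeft z) y)//.
rewrite [X in X + _]Rintegral_itv_bndo_bndc; first by rewrite addrC subrK.
exact: L1_sub hg.
Qed.

Lemma intg_cst x y k : x <= y -> intg x y (fun=> k) = k * (y - x).
Proof. by move=> xy; rewrite /intg Rintegral_cst//= measure_itvoo. Qed.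

Lemma intg_patch a b x y g : a <= x -> y <= b ->
  intg x y (g \_ `]a, b[) = intg x y g.
Proof.
move=> ax yb; apply: eq_intg => t; rewrite in_itv/= => /andP[xt ty].
by rewrite patchE mem_set//= in_itv/= (le_lt_trans ax)// (lt_le_trans ty).
Qed.

Lemma L1_patchT a b g : L1 a b g -> leb.-integrable setT (EFin \o (g \_ `]a, b[)).
Proof.
move=> hg; rewrite -restrict_EFin; apply/integrable_restrict => //=.
by rewrite setTI.
Qed.

Lemma le_intg_sub a b c d g : a <= c -> c <= d -> d <= b -> L1 a b g ->
  aeon a b (fun x => 0 <= g x) -> intg c d g <= intg a b g.
Proof.
move=> ac cd db hg g0.
have cb := le_trans cd db; have ad := le_trans ac cd.
rewrite (intg_cat ac cb hg) (intg_cat cd db (L1_sub ac (lexx b) hg)).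
rewrite addrCA lerDl addr_ge0// intg_ge0_ae//.
- exact: L1_sub hg.
- exact: aeon_sub g0.
- exact: L1_sub hg.
- exact: aeon_sub g0.
Qed.

End Integral.

(** * Calculus of primitives *)

Section Primitive.
Context {R : realType}.
Implicit Types (a b x y z : R) (f g h F G : R -> R).
Notation leb := (@lebesgue_measure R).

(** The working form of absolute continuity on [a, b]: the function comes with a chosen density, so
    that identities between derivatives become identities between integrands. *)
Definition primitive a b F f : Prop :=
  L1 a b f /\ forall x, a <= x -> x <= b -> F x = F a + intg a x f.

Lemma primitive_sub a b F f x y : primitive a b F f -> a <= x -> x <= y -> y <= b ->
  F y - F x = intg x y f.
Proof.
move=> [hf H] ax xy yb; rewrite (H y) ?(le_trans ax)// (H x)//; last exact: le_trans yb.
rewrite (intg_cat ax xy); last exact: L1_sub hf.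
by rewrite opprD addrACA subrr add0r addrC addKr.
Qed.

Lemma primitive_intg a b f (k : R) : L1 a b f -> primitive a b (fun x => k + intg a x f) f.
Proof. by move=> hf; split => // x ax xb; rewrite intgxx addr0. Qed.

Lemma primitiveD a b F f G g : primitive a b F f -> primitive a b G g ->
  primitive a b (fun x => F x + G x) (fun x => f x + g x).
Proof.
move=> [hf HF] [hg HG]; split; first exact: L1D.
move=> x ax xb; rewrite (HF x)// (HG x)// intgD; first exact: addrACA.
  exact: L1_sub hf.
exact: L1_sub hg.
Qed.

Lemma primitiveZ a b (k : R) F f : primitive a b F f ->
  primitive a b (fun x => k * F x) (fun x => k * f x).
Proof.
move=> [hf HF]; split; first exact: L1Z.
move=> x ax xb; rewrite (HF x)// intgZ; first exact: mulrDr.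
exact: L1_sub hf.
Qed.

Lemma primitiveN a b F f : primitive a b F f ->
  primitive a b (fun x => - F x) (fun x => - f x).
Proof.
move=> /(primitiveZ (-1)); congr primitive; by apply/funext => x; rewrite mulN1r.
Qed.

Lemma primitiveB a b F f G g : primitive a b F f -> primitive a b G g ->
  primitive a b (fun x => F x - G x) (fun x => f x - g x).
Proof. by move=> hF /primitiveN; exact: primitiveD. Qed.

Lemma primitive_cst a b (k : R) : primitive a b (fun=> k) (fun=> 0).
Proof.
split; first exact: L1_cst.
by move=> x ax xb; rewrite intg_cst// mul0r addr0.
Qed.

(** Jordan decomposition: F = T - (T - F) with T the total variation, where both terms are
    nondecreasing and absolutely continuous. *)
Lemma ac_primitive a b F : a < b -> ac a b F -> exists f, primitive a b F f.
Proof.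
move=> ab acF; have ab' := ltW ab.
pose T x := fine (total_variation a x F).
have acT : ac a b T by exact: ac_total_variation.
have BV := ac_bounded_variation ab' acF.
have fin x y : a <= x -> x <= y -> y <= b -> total_variation x y F \is a fin_num.
  move=> ax xy yb; apply/bounded_variationP => //.
  by apply: (bounded_variationr ax xy); apply: bounded_variationl BV => //; exact: le_trans xy.
have TD x y : a <= x -> x <= y -> y <= b -> `|F y - F x| <= T y - T x.
  move=> ax xy yb; rewrite /T (total_variationD F ax xy) fineD ?fin//; last exact: le_trans yb.
  rewrite addrAC subrr add0r -lee_fin fineK ?fin//.
  exact: total_variation_ge.
have monoT : {in `[a, b] &, {homo T : x y / x <= y}}.
  move=> x y; rewrite !in_itv/= => /andP[ax xb] /andP[ay yb] xy.
  rewrite -subr_ge0; apply: le_trans (TD _ _ ax xy yb) => //.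
have monoB : {in `[a, b] &, {homo (fun x => T x - F x) : x y / x <= y}}.
  move=> x y; rewrite !in_itv/= => /andP[ax xb] /andP[ay yb] xy.
  have := TD _ _ ax xy yb; have := ler_norm (F y - F x); lra.
have [g1 [i1 e1]] := ac_monotone_density ab acT monoT.
have [g2 [i2 e2]] := ac_monotone_density ab (acB acT acF) monoB.
have L1g g : leb.-integrable setT (EFin \o g) -> L1 a b g.
  by move=> h; apply: integrableS h.
have [l1 l2] := (L1g _ i1, L1g _ i2).
exists (fun x => g1 x - g2 x); split; first exact: L1B.
move=> x ax xb; have l1' := L1_sub (lexx a) xb l1; have l2' := L1_sub (lexx a) xb l2.
rewrite intgB//.
have := e1 _ ax xb; have := e2 _ ax xb.
rewrite -!Rintegral_itv_bndo_bndc// -!/(intg _ _ _); lra.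
Qed.

(** The integral of |f| over a set is small with the measure of the set; this is applied to the
    union of the intervals, [f] being extended by 0 to the line. *)
Lemma primitive_ac a b F f : a <= b -> primitive a b F f -> ac a b F.
Proof.
move=> ab hF; have [hf _] := hF; move=> e e0.
have [d [d0 Hd]] := integral_normr_continuous (L1_patchT hf) e0.
exists d => // I u v h1 h2 h3.
pose s := enum I; pose J i := `]u i, v i[%classic : set R.
have tJ : trivIset [set` s] J.
  apply/trivIsetP => i j _ _ ij; rewrite -subset0 => x []; rewrite /J/= !in_itv/=.
  move=> /andP[k1 k2] /andP[k3 k4]; have [k|k] := h2 _ _ ij.
    by have := lt_trans (lt_le_trans k2 k) k3; rewrite ltxx.
  by have := lt_trans (lt_le_trans k4 k) k1; rewrite ltxx.
have mJ i : measurable (J i) by exact: measurable_itv.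
pose D := \big[setU/set0]_(i <- s) J i.
have mD : measurable D by apply: bigsetU_measurable.
have lD : (leb D < d%:E)%E.
  have : (leb D = \sum_(i <- s) leb (J i))%E.
    have := @ge0_integral_bigsetU _ _ _ leb I J (cst 1%E) s mJ (enum_uniq I) tJ.
    rewrite /= integral_cst// mul1e => ->//.
    by apply: eq_bigr => i _; have := integral_cst leb (mJ i) 1; rewrite mul1e.
  move=> ->; under eq_bigr => i _.
    rewrite measure_itvoo; last by have [_ []] := h1 i. over.
  by rewrite sumEFin lte_fin big_enum.
have := Hd D mD lD; apply: le_lt_trans.
have patE i x : x \in `]u i, v i[ -> (f \_ `]a, b[) x = f x.
  have [k1 [k2 k3]] := h1 i; rewrite in_itv/= => /andP[k4 k5].
  by rewrite patchE mem_set//= in_itv/= (le_lt_trans k1)// (lt_le_trans k5).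
have -> : \int[leb]_(x in D) `|(f \_ `]a, b[) x| = \sum_i intg (u i) (v i) (fun x => `|f x|).
  rewrite /Rintegral (@integral_bigsetU_EFin _ _ _ leb I J)//; last 2 first.
  - exact: enum_uniq.
  - apply/measurable_EFinP; apply: measurable_funTS; apply: measurableT_comp => //.
    by have /integrableP[/measurable_EFinP] := L1_patchT hf.
  have E i : (\int[leb]_(x in J i) `|(f \_ `]a, b[) x|%:E = (intg (u i) (v i) (fun x => `|f x|))%:E)%E.
    have [k1 [k2 k3]] := h1 i.
    rewrite /intg /Rintegral fineK; last first.
      apply: integrable_fin_num => //=; apply: L1_norm; exact: L1_sub hf.
    by apply: eq_integral => x; rewrite inE/= => /patE ->.
  by under eq_bigr do rewrite E; rewrite sumEFin/= big_enum.
apply: ler_sum => i _; have [k1 [k2 k3]] := h1 i.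
rewrite (primitive_sub hF)//; apply: norm_intg; exact: L1_sub hf.
Qed.

(** The fundamental theorem of calculus is applied to [f] extended by 0 outside ]a, b[; near an
    interior point F coincides with the integral of this extension. *)
Lemma primitive_derive a b F f : primitive a b F f ->
  aeon a b (fun x => derivable F x 1 /\ derive1 F x = f x).
Proof.
move=> [hf HF]; pose g := f \_ `]a, b[.
have gi := L1_patchT hf.
have giy (y : R) : leb.-integrable [set` Interval (BRight a) (BRight y)] (EFin \o g).
  by apply: integrableS gi.
have locg : locally_integrable setT g.
  by apply: open_integrable_locally => //; exact: openT.
have := FTC1 giy locg; rewrite /aeon; apply: (@filterS _ _ (ae_filter_ringOfSetsType leb)) => x H xab.
have := xab; rewrite in_itv/= => /andP[ax xb].
have [|d1 d2] := H; first by [].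
pose G y := F a + \int[leb]_(t in [set` Interval (BRight a) (BRight y)]) g t.
have FG : \near x, F x = G x.
  near=> y; have ay : a < y by near: y; exact: lt_nbhsr.
  have yb : y < b by near: y; exact: lt_nbhsl.
  rewrite (HF y (ltW ay) (ltW yb)) /G; congr (_ + _).
  rewrite -Rintegral_itv_bndo_bndc; last first.
    by apply: integrableS gi.
  by rewrite -(@intg_patch _ a b)// ltW.
have dG : is_derive x 1 G (f x).
  rewrite /G -[f x]add0r; apply: is_deriveD; apply: DeriveDef => //.
  by rewrite -derive1E d2 /g patchE mem_set.
have dF := near_eq_is_derive (filterS (fun _ => @esym _ _ _) FG) dG.
by split; [|rewrite derive1E]; case: dF.
Unshelve. all: by end_near. Qed.

Lemma primitive_unique_ae a b F f g : primitive a b F f -> L1 a b g ->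
  aeon a b (fun x => derive1 F x = g x) -> primitive a b F g.
Proof.
move=> hF hg dF; have [hf HF] := hF; split => // x ax xb; rewrite (HF x)//; congr (_ + _).
apply: eq_intg_ae; [exact: L1_sub hf|exact: L1_sub hg|].
apply: (aeon_sub (lexx a) xb).
by apply: aeonS2 dF (primitive_derive hF) => t _ <- [].
Qed.

(** Reduces finding a density to a computation at points of differentiability, so that the pointwise
    product and chain rules suffice. *)
Lemma ac_primitive_ae a b F g : a < b -> ac a b F -> L1 a b g ->
  aeon a b (fun x => derivable F x 1 -> derive1 F x = g x) -> primitive a b F g.
Proof.
move=> ab acF hg dF; have [f hF] := ac_primitive ab acF.
apply: (primitive_unique_ae hF hg).
by apply: aeonS2 dF (primitive_derive hF) => x _ H [d _]; exact: H.
Qed.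

End Primitive.

(** * Products and exponentials of primitives, Gronwall's inequality *)

Section PrimitiveCalculus.
Context {R : realType}.
Implicit Types (a b x y z : R) (f g h F G : R -> R).
Notation leb := (@lebesgue_measure R).

Lemma primitive_bounded a b F f : primitive a b F f ->
  exists M : R, forall x, a <= x -> x <= b -> `|F x| <= M.
Proof.
move=> hF; have [hf HF] := hF; exists (`|F a| + intg a b (fun x => `|f x|)).
move=> x ax xb; rewrite (HF x)// (le_trans (ler_normD _ _))// lerD2l.
apply: le_trans (norm_intg (L1_sub (lexx a) xb hf)) _.
by apply: le_intg_sub => //; [exact: L1_norm|exact: aeonW].
Qed.

Lemma ac_unif_cont a b F : ac a b F -> forall e : R, 0 < e -> exists2 d : R, 0 < d &
  forall x y, a <= x -> x <= b -> a <= y -> y <= b -> `|x - y| < d -> `|F x - F y| < e.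
Proof.
move=> H e e0; have [d d0 Hd] := H e e0; exists d => //.
suff W x y : a <= x -> x <= y -> y <= b -> `|x - y| < d -> `|F x - F y| < e.
  move=> x y ax xb ay yb; have [xy|/ltW yx] := leP x y; first exact: W.
  by move=> h; rewrite distrC; apply: W => //; rewrite distrC.
move=> ax xy yb; rewrite distrC ger0_norm ?subr_ge0// => xyd.
have := Hd 'I_1 (fun=> x) (fun=> y); rewrite !big_ord1 distrC; apply => //.
by move=> i j; rewrite (ord1 i) (ord1 j) eqxx.
Qed.

Lemma unif_cont_within a b F : (forall e : R, 0 < e -> exists2 d : R, 0 < d &
  forall x y, a <= x -> x <= b -> a <= y -> y <= b -> `|x - y| < d -> `|F x - F y| < e) ->
  {within `[a, b], continuous F}.
Proof.
move=> H; apply/subspace_continuousP => x /=; rewrite in_itv/= => /andP[ax xb].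
apply/(@cvgrPdist_lt _ R^o) => e /H[d d0 Hd]; exists d => //= y xyd.
by rewrite in_itv/= => /andP[ay yb]; exact: Hd.
Qed.

Lemma primitive_within a b F f : a <= b -> primitive a b F f ->
  {within `[a, b], continuous F}.
Proof. by move=> ab /(primitive_ac ab)/ac_unif_cont; exact: unif_cont_within. Qed.

Lemma within_measurable a b F : {within `[a, b], continuous F} ->
  measurable_fun `]a, b[ F.
Proof.
move=> cF; apply: (@measurable_funS _ _ _ _ `[a, b]%classic) => //.
  exact: subset_itv_oo_cc.
by apply: subspace_continuous_measurable_fun => //; exact: measurable_itv.
Qed.

Lemma primitive_meas a b F f : a <= b -> primitive a b F f -> measurable_fun `]a, b[ F.
Proof. by move=> ab hF; apply: within_measurable; exact: primitive_within hF. Qed.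

Lemma primitive_L1M a b F f g : a <= b -> primitive a b F f -> L1 a b g ->
  L1 a b (fun x => F x * g x).
Proof.
move=> ab hF hg; have [M HM] := primitive_bounded hF.
apply: (@L1_Ml _ _ _ _ _ M) => //; first exact: primitive_meas hF.
by move=> x; rewrite in_itv/= => /andP[/ltW ax /ltW xb]; exact: HM.
Qed.

Lemma ac_lipschitz2 a b F G H (K : R) : ac a b F -> ac a b G ->
  (forall u v, a <= u -> u <= v -> v <= b ->
    `|H v - H u| <= K * (`|F v - F u| + `|G v - G u|)) -> ac a b H.
Proof.
move=> hF hG HK e e0; pose L := `|K| + 1.
have L0 : 0 < L by rewrite ltr_wpDl.
have e20 : 0 < e / (2 * L) by rewrite divr_gt0// mulr_gt0.
have [d1 d10 H1] := hF _ e20; have [d2 d20 H2] := hG _ e20.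
exists (Num.min d1 d2); first by rewrite lt_min d10.
move=> I u v h1 h2; rewrite lt_min => /andP[h3 h4].
have := H1 I u v h1 h2 h3; have := H2 I u v h1 h2 h4 => k1 k2.
apply: (@le_lt_trans _ _ (L * (\sum_i `|F (v i) - F (u i)| + \sum_i `|G (v i) - G (u i)|))).
  rewrite -big_split/= mulr_sumr; apply: ler_sum => i _.
  have [k3 [k4 k5]] := h1 i; apply: (le_trans (HK _ _ k3 k4 k5)).
  by rewrite ler_wpM2r// ?addr_ge0// /L ler_wpDr// ler_norm.
have -> : e = L * (e / (2 * L) + e / (2 * L)).
  by field; rewrite gt_eqF.
by rewrite ltr_pM2l// ltrD.
Qed.

Lemma primitiveM a b F f G g : a < b -> primitive a b F f -> primitive a b G g ->
  primitive a b (fun x => F x * G x) (fun x => f x * G x + F x * g x).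
Proof.
move=> ab hF hG; have ab' := ltW ab.
have [M1 HM1] := primitive_bounded hF; have [M2 HM2] := primitive_bounded hG.
apply: ac_primitive_ae => //.
- pose K := `|M1| + `|M2|.
  apply: (@ac_lipschitz2 _ _ F G _ K); [exact: primitive_ac hF|exact: primitive_ac hG|].
  move=> u v au uv vb.
  rewrite (_ : _ - _ = F v * (G v - G u) + (F v - F u) * G u); last by ring.
  rewrite (le_trans (ler_normD _ _))// !normrM addrC mulrDr lerD//.
    rewrite mulrC ler_wpM2r// (le_trans (HM2 _ au (le_trans uv vb)))// /K.
    by rewrite (le_trans (ler_norm _))// lerDr.
  rewrite ler_wpM2r// (le_trans (HM1 _ (le_trans au uv) vb))// /K.
  by rewrite (le_trans (ler_norm _))// lerDl.
- apply: L1D; last by apply: primitive_L1M hF _ => //; exact: hG.1.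
  by under eq_fun do rewrite mulrC; apply: primitive_L1M hG _ => //; exact: hF.1.
- apply: aeonS2 (primitive_derive hF) (primitive_derive hG) => x xab [dF F'] [dG G'] _.
  have iF : is_derive x (1 : R) F (f x) by apply: DeriveDef; [exact: dF|rewrite -derive1E].
  have iG : is_derive x (1 : R) G (g x) by apply: DeriveDef; [exact: dG|rewrite -derive1E].
  have iM := is_deriveM iF iG.
  rewrite derive1E (_ : (fun x0 => _) = F * G)//.
  rewrite (@derive_val _ _ _ _ _ _ _ iM) addrC; congr (_ + _).
  by rewrite mulrC.
Qed.

Lemma expR_lipschitz (M x y : R) : x <= M -> y <= M ->
  `|expR x - expR y| <= expR M * `|x - y|.
Proof.
suff W u v : u <= v -> v <= M -> `|expR v - expR u| <= expR M * `|v - u|.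
  move=> xM yM; have [xy|/ltW yx] := leP x y; last exact: W.
  by rewrite distrC [`|x - y|]distrC; exact: W.
move=> uv vM; rewrite !ger0_norm ?subr_ge0 ?ler_expR//.
apply: (@le_trans _ _ (expR v * (v - u))); last first.
  by rewrite ler_wpM2r ?subr_ge0// ler_expR.
have := expR_ge1Dx (u - v); rewrite expRB ler_pdivlMr ?expR_gt0//; lra.
Qed.

Lemma primitive_exp a b F f : a < b -> primitive a b F f ->
  primitive a b (fun x => expR (F x)) (fun x => f x * expR (F x)).
Proof.
move=> ab hF; have ab' := ltW ab.
have [M HM] := primitive_bounded hF.
have acE : ac a b (fun x => expR (F x)).
  apply: (@ac_lipschitz2 _ _ F F _ (expR M)); [exact: primitive_ac hF|exact: primitive_ac hF|].
  move=> u v au uv vb; apply: le_trans (@expR_lipschitz M _ _ _ _) _.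
  - by apply: le_trans (ler_norm _) _; apply: HM => //; exact: le_trans uv.
  - by apply: le_trans (ler_norm _) _; apply: HM => //; exact: le_trans vb.
  - by rewrite ler_wpM2l ?expR_ge0// lerDl.
apply: ac_primitive_ae => //.
- have [e he] := ac_primitive ab acE.
  by under eq_fun do rewrite mulrC; apply: primitive_L1M he _ => //; exact: hF.1.
- apply: aeonS (primitive_derive hF) => x xab [dF F'] _.
  have iF : is_derive x (1 : R) F (f x) by apply: DeriveDef; [exact: dF|rewrite -derive1E].
  have iE := is_derive1_comp (is_derive_expR (F x)) iF.
  by rewrite derive1E (@derive_val _ _ _ _ _ _ _ iE) mulrC.
Qed.

Lemma primitive_le a b F f x y : primitive a b F f -> aeon a b (fun x => f x <= 0) ->
  a <= x -> x <= y -> y <= b -> F y <= F x.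
Proof.
move=> hF f0 ax xy yb; rewrite -subr_le0 (primitive_sub hF)// -oppr_ge0 -intgN; last first.
  exact: L1_sub ax yb hF.1.
apply: intg_ge0_ae; first by apply: L1N; exact: L1_sub ax yb hF.1.
by apply: (aeon_sub ax yb); apply: aeonS f0 => t _; rewrite oppr_ge0.
Qed.

(** With E = exp(- int m) and G the right-hand side of the hypothesis, the product G E has density m
    E (v - G) <= 0, hence does not exceed its value c at [a]. *)
Lemma gronwall a b (c : R) m v : a < b -> L1 a b m -> (forall x, 0 <= m x) ->
  L1 a b (fun x => m x * v x) ->
  (forall x, a <= x -> x <= b -> v x <= c + intg a x (fun t => m t * v t)) ->
  forall x, a <= x -> x <= b -> v x <= c * expR (intg a x m).
Proof.
move=> ab hm m0 hmv H x ax xb.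
pose E t := expR (0 - intg a t m); pose G t := c + intg a t (fun t => m t * v t).
have hM : primitive a b (fun t => 0 - intg a t m) (fun t => 0 - m t).
  apply: primitiveB; first exact: primitive_cst.
  by have := primitive_intg 0 hm; under eq_fun do rewrite add0r.
have hG : primitive a b G (fun t => m t * v t) by exact: primitive_intg.
have hGE := primitiveM ab hG (primitive_exp ab hM).
have : G x * E x <= G a * E a.
  apply: (primitive_le hGE) => //; apply: aeonW => t; rewrite in_itv/= => /andP[at_ tb].
  rewrite [leLHS](_ : _ = m t * expR (0 - intg a t m) * (v t - G t)); last first.
    by rewrite /G; ring.
  rewrite mulr_ge0_le0 ?mulr_ge0 ?expR_ge0// subr_le0.
  by apply: H; exact: ltW.
rewrite /E /G !intgxx subr0 expR0 mulr1 addr0 sub0r expRN.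
rewrite ler_pdivrMr ?expR_gt0//; apply: le_trans; exact: H.
Qed.

End PrimitiveCalculus.

Section BoundedMeasurable.
Context {R : realType}.
Implicit Types (a b : R) (f g F : R -> R).

(** Multipliers of L^1. The class is closed under the algebraic operations, which settles the
    integrability of all later integrands. *)
Definition bmeas a b f := measurable_fun `]a, b[ f /\
  exists M : R, forall x, x \in `]a, b[ -> `|f x| <= M.

Lemma bmeasD a b f g : bmeas a b f -> bmeas a b g -> bmeas a b (fun x => f x + g x).
Proof.
move=> [mf [M HM]] [mg [N HN]]; split; first exact: measurable_funD.
by exists (M + N) => x xab; rewrite (le_trans (ler_normD _ _))// lerD ?HM ?HN.
Qed.

Lemma bmeasN a b f : bmeas a b f -> bmeas a b (fun x => - f x).
Proof.
move=> [mf [M HM]]; split; first exact: measurableT_comp.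
by exists M => x xab; rewrite normrN HM.
Qed.

Lemma bmeasB a b f g : bmeas a b f -> bmeas a b g -> bmeas a b (fun x => f x - g x).
Proof. by move=> hf /bmeasN; exact: bmeasD. Qed.

Lemma bmeasM a b f g : bmeas a b f -> bmeas a b g -> bmeas a b (fun x => f x * g x).
Proof.
move=> [mf [M HM]] [mg [N HN]]; split; first exact: measurable_funM.
by exists (M * N) => x xab; rewrite normrM ler_pM ?HM ?HN.
Qed.

Lemma bmeas_norm a b f : bmeas a b f -> bmeas a b (fun x => `|f x|).
Proof.
move=> [mf [M HM]]; split; first exact: measurableT_comp.
by exists M => x xab; rewrite normr_id HM.
Qed.

Lemma bmeas_cst a b (k : R) : bmeas a b (fun=> k).
Proof. by split; [exact: measurable_cst|exists `|k|]. Qed.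

Lemma bmeas_L1M a b f g : bmeas a b f -> L1 a b g -> L1 a b (fun x => g x * f x).
Proof.
move=> [mf [M HM]] hg; under eq_fun do rewrite mulrC.
exact: L1_Ml HM hg.
Qed.

Lemma bmeas_primitive a b F f : a <= b -> primitive a b F f -> bmeas a b F.
Proof.
move=> ab hF; split; first exact: primitive_meas hF.
have [M HM] := primitive_bounded hF; exists M => x; rewrite in_itv/= => /andP[ax xb].
by apply: HM; exact: ltW.
Qed.

Lemma bmeas_sub a b c d f : a <= c -> d <= b -> bmeas a b f -> bmeas c d f.
Proof.
move=> ac db [mf [M HM]]; split.
  apply: measurable_funS mf => //; apply: subset_itv; by rewrite bnd_simp.
exists M => x; rewrite in_itv/= => /andP[cx xd]; apply: HM.
by rewrite in_itv/= (le_lt_trans ac)// (lt_le_trans xd).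
Qed.

End BoundedMeasurable.

(** * The linear differential system *)

Section LinearSystem.
Context {R : realType}.
Implicit Types (a b c x : R) (P Q s y u z v : R -> R).

(* For P = 1/p, Q = q - lam r and u = y^[1] this is the equation of the problem. *)
Definition slsys a b P Q s y u :=
  primitive a b y (fun x => P x * u x - s x * y x) /\
  primitive a b u (fun x => s x * u x + Q x * y x).

(** Bounds the operator norm, for |y| + |u|, of the coefficient matrix of the system. *)
Definition slweight P Q s x : R := `|P x| + `|Q x| + `|s x|.

Lemma slweight_ge0 P Q s x : 0 <= slweight P Q s x.
Proof. by rewrite !addr_ge0. Qed.

Lemma slweight_L1 a b P Q s : L1 a b P -> L1 a b Q -> L1 a b s ->
  L1 a b (slweight P Q s).
Proof. by move=> hP hQ hs; apply: L1D; [apply: L1D|]; exact: L1_norm. Qed.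

Lemma sl_rhs_le P Q s x (y u : R) :
  `|P x * u - s x * y| + `|s x * u + Q x * y| <= slweight P Q s x * (`|y| + `|u|).
Proof.
have h1 := ler_normB (P x * u) (s x * y); have h2 := ler_normD (s x * u) (Q x * y).
apply: (le_trans (lerD h1 h2)); rewrite !normrM /slweight.
have := mulr_ge0 (normr_ge0 (P x)) (normr_ge0 y).
have := mulr_ge0 (normr_ge0 (Q x)) (normr_ge0 u).
lra.
Qed.

Lemma intg_sl_le a x P Q s y u : L1 a x P -> L1 a x Q -> L1 a x s ->
  bmeas a x y -> bmeas a x u ->
  `|intg a x (fun t => P t * u t - s t * y t)| +
  `|intg a x (fun t => s t * u t + Q t * y t)| <=
  intg a x (fun t => slweight P Q s t * (`|y t| + `|u t|)).
Proof.
move=> hP hQ hs hy hu.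
have i1 : L1 a x (fun t => P t * u t - s t * y t) by apply: L1B; exact: bmeas_L1M.
have i2 : L1 a x (fun t => s t * u t + Q t * y t) by apply: L1D; exact: bmeas_L1M.
apply: (le_trans (lerD (norm_intg i1) (norm_intg i2))).
rewrite -intgD; [|exact: L1_norm|exact: L1_norm].
apply: le_intg.
- by apply: L1D; exact: L1_norm.
- apply: bmeas_L1M; last exact: slweight_L1.
  by apply: bmeasD; exact: bmeas_norm.
- by move=> t _; exact: sl_rhs_le.
Qed.

(** The intervals of radius 2 K 2^-n around [w n] are nested, and the supremum of their left ends
    lies in all of them. *)
Lemma geometric_limit (w : nat -> R) (K : R) :
  (forall n, `|w n.+1 - w n| <= K * 2^-1 ^+ n) ->
  exists l, forall n, `|l - w n| <= 2 * K * 2^-1 ^+ n.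
Proof.
move=> H; have K0 : 0 <= K by have := H 0%N; rewrite expr0 mulr1; exact: le_trans.
have h2 n : 2^-1 ^+ n.+1 = 2^-1 * 2^-1 ^+ n :> R by rewrite exprS.
have p0 n : 0 <= 2 * K * 2^-1 ^+ n :> R by rewrite !mulr_ge0// exprn_ge0// invr_ge0.
pose lo n := w n - 2 * K * 2^-1 ^+ n; pose up n := w n + 2 * K * 2^-1 ^+ n.
have lo1 n : lo n <= lo n.+1.
  rewrite /lo h2; have := H n; rewrite ler_norml => /andP[h _]; lra.
have up1 n : up n.+1 <= up n.
  rewrite /up h2; have := H n; rewrite ler_norml => /andP[_ h]; lra.
have mlo m k : lo m <= lo (m + k)%N.
  by elim: k => [|k IH]; rewrite ?addn0// addnS; exact: le_trans (lo1 _).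
have mup m k : up (m + k)%N <= up m.
  by elim: k => [|k IH]; rewrite ?addn0// addnS; exact: le_trans (up1 _) IH.
have lu m n : lo m <= up n.
  apply: (le_trans (mlo m n)); apply: le_trans (mup n m); rewrite addnC /lo /up.
  have := p0 (n + m)%N; lra.
exists (sup (range lo)) => n.
have hs : has_sup (range lo).
  by split; [exists (lo 0%N); exists 0%N|exists (up 0%N) => _ [m _ <-]].
rewrite ler_norml; apply/andP; split.
  have : lo n <= sup (range lo) by apply: ub_le_sup; [exact: hs.2|exists n].
  rewrite /lo; lra.
have : sup (range lo) <= up n by apply: ge_sup; [exact: hs.1|move=> _ [m _ <-]].
rewrite /up; lra.
Qed.

Lemma le0_geometric (x K : R) : (forall n, x <= K * 2^-1 ^+ n) -> x <= 0.
Proof.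
move=> H; rewrite leNgt; apply/negP => x0.
have K0 : 0 < K by have := H 0%N; rewrite expr0 mulr1; exact: lt_le_trans.
have [n hn] : exists n : nat, K / x < n%:R.
  by exists (Num.bound (K / x)); apply: archi_boundP; rewrite divr_ge0// ltW.
have n2 : n%:R <= (2 : R) ^+ n by rewrite -natrX ler_nat ltnW// ltn_expl.
have := H n; rewrite exprVn ler_pdivlMr ?exprn_gt0// leNgt => /negP; apply.
move: hn; rewrite ltr_pdivrMr// => /lt_le_trans; apply.
by rewrite mulrC ler_pM2l.
Qed.

Lemma lt_geometric (K e : R) : 0 < e -> exists n, K * 2^-1 ^+ n < e.
Proof.
move=> e0; apply: contrapT => H; suff : e <= 0 by rewrite leNgt e0.
apply: (@le0_geometric _ K) => n; rewrite leNgt; apply/negP => h; apply: H.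
by exists n.
Qed.

Lemma uniform_limit_bmeas a b (w : nat -> R -> R) y K : a <= b ->
  (forall n, exists f, primitive a b (w n) f) ->
  (forall n x, a <= x -> x <= b -> `|y x - w n x| <= K * 2^-1 ^+ n) -> bmeas a b y.
Proof.
move=> ab hw H; split.
  apply: within_measurable; apply: unif_cont_within => e e0.
  have e30 : 0 < e / 3 by rewrite divr_gt0.
  have [n hn] := lt_geometric K e30; have [f hf] := hw n.
  have [d d0 Hd] := ac_unif_cont (primitive_ac ab hf) e30.
  exists d => // x z ax xb az zb /(Hd _ _ ax xb az zb).
  have := H n x ax xb; have := H n z az zb; rewrite !ler_norml !ltr_norml; lra.
have [f hf] := hw 0%N; have [M HM] := primitive_bounded hf.
exists (M + K) => x; rewrite in_itv/= => /andP[/ltW ax /ltW xb].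
have := HM x ax xb; have := H 0%N x ax xb; rewrite expr0 mulr1 !ler_norml; lra.
Qed.

(** Picard iteration in a Bielecki norm: measured against the weight E = exp(2 int m), the integral
    operator halves distances, so the iterates converge on all of [a, b] without subdividing it. *)
Lemma slsys_exists a b P Q s (c1 c2 : R) : a < b ->
  L1 a b P -> L1 a b Q -> L1 a b s ->
  exists y u, [/\ slsys a b P Q s y u, y a = c1 & u a = c2].
Proof.
move=> ab hP hQ hs; have ab' := ltW ab.
have sub f x : L1 a b f -> x <= b -> L1 a x f by move=> h xb; exact: L1_sub h.
pose rhs1 (w : (R -> R) * (R -> R)) t := P t * w.2 t - s t * w.1 t.
pose rhs2 (w : (R -> R) * (R -> R)) t := s t * w.2 t + Q t * w.1 t.
pose T w : (R -> R) * (R -> R) :=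
  (fun x => c1 + intg a x (rhs1 w), fun x => c2 + intg a x (rhs2 w)).
pose bm (w : (R -> R) * (R -> R)) := bmeas a b w.1 /\ bmeas a b w.2.
have Lr w : bm w -> L1 a b (rhs1 w) /\ L1 a b (rhs2 w).
  move=> [h1 h2]; split.
    by apply: L1B; exact: bmeas_L1M.
  by apply: L1D; exact: bmeas_L1M.
have bT w : bm w -> bm (T w).
  by move=> /Lr[h1 h2]; split; apply: (bmeas_primitive ab' (primitive_intg _ _)).
pose d (w w' : (R -> R) * (R -> R)) x := `|w.1 x - w'.1 x| + `|w.2 x - w'.2 x|.
pose m := slweight P Q s; have hm : L1 a b m by exact: slweight_L1.
have dT w w' x : bm w -> bm w' -> a <= x -> x <= b ->
    d (T w) (T w') x <= intg a x (fun t => m t * d w w' t).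
  move=> bw bw' ax xb; have [l1 l2] := Lr _ bw; have [l1' l2'] := Lr _ bw'.
  have := @intg_sl_le a x P Q s (fun t => w.1 t - w'.1 t) (fun t => w.2 t - w'.2 t)
    (sub _ _ hP xb) (sub _ _ hQ xb) (sub _ _ hs xb).
  have bs f : bmeas a b f -> bmeas a x f by exact: bmeas_sub.
  move=> /(_ (bs _ (bmeasB bw.1 bw'.1)) (bs _ (bmeasB bw.2 bw'.2))).
  have e1 : (T w).1 x - (T w').1 x = intg a x (fun t => rhs1 w t - rhs1 w' t).
    by rewrite (@intgB _ _ _ (rhs1 w) (rhs1 w')); [rewrite /T/=; ring|exact: sub|exact: sub].
  have e2 : (T w).2 x - (T w').2 x = intg a x (fun t => rhs2 w t - rhs2 w' t).
    by rewrite (@intgB _ _ _ (rhs2 w) (rhs2 w')); [rewrite /T/=; ring|exact: sub|exact: sub].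
  apply: le_trans; rewrite /d e1 e2 lerD// le_eqVlt; apply/orP; left; apply/eqP;
    congr (`|_|); apply: eq_intg => t _; rewrite /rhs1 /rhs2; ring.
pose W n := iter n T (fun=> c1, fun=> c2).
have bW n : bm (W n).
  elim: n => [|n IH]; last exact: bT.
  by split; exact: bmeas_cst.
(* The factor 2 in the exponent gives int m E = (E - 1) / 2, which is the contraction ratio 1 /
   2. *)
pose E x := expR (2 * (0 + intg a x m)).
have hE : primitive a b E (fun x => 2 * m x * E x).
  by apply: primitive_exp => //; apply: primitiveZ; exact: primitive_intg.
have mg0 x : x <= b -> 0 <= intg a x m.
  move=> xb; apply: intg_ge0_ae; first exact: sub.
  by apply: aeonW => t _; exact: slweight_ge0.
have E1 x : x <= b -> 1 <= E x.
  move=> xb; rewrite /E -[leLHS]expR0 ler_expR mulr_ge0// add0r; exact: mg0.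
have hmE : L1 a b (fun x => m x * E x).
  by apply: bmeas_L1M => //; exact: bmeas_primitive hE.
have EI x : a <= x -> x <= b -> intg a x (fun t => m t * E t) = (E x - 1) / 2.
  have Ea : E a = 1 by rewrite /E intgxx addr0 mulr0 expR0.
  move=> ax xb; rewrite (hE.2 _ ax xb) Ea.
  have -> : intg a x (fun t => 2 * m t * E t) = 2 * intg a x (fun t => m t * E t).
    by rewrite -intgZ; [apply: eq_intg => t _; rewrite mulrA|exact: sub].
  by field.
have [C HC] : exists C, forall x, a <= x -> x <= b -> d (W 1%N) (W 0%N) x <= C.
  have bd : bmeas a b (fun t => d (W 1%N) (W 0%N) t).
    by apply: bmeasD; apply: bmeas_norm; apply: bmeasB; try exact: (bW 1%N).1;
      try exact: (bW 1%N).2; exact: bmeas_cst.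
  have [l1 l2] := Lr _ (bW 0%N).
  have [M1 H1] := primitive_bounded (primitive_intg 0 l1).
  have [M2 H2] := primitive_bounded (primitive_intg 0 l2).
  exists (M1 + M2) => x ax xb.
  have := lerD (H1 _ ax xb) (H2 _ ax xb); rewrite /d /W /= !add0r.
  by rewrite ![_ + intg _ _ _]addrC !addrK.
have C0 : 0 <= C by apply: le_trans (HC a (lexx a) ab'); rewrite addr_ge0.
have dW n x : a <= x -> x <= b -> d (W n.+1) (W n) x <= C * 2^-1 ^+ n * E x.
  elim: n x => [|n IH] x ax xb.
    rewrite expr0 mulr1; apply: (le_trans (HC _ ax xb)).
    by rewrite ler_peMr// E1.
  apply: (le_trans (dT (W n.+1) (W n) x (bW _) (bW _) ax xb)).
  apply: (@le_trans _ _ (intg a x (fun t => C * 2^-1 ^+ n * (m t * E t)))).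
    apply: le_intg.
    - apply: bmeas_L1M; last exact: sub.
      apply: (bmeas_sub (lexx a) xb).
      by apply: bmeasD; apply: bmeas_norm; apply: bmeasB;
        try exact: (bW _).1; exact: (bW _).2.
    - by apply: L1Z; exact: sub.
    - move=> t; rewrite in_itv/= => /andP[ta tx].
      rewrite mulrCA ler_wpM2l ?slweight_ge0// IH ?ltW//; exact: lt_le_trans xb.
  rewrite intgZ; last exact: sub.
  rewrite EI// exprS (_ : C * (2^-1 * _) * _ = C * 2^-1 ^+ n * (E x / 2)); last by field.
  rewrite ler_wpM2l ?mulr_ge0// ?exprn_ge0 ?invr_ge0//; lra.
pose K := C * E b.
have K0 : 0 <= K by rewrite mulr_ge0// ltW// expR_gt0.
have mono x : a <= x -> x <= b -> E x <= E b.
  move=> ax xb; rewrite -subr_ge0 (primitive_sub hE ax xb (lexx b)).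
  apply: intg_ge0_ae; first exact: L1_sub hE.1.
  by apply: aeonW => t _; rewrite !mulr_ge0 ?expR_ge0// slweight_ge0.
have dWK n x : a <= x -> x <= b -> d (W n.+1) (W n) x <= K * 2^-1 ^+ n.
  move=> ax xb; apply: (le_trans (dW n x ax xb)).
  rewrite /K mulrAC; apply: ler_wpM2r; first by rewrite exprn_ge0 ?invr_ge0.
  by apply: ler_wpM2l; [exact: C0|exact: mono].
have lim1 : forall x, exists l, a <= x -> x <= b ->
    forall n, `|l - (W n).1 x| <= 2 * K * 2^-1 ^+ n.
  move=> x; have [ax|nax] := boolP (a <= x); last by exists 0.
  have [xb|nxb] := boolP (x <= b); last by exists 0.
  have [|l hl] := @geometric_limit (fun n => (W n).1 x) K; last by exists l.
  by move=> n; apply: le_trans (dWK n x ax xb); rewrite /d lerDl.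
have lim2 : forall x, exists l, a <= x -> x <= b ->
    forall n, `|l - (W n).2 x| <= 2 * K * 2^-1 ^+ n.
  move=> x; have [ax|nax] := boolP (a <= x); last by exists 0.
  have [xb|nxb] := boolP (x <= b); last by exists 0.
  have [|l hl] := @geometric_limit (fun n => (W n).2 x) K; last by exists l.
  by move=> n; apply: le_trans (dWK n x ax xb); rewrite /d lerDr.
have {lim1}[y hy] := choice lim1; have {lim2}[u hu] := choice lim2.
have pW n : exists f g, primitive a b (W n).1 f /\ primitive a b (W n).2 g.
  case: n => [|n]; first by exists (fun=> 0), (fun=> 0); split; exact: primitive_cst.
  have [l1 l2] := Lr _ (bW n).
  by exists (rhs1 (W n)), (rhs2 (W n)); split; exact: primitive_intg.
have byu : bm (y, u).
  split.
    apply: (@uniform_limit_bmeas _ _ (fun n => (W n).1) _ (2 * K)) => // [n|n x ax xb].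
      by have [f [g [hf _]]] := pW n; exists f.
    exact: hy.
  apply: (@uniform_limit_bmeas _ _ (fun n => (W n).2) _ (2 * K)) => // [n|n x ax xb].
    by have [f [g [_ hg]]] := pW n; exists g.
  exact: hu.
(* [T (W n)] is the next iterate, hence close to (y, u), and it is also close to T (y, u); both
   errors decay geometrically. *)
have fixT x : a <= x -> x <= b -> d (y, u) (T (y, u)) x <= 0.
  move=> ax xb; pose L := intg a b m.
  apply: (@le0_geometric _ (4 * K + 4 * K * L)) => n.
  have t1 : d (T (W n)) (T (y, u)) x <= 4 * K * L * 2^-1 ^+ n.
    apply: (le_trans (dT (W n) (y, u) x (bW _) byu ax xb)).
    apply: (@le_trans _ _ (intg a x (fun t => 4 * K * 2^-1 ^+ n * m t))).
      apply: le_intg.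
      - apply: bmeas_L1M; last exact: sub.
        apply: (bmeas_sub (lexx a) xb).
        by apply: bmeasD; apply: bmeas_norm; apply: bmeasB;
        [exact: (bW _).1|exact: byu.1|exact: (bW _).2|exact: byu.2].
      - by apply: L1Z; exact: sub.
      - move=> t; rewrite in_itv/= => /andP[/ltW ta tx].
        have tb : t <= b by apply: ltW; exact: lt_le_trans xb.
        rewrite mulrC ler_wpM2r ?slweight_ge0//.
        have := hy t ta tb n; have := hu t ta tb n.
        rewrite distrC => h1; rewrite distrC => h2; rewrite /d/=; lra.
    rewrite intgZ; last exact: sub.
    rewrite [leRHS]mulrAC ler_wpM2l ?mulr_ge0 ?expR_ge0 ?exprn_ge0 ?invr_ge0//.
    by apply: le_intg_sub => //; apply: aeonW => t _; exact: slweight_ge0.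
  have := hy x ax xb n.+1; have := hu x ax xb n.+1; move: t1.
  have h2 : 2^-1 ^+ n.+1 = 2^-1 * 2^-1 ^+ n :> R by rewrite exprS.
  rewrite h2 -[W n.+1]/(T (W n)) /d.
  have k1 := ler_distD ((T (W n)).1 x) ((y,u).1 x) ((T (y, u)).1 x).
  have k2 := ler_distD ((T (W n)).2 x) ((y,u).2 x) ((T (y, u)).2 x).
  have p0 : 0 <= 2 * K * 2^-1 ^+ n :> R.
    by apply: mulr_ge0; [exact: mulr_ge0|rewrite exprn_ge0// invr_ge0].
  move: k1 k2; rewrite /=; lra.
have [l1 l2] := Lr _ byu.
have fix1 x : a <= x -> x <= b -> y x = (T (y, u)).1 x /\ u x = (T (y, u)).2 x.
  move=> ax xb; have := fixT x ax xb; rewrite /d/= => h; split; apply/eqP;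
  rewrite -subr_eq0 -normr_le0; apply: le_trans h; by rewrite ?lerDl ?lerDr.
have [ya ua] : y a = c1 /\ u a = c2.
  by have [-> ->] := fix1 a (lexx a) ab'; rewrite /T/= !intgxx !addr0.
exists y, u; split => //; split; split => // x ax xb.
  by have [-> _] := fix1 x ax xb; rewrite ya.
by have [_ ->] := fix1 x ax xb; rewrite ua.
Qed.

Lemma slsys_bmeas a b P Q s y u : a <= b -> slsys a b P Q s y u ->
  bmeas a b y /\ bmeas a b u.
Proof. by move=> ab [h1 h2]; split; [exact: bmeas_primitive h1|exact: bmeas_primitive h2]. Qed.

Lemma slsys_lin a b P Q s y u y' u' (k k' : R) :
  slsys a b P Q s y u -> slsys a b P Q s y' u' ->
  slsys a b P Q s (fun x => k * y x + k' * y' x) (fun x => k * u x + k' * u' x).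
Proof.
move=> [h1 h2] [h1' h2']; split.
  have := primitiveD (primitiveZ k h1) (primitiveZ k' h1'); congr primitive.
  by apply/funext => x; ring.
have := primitiveD (primitiveZ k h2) (primitiveZ k' h2'); congr primitive.
by apply/funext => x; ring.
Qed.

Definition coef_dist a b P Q s P' Q' s' : R :=
  intg a b (slweight (fun x => P' x - P x) (fun x => Q' x - Q x) (fun x => s' x - s x)).

(** The difference of the two solutions satisfies the perturbed system ([f1], [f2]) with an
    inhomogeneity made of the coefficient differences times (y, u) ([g1], [g2]). Its integral is at
    most B times the coefficient distance, and Gronwall's inequality concludes. *)
Lemma slsys_dependence a b P Q s P' Q' s' y u y' u' (B : R) : a < b ->
  L1 a b P -> L1 a b Q -> L1 a b s -> L1 a b P' -> L1 a b Q' -> L1 a b s' ->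
  slsys a b P Q s y u -> slsys a b P' Q' s' y' u' ->
  (forall x, a <= x -> x <= b -> `|y x| + `|u x| <= B) ->
  forall x, a <= x -> x <= b ->
  `|y' x - y x| + `|u' x - u x| <=
   (`|y' a - y a| + `|u' a - u a| + B * coef_dist a b P Q s P' Q' s') *
   expR (intg a b (slweight P' Q' s')).
Proof.
move=> ab hP hQ hs hP' hQ' hs' [p1 p2] [p1' p2'] HB x0 ax0 x0b; have ab' := ltW ab.
have [by_ bu] : bmeas a b y /\ bmeas a b u by exact: slsys_bmeas ab' (conj p1 p2).
have [by' bu'] : bmeas a b y' /\ bmeas a b u' by exact: slsys_bmeas ab' (conj p1' p2').
set D := coef_dist _ _ _ _ _ _ _ _.
pose v x := `|y' x - y x| + `|u' x - u x|.
have bv : bmeas a b v by apply: bmeasD; apply: bmeas_norm; exact: bmeasB.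
pose m := slweight P' Q' s'; have hm : L1 a b m by exact: slweight_L1.
pose dm := slweight (fun x => P' x - P x) (fun x => Q' x - Q x) (fun x => s' x - s x).
have hdm : L1 a b dm by apply: slweight_L1; exact: L1B.
pose c := `|y' a - y a| + `|u' a - u a| + B * D.
have D0 : 0 <= D.
  by apply: intg_ge0_ae => //; apply: aeonW => t _; exact: slweight_ge0.
have B0 : 0 <= B by apply: le_trans (HB a (lexx a) ab'); rewrite addr_ge0.
have c0 : 0 <= c by rewrite !addr_ge0// mulr_ge0.
have H x : a <= x -> x <= b -> v x <= c + intg a x (fun t => m t * v t).
  move=> ax xb.
  have sub f : L1 a b f -> L1 a x f by move=> h; exact: L1_sub h.
  have bs f : bmeas a b f -> bmeas a x f by exact: bmeas_sub.
  pose f1 t := P' t * (u' t - u t) - s' t * (y' t - y t).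
  pose f2 t := s' t * (u' t - u t) + Q' t * (y' t - y t).
  pose g1 t := (P' t - P t) * u t - (s' t - s t) * y t.
  pose g2 t := (s' t - s t) * u t + (Q' t - Q t) * y t.
  have lf1 : L1 a x f1 by apply/sub; apply: L1B; apply: bmeas_L1M => //; exact: bmeasB.
  have lf2 : L1 a x f2 by apply/sub; apply: L1D; apply: bmeas_L1M => //; exact: bmeasB.
  have lg1 : L1 a x g1 by apply/sub; apply: L1B; apply: bmeas_L1M => //; exact: L1B.
  have lg2 : L1 a x g2 by apply/sub; apply: L1D; apply: bmeas_L1M => //; exact: L1B.
  have e1 : y' x - y x = (y' a - y a) + (intg a x f1 + intg a x g1).
    rewrite -intgD// (p1.2 x)// (p1'.2 x)// opprD addrACA; congr (_ + _).
    rewrite -intgB; [|exact: sub p1'.1|exact: sub p1.1].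
    by apply: eq_intg => t _; rewrite /f1 /g1; ring.
  have e2 : u' x - u x = (u' a - u a) + (intg a x f2 + intg a x g2).
    rewrite -intgD// (p2.2 x)// (p2'.2 x)// opprD addrACA; congr (_ + _).
    rewrite -intgB; [|exact: sub p2'.1|exact: sub p2.1].
    by apply: eq_intg => t _; rewrite /f2 /g2; ring.
  have k1 := @intg_sl_le a x P' Q' s' (fun t => y' t - y t) (fun t => u' t - u t)
    (sub _ hP') (sub _ hQ') (sub _ hs') (bs _ (bmeasB by' by_)) (bs _ (bmeasB bu' bu)).
  have k2 := @intg_sl_le a x (fun t => P' t - P t) (fun t => Q' t - Q t) (fun t => s' t - s t) y u
    (sub _ (L1B hP' hP)) (sub _ (L1B hQ' hQ)) (sub _ (L1B hs' hs)) (bs _ by_) (bs _ bu).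
  have k3 : intg a x (fun t => dm t * (`|y t| + `|u t|)) <= B * D.
    apply: (@le_trans _ _ (intg a x (fun t => B * dm t))).
      apply: le_intg.
      - apply: bmeas_L1M; last exact: sub.
        by apply/bs; apply: bmeasD; exact: bmeas_norm.
      - by apply: L1Z; exact: sub.
      - move=> t; rewrite in_itv/= => /andP[at_ tx].
        rewrite mulrC ler_wpM2r ?slweight_ge0// HB ?ltW//; exact: lt_le_trans xb.
    rewrite intgZ; last exact: sub.
    rewrite ler_wpM2l//; apply: le_intg_sub => //.
    by apply: aeonW => t _; exact: slweight_ge0.
  rewrite /v {1}e1 {1}e2 /c.
  have n1 := ler_normD (y' a - y a) (intg a x f1 + intg a x g1).
  have n2 := ler_normD (u' a - u a) (intg a x f2 + intg a x g2).
  have n3 := ler_normD (intg a x f1) (intg a x g1).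
  have n4 := ler_normD (intg a x f2) (intg a x g2).
  move: k1 k2 k3; rewrite -/f1 -/f2 -/g1 -/g2 -/m -/dm; lra.
have := gronwall ab hm (fun x => slweight_ge0 P' Q' s' x) (bmeas_L1M bv hm) H ax0 x0b.
move=> /le_trans; apply; apply: (ler_wpM2l c0).
rewrite ler_expR; apply: le_intg_sub => //.
by apply: aeonW => t _; exact: slweight_ge0.
Qed.

Lemma slsys_unique a b P Q s y u y' u' : a < b ->
  L1 a b P -> L1 a b Q -> L1 a b s ->
  slsys a b P Q s y u -> slsys a b P Q s y' u' -> y' a = y a -> u' a = u a ->
  forall x, a <= x -> x <= b -> y' x = y x /\ u' x = u x.
Proof.
move=> ab hP hQ hs h h' ey eu x ax xb.
have [M1 H1] := primitive_bounded h.1; have [M2 H2] := primitive_bounded h.2.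
have := @slsys_dependence a b P Q s P Q s y u y' u' (M1 + M2) ab hP hQ hs hP hQ hs h h'.
move=> /(_ (fun x ax xb => lerD (H1 x ax xb) (H2 x ax xb)) x ax xb).
have -> : coef_dist a b P Q s P Q s = 0.
  rewrite /coef_dist (@eq_intg _ _ _ _ (fun=> 0)) ?intg_cst ?mul0r ?ltW//.
  by move=> t _; rewrite /slweight !subrr normr0 !addr0.
rewrite ey eu !subrr normr0 mulr0 !addr0 mul0r => h0.
by split; apply/eqP; rewrite -subr_eq0 -normr_le0; apply: le_trans h0; rewrite ?lerDl ?lerDr.
Qed.

End LinearSystem.

(** * The Lagrange identity and the reduction to real systems *)

Section Lagrange.
Context {R : realType}.
Implicit Types (a b c x : R) (P Q s y u z v : R -> R).

(** In the derivative of the bracket y v - u z only differences of coefficients survive. The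
    identity serves twice: for one problem at two parameters, and for two neighbouring problems. *)
Lemma slsys_lagrange a b P Q s P' Q' s' y u z v : a < b ->
  slsys a b P Q s y u -> slsys a b P' Q' s' z v ->
  let I x := (P x - P' x) * (u x * v x) + (s' x - s x) * (y x * v x + u x * z x) +
             (Q' x - Q x) * (y x * z x) in
  L1 a b I /\
  (y b * v b - u b * z b) - (y a * v a - u a * z a) = intg a b I.
Proof.
move=> ab [py pu] [pz pv] I.
have h := primitiveB (primitiveM ab py pv) (primitiveM ab pu pz).
rewrite -(_ : (fun x => ((P x * u x - s x * y x) * v x + y x * (s' x * v x + Q' x * z x)) -
  ((s x * u x + Q x * y x) * z x + u x * (P' x * v x - s' x * z x))) = I); last first.
  by apply/funext => x; rewrite /I; ring.
split; first exact: h.1.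
exact: (primitive_sub h (lexx a) (ltW ab) (lexx b)).
Qed.

Lemma Re_le_normc (w : R[i]) : `|complex.Re w| <= normc w.
Proof. by case: w => x y /=; rewrite -sqrtr_sqr ler_wsqrtr// lerDl sqr_ge0. Qed.

Lemma Im_le_normc (w : R[i]) : `|complex.Im w| <= normc w.
Proof. by case: w => x y /=; rewrite -sqrtr_sqr ler_wsqrtr// lerDr sqr_ge0. Qed.

Lemma normc_ge0 (w : R[i]) : 0 <= normc w.
Proof. by case: w => x y /=; exact: sqrtr_ge0. Qed.

Lemma normc_le_ReIm (w : R[i]) : normc w <= `|complex.Re w| + `|complex.Im w|.
Proof.
case: w => x y /=; rewrite -[leRHS]ger0_norm ?addr_ge0// -sqrtr_sqr ler_wsqrtr//.
by rewrite sqrrD !real_normK ?num_real// addrAC lerDl mulrn_wge0// mulr_ge0.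
Qed.

Lemma ac_of_ord a b (f : R -> R) : (forall e : R, 0 < e -> exists2 d : R, 0 < d &
    forall (m : nat) (u v : 'I_m -> R),
      (forall i, a <= u i /\ u i <= v i /\ v i <= b) ->
      (forall i j, i != j -> v i <= u j \/ v j <= u i) ->
      \sum_i (v i - u i) < d -> \sum_i `|f (v i) - f (u i)| < e) -> ac a b f.
Proof.
move=> H e /H[d d0 Hd]; exists d => // I u v h1 h2 h3.
have E (g : I -> R) : \sum_i g i = \sum_(k < #|I|) g (enum_val k).
  by rewrite (reindex (@enum_val I xpredT))//; apply: onW_bij; exact: enum_val_bij.
rewrite E; apply: (Hd _ (u \o enum_val) (v \o enum_val)) => /=.
- by move=> i; exact: h1.
- by move=> i j ij; apply: h2; rewrite (inj_eq enum_val_inj).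
- by rewrite -(E (fun i => v i - u i)).
Qed.

Lemma absolutely_continuous_parts a b (f : R -> R[i]) : absolutely_continuous a b f ->
  ac a b (fun x => complex.Re (f x)) /\ ac a b (fun x => complex.Im (f x)).
Proof.
move=> H; split; apply: ac_of_ord => e /H[d d0 Hd]; exists d => // m u v h1 h2 h3;
  apply: le_lt_trans (Hd m u v h1 h2 h3); apply: ler_sum => i _; rewrite -raddfB.
  exact: Re_le_normc.
exact: Im_le_normc.
Qed.

Lemma absolutely_continuous_of_parts a b (f : R -> R[i]) :
  ac a b (fun x => complex.Re (f x)) -> ac a b (fun x => complex.Im (f x)) ->
  absolutely_continuous a b f.
Proof.
move=> h1 h2 e e0; have e20 : 0 < e / 2 by rewrite divr_gt0.
have [d1 d10 H1] := h1 _ e20; have [d2 d20 H2] := h2 _ e20.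
exists (Num.min d1 d2); first by rewrite lt_min d10.
move=> m u v k1 k2; rewrite lt_min => /andP[k3 k4].
have := ltrD (H1 _ u v k1 k2 k3) (H2 _ u v k1 k2 k4); rewrite -splitr.
apply: le_lt_trans; rewrite -big_split/=; apply: ler_sum => i _.
by rewrite -!raddfB; exact: normc_le_ReIm.
Qed.

Lemma ac_bmeas a b (f : R -> R) : a < b -> ac a b f -> bmeas a b f.
Proof. by move=> ab /(ac_primitive ab)[g]; apply: bmeas_primitive; exact: ltW. Qed.

Lemma L1_coef a b (w : sl_problem R) : Omega a b w ->
  [/\ L1 a b (sl_invp w), L1 a b (sl_q w), L1 a b (sl_r w) & L1 a b (sl_s w)].
Proof. by case. Qed.

Lemma L1_potential a b (w : sl_problem R) (lam : R) : Omega a b w ->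
  L1 a b (fun x => sl_q w x - lam * sl_r w x).
Proof. by move=> /L1_coef[_ hq hr _]; apply: L1B => //; exact: L1Z. Qed.

Definition slreal a b (w : sl_problem R) (lam : R) y u :=
  slsys a b (sl_invp w) (fun x => sl_q w x - lam * sl_r w x) (sl_s w) y u.

(** A non-real parameter al + i be couples the real and imaginary parts through be. This form is
    what shows that eigenvalues are real; for be = 0 the parts decouple into two real systems. *)
Lemma sl_solution_parts a b (w : sl_problem R) (al be : R) (y u : R -> R[i]) :
  a < b -> Omega a b w -> sl_solution a b w (al +i* be) y u ->
  let y1 x := complex.Re (y x) in let y2 x := complex.Im (y x) in
  let u1 x := complex.Re (u x) in let u2 x := complex.Im (u x) in
  let P := sl_invp w in let s := sl_s w in let q := sl_q w in let r := sl_r w in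
  [/\ primitive a b y1 (fun x => P x * u1 x - s x * y1 x),
      primitive a b y2 (fun x => P x * u2 x - s x * y2 x),
      primitive a b u1 (fun x => s x * u1 x + (q x - al * r x) * y1 x + be * (r x * y2 x)) &
      primitive a b u2 (fun x => s x * u2 x + (q x - al * r x) * y2 x - be * (r x * y1 x))].
Proof.
move=> ab hw [acy acu e1 e2] y1 y2 u1 u2 P s q r.
have [hP hq hr hs] := L1_coef hw; have hQ := L1_potential al hw.
have [ay1 ay2] := absolutely_continuous_parts acy.
have [au1 au2] := absolutely_continuous_parts acu.
have [[by1 by2] [bu1 bu2]] :=
  ((ac_bmeas ab ay1, ac_bmeas ab ay2), (ac_bmeas ab au1, ac_bmeas ab au2)).
have [_ [p0 _ _ _]] := hw.
(* Since 1/p > 0 almost everywhere, u = p (y' + s y) can be solved for y'. *)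
have E1 : aeon a b (fun x => derive1 y1 x = P x * u1 x - s x * y1 x /\
    derive1 y2 x = P x * u2 x - s x * y2 x).
  apply: aeonS2 e1 p0 => x _; rewrite /sl_p /cderive /u1 /u2 /y1 /y2.
  set d1 := derive1 _ x; set d2 := derive1 _ x.
  case: (u x) => a1 a2; case: (y x) => b1 b2 /= [h1 h2] /[!invr_gt0] P0.
  have PN : P x != 0 by rewrite gt_eqF.
  by rewrite h1 h2; split; rewrite /P /s; field.
have E2 : aeon a b (fun x => derive1 u1 x = s x * u1 x + (q x - al * r x) * y1 x + be * (r x * y2 x) /\
    derive1 u2 x = s x * u2 x + (q x - al * r x) * y2 x - be * (r x * y1 x)).
  apply: aeonS e2 => x _; rewrite /cderive /u1 /u2 /y1 /y2.
  set d1 := derive1 _ x; set d2 := derive1 _ x.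
  case: (u x) => a1 a2; case: (y x) => b1 b2 /= [h1 h2].
  rewrite /s /q /r; split; lra.
split; apply: ac_primitive_ae => //.
- by apply: L1B; exact: bmeas_L1M.
- by apply: aeonS E1 => x _ [].
- by apply: L1B; exact: bmeas_L1M.
- by apply: aeonS E1 => x _ [].
- by apply: L1D; [apply: L1D; exact: bmeas_L1M|apply: L1Z; exact: bmeas_L1M].
- by apply: aeonS E2 => x _ [].
- by apply: L1B; [apply: L1D; exact: bmeas_L1M|apply: L1Z; exact: bmeas_L1M].
- by apply: aeonS E2 => x _ [].
Qed.

Lemma sl_solution_real a b (w : sl_problem R) (lam : R) (y u : R -> R[i]) :
  a < b -> Omega a b w -> sl_solution a b w lam%:C y u <->
  slreal a b w lam (fun x => complex.Re (y x)) (fun x => complex.Re (u x)) /\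
  slreal a b w lam (fun x => complex.Im (y x)) (fun x => complex.Im (u x)).
Proof.
move=> ab hw; split.
  move=> /(sl_solution_parts ab hw)[h1 h2 h3 h4]; split; split => //.
    by move: h3; congr primitive; apply/funext => x; rewrite mul0r addr0.
  by move: h4; congr primitive; apply/funext => x; rewrite mul0r subr0.
move=> [[h1 h2] [h3 h4]]; have ab' := ltW ab.
have [_ [p0 _ _ _]] := hw.
split.
- by apply: absolutely_continuous_of_parts; [exact: primitive_ac h1|exact: primitive_ac h3].
- by apply: absolutely_continuous_of_parts; [exact: primitive_ac h2|exact: primitive_ac h4].
- have D := aeonS2 _ (primitive_derive h1) (primitive_derive h3).
  apply: aeonS2 p0 (D _ (fun x _ h h' => conj h.2 h'.2)) => x _.
  rewrite /sl_p /cderive; set d1 := derive1 _ x; set d2 := derive1 _ x.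
  rewrite invr_gt0 => P0 [-> ->]; have PN : sl_invp w x != 0 by rewrite gt_eqF.
  case: (u x) => a1 a2; case: (y x) => b1 b2 /=.
  by apply/eqP; rewrite eq_complex/=; apply/andP; split; apply/eqP; field.
- have D := aeonS2 _ (primitive_derive h2) (primitive_derive h4).
  apply: aeonS (D _ (fun x _ h h' => conj h.2 h'.2)) => x _.
  rewrite /cderive; set d1 := derive1 _ x; set d2 := derive1 _ x.
  move=> [-> ->]; case: (u x) => a1 a2; case: (y x) => b1 b2 /=.
  by apply/eqP; rewrite eq_complex/=; apply/andP; split; apply/eqP; ring.
Qed.

End Lagrange.

(** * Fundamental solutions and the filter of nearby problems *)

Section Fundamental.
Context {R : realType}.
Implicit Types (a b c x lam : R) (P Q s y u z v : R -> R) (w rho : sl_problem R).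
Notation leb := (@lebesgue_measure R).

(** A chosen solution of the initial value problem at [a]; for problems in [Omega] one exists, so
    the default pair of zero functions is never a fallback there. *)
Definition ivp a b w lam (c1 c2 : R) : (R -> R) * (R -> R) :=
  xget (cst 0, cst 0) [set yu | [/\ slreal a b w lam yu.1 yu.2, yu.1 a = c1 & yu.2 a = c2]].

Lemma ivpP a b w lam c1 c2 : a < b -> Omega a b w ->
  [/\ slreal a b w lam (ivp a b w lam c1 c2).1 (ivp a b w lam c1 c2).2,
      (ivp a b w lam c1 c2).1 a = c1 & (ivp a b w lam c1 c2).2 a = c2].
Proof.
move=> ab hw; have [hP hq hr hs] := L1_coef hw.
have [y [u h]] := slsys_exists c1 c2 ab hP (L1_potential lam hw) hs.
rewrite /ivp; case: xgetP => [yu _ //|/(_ (y, u))]; by case.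
Qed.

(** [fy] and [fu] are the two rows of the fundamental matrix that equals the identity at [a]. *)
Definition fy a b w lam (j : 'I_2) : R -> R := (ivp a b w lam (j == 0)%:R (j == 1)%:R).1.
Definition fu a b w lam (j : 'I_2) : R -> R := (ivp a b w lam (j == 0)%:R (j == 1)%:R).2.

Lemma fund_sol a b w lam j : a < b -> Omega a b w ->
  slreal a b w lam (fy a b w lam j) (fu a b w lam j).
Proof. by move=> ab hw; have [] := ivpP lam (j == 0)%:R (j == 1)%:R ab hw. Qed.

Lemma fy_a a b w lam j : a < b -> Omega a b w -> fy a b w lam j a = (j == 0)%:R.
Proof. by move=> ab hw; have [] := ivpP lam (j == 0)%:R (j == 1)%:R ab hw. Qed.

Lemma fu_a a b w lam j : a < b -> Omega a b w -> fu a b w lam j a = (j == 1)%:R.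
Proof. by move=> ab hw; have [] := ivpP lam (j == 0)%:R (j == 1)%:R ab hw. Qed.

Lemma slreal_fund a b w lam y u : a < b -> Omega a b w -> slreal a b w lam y u ->
  forall x, a <= x -> x <= b ->
  y x = fy a b w lam 0 x * y a + fy a b w lam 1 x * u a /\
  u x = fu a b w lam 0 x * y a + fu a b w lam 1 x * u a.
Proof.
move=> ab hw h x ax xb; have [hP hq hr hs] := L1_coef hw.
have h' := slsys_lin (y a) (u a) (fund_sol lam 0 ab hw) (fund_sol lam 1 ab hw).
have [] := slsys_unique ab hP (L1_potential lam hw) hs h' h _ _ ax xb.
- by rewrite !fy_a//= mulr1 mulr0 addr0.
- by rewrite !fu_a//= mulr1 mulr0 add0r.
- by move=> -> ->; split; rewrite mulrC [X in _ + X]mulrC.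
Qed.

Definition sl_dist_coef a b w0 w : R :=
  intg a b (fun x => `|sl_invp w x - sl_invp w0 x| + `|sl_q w x - sl_q w0 x| +
     `|sl_r w x - sl_r w0 x| + `|sl_s w x - sl_s w0 x|).

Lemma entry_norm_ge0 (M : 'M[R[i]]_2) : 0 <= entry_norm M.
Proof. by do 2 apply: sumr_ge0 => ? _; exact: normc_ge0. Qed.

Lemma entry_norm_ge (M : 'M[R[i]]_2) i j : normc (M i j) <= entry_norm M.
Proof.
rewrite /entry_norm (bigD1 i)//= (bigD1 j)//= -addrA lerDl addr_ge0//.
  by apply: sumr_ge0 => ? _; exact: normc_ge0.
by do 2 apply: sumr_ge0 => ? _; exact: normc_ge0.
Qed.

Lemma entry_norm0 : entry_norm (0 : 'M[R[i]]_2) = 0.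
Proof.
by rewrite /entry_norm big1// => i _; rewrite big1// => j _; rewrite mxE ComplexField.Normc.normc0.
Qed.

Lemma sl_dist_coef_L1 a b w0 w : Omega a b w0 -> Omega a b w ->
  L1 a b (fun x => `|sl_invp w x - sl_invp w0 x| + `|sl_q w x - sl_q w0 x| +
     `|sl_r w x - sl_r w0 x| + `|sl_s w x - sl_s w0 x|).
Proof.
move=> /L1_coef[h1 h2 h3 h4] /L1_coef[h1' h2' h3' h4'].
have L f g : L1 a b f -> L1 a b g -> L1 a b (fun x => `|f x - g x|).
  by move=> hf hg; apply: L1_norm; exact: L1B.
by apply: L1D; [apply: L1D; [apply: L1D|]|]; exact: L.
Qed.

Lemma sl_dist_coef_ge0 a b w0 w : Omega a b w0 -> Omega a b w -> 0 <= sl_dist_coef a b w0 w.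
Proof.
move=> h h'; apply: intg_ge0_ae; first exact: sl_dist_coef_L1.
by apply: aeonW => x _; rewrite !addr_ge0.
Qed.

Lemma sl_distE a b w0 w : sl_dist a b w w0 =
  entry_norm (sl_A w - sl_A w0) + entry_norm (sl_B w - sl_B w0) + sl_dist_coef a b w0 w.
Proof. by []. Qed.

Lemma sl_dist_coef_le a b w0 w : sl_dist_coef a b w0 w <= sl_dist a b w w0.
Proof. by rewrite sl_distE lerDr addr_ge0// entry_norm_ge0. Qed.

Lemma coef_dist_le a b w0 w lam0 lam : Omega a b w0 -> Omega a b w ->
  coef_dist a b (sl_invp w0) (fun x => sl_q w0 x - lam0 * sl_r w0 x) (sl_s w0)
     (sl_invp w) (fun x => sl_q w x - lam * sl_r w x) (sl_s w) <=
  (1 + `|lam|) * sl_dist_coef a b w0 w + `|lam - lam0| * L1norm a b (sl_r w0).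
Proof.
move=> h h'; have hD := sl_dist_coef_L1 h h'.
have [h1 h2 h3 h4] := L1_coef h; have [h1' h2' h3' h4'] := L1_coef h'.
rewrite /sl_dist_coef /L1norm -/(intg a b (fun x => `|sl_r w0 x|)).
rewrite -!intgZ//; [|exact: L1_norm].
rewrite -intgD; [|exact: L1Z|by apply: L1Z; exact: L1_norm].
apply: le_intg.
- by apply: slweight_L1; apply: L1B => //; exact: L1_potential.
- by apply: L1D; apply: L1Z => //; exact: L1_norm.
move=> x _; rewrite /slweight.
set p := `|sl_invp w x - _|; set t := `|sl_s w x - _|.
have -> : sl_q w x - lam * sl_r w x - (sl_q w0 x - lam0 * sl_r w0 x) =
  (sl_q w x - sl_q w0 x) - (lam * (sl_r w x - sl_r w0 x) + (lam - lam0) * sl_r w0 x) by ring.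
have k1 := ler_normB (sl_q w x - sl_q w0 x)
  (lam * (sl_r w x - sl_r w0 x) + (lam - lam0) * sl_r w0 x).
have k2 := ler_normD (lam * (sl_r w x - sl_r w0 x)) ((lam - lam0) * sl_r w0 x).
rewrite !normrM in k1 k2.
have := mulr_ge0 (normr_ge0 lam) (normr_ge0 (sl_invp w x - sl_invp w0 x)).
have := mulr_ge0 (normr_ge0 lam) (normr_ge0 (sl_q w x - sl_q w0 x)).
have := mulr_ge0 (normr_ge0 lam) (normr_ge0 (sl_s w x - sl_s w0 x)).
have := normr_ge0 (sl_r w x - sl_r w0 x).
rewrite -/p -/t; lra.
Qed.

(* The spectral parameter is doubled because Gram matrices pair the solutions for
   two different parameters. *)
Definition slnear a b (lam0 : R) (w0 : sl_problem R) : set_system (R * R * sl_problem R) :=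
  [set A | exists2 e : R, 0 < e & forall l1 l2 w, `|l1 - lam0| < e -> `|l2 - lam0| < e ->
     Omega a b w -> sl_dist a b w w0 < e -> A (l1, l2, w)].

Global Instance slnear_filter a b lam0 w0 : Filter (slnear a b lam0 w0).
Proof.
split.
- by exists 1.
- move=> A B [e e0 he] [d d0 hd]; exists (Num.min e d); first by rewrite lt_min e0.
  move=> l1 l2 w; rewrite !lt_min => /andP[? ?] /andP[? ?] ? /andP[? ?].
  by split; [exact: he|exact: hd].
- by move=> A B AB [e e0 he]; exists e => // *; apply: AB; exact: he.
Qed.

Lemma slnear_lam1 a b lam0 w0 : p.1.1 @[p --> slnear a b lam0 w0] --> lam0.
Proof.
apply/(@cvgrPdist_lt _ R^o) => e e0; exists e => // l1 l2 w h _ _ _ /=.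
by rewrite distrC.
Qed.

Lemma slnear_lam2 a b lam0 w0 : p.1.2 @[p --> slnear a b lam0 w0] --> lam0.
Proof.
apply/(@cvgrPdist_lt _ R^o) => e e0; exists e => // l1 l2 w _ h _ _ /=.
by rewrite distrC.
Qed.

Lemma slnear_Omega a b lam0 w0 : \forall p \near slnear a b lam0 w0, Omega a b p.2.
Proof. by exists 1. Qed.

Lemma slnear_coef a b lam0 w0 : Omega a b w0 ->
  sl_dist_coef a b w0 p.2 @[p --> slnear a b lam0 w0] --> 0.
Proof.
move=> h0; apply/(@cvgrPdist_lt _ R^o) => e e0; exists e => // l1 l2 w _ _ hw hd /=.
rewrite sub0r normrN ger0_norm ?sl_dist_coef_ge0//.
exact: le_lt_trans (sl_dist_coef_le _ _ _ _) hd.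
Qed.

(* One statement serves both spectral parameters of [slnear]. *)
Lemma fund_cvg a b lam0 w0 (lam : R * R * sl_problem R -> R) j : a < b -> Omega a b w0 ->
  lam p @[p --> slnear a b lam0 w0] --> lam0 ->
  forall e : R, 0 < e -> \forall p \near slnear a b lam0 w0,
    forall x, a <= x -> x <= b ->
    `|fy a b p.2 (lam p) j x - fy a b w0 lam0 j x| +
    `|fu a b p.2 (lam p) j x - fu a b w0 lam0 j x| < e.
Proof.
move=> ab h0 lamc e e0; have ab' := ltW ab.
have [hP hq hr hs] := L1_coef h0.
pose y0 := fy a b w0 lam0 j; pose u0 := fu a b w0 lam0 j.
have s0 : slreal a b w0 lam0 y0 u0 by exact: fund_sol.
have [M1 H1] := primitive_bounded s0.1; have [M2 H2] := primitive_bounded s0.2.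
pose m0 := slweight (sl_invp w0) (fun x => sl_q w0 x - lam0 * sl_r w0 x) (sl_s w0).
have hm0 : L1 a b m0 by apply: slweight_L1 => //; exact: L1_potential.
pose N0 := intg a b m0.
(* Near [w0] the coefficient distance is below 1, so N0 + 1 bounds the exponent in the dependence
   estimate for every nearby problem. *)
pose C := (M1 + M2) * expR (N0 + 1).
pose D (p : R * R * sl_problem R) : R := (1 + `|lam p|) * sl_dist_coef a b w0 p.2 +
  `|lam p - lam0| * L1norm a b (sl_r w0).
have Dc : D p @[p --> slnear a b lam0 w0] --> 0.
  rewrite [X in _ --> X](_ : 0 = (1 + `|lam0|) * 0 + `|lam0 - lam0| * L1norm a b (sl_r w0)); last first.
    by rewrite subrr normr0 mulr0 mul0r addr0.
  apply: (@cvgD _ R^o).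
    apply: cvgM; last exact: slnear_coef.
    apply: (@cvgD _ R^o); first exact: cvg_cst.
    exact: (@cvg_norm _ R^o).
  apply: cvgM; last exact: cvg_cst.
  apply: (@cvg_norm _ R^o); apply: (@cvgB _ R^o) => //; exact: cvg_cst.
have M0 : 0 <= M1 + M2.
  by rewrite addr_ge0//; [apply: le_trans (H1 a (lexx a) ab')|apply: le_trans (H2 a (lexx a) ab')].
have C0 : 0 <= C by rewrite mulr_ge0// expR_ge0.
have e1 : 0 < e / (C + 1) by rewrite divr_gt0// ltr_wpDl.
have n1 := slnear_Omega a b lam0 w0.
have n2 := cvgr_lt _ Dc _ e1.
have n3 := cvgr_lt _ Dc _ ltr01.
near=> p => x ax xb.
have hp : Omega a b p.2 by near: p; exact: n1.
have D1 : D p < e / (C + 1) by near: p; exact: n2.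
have D2 : D p < 1 by near: p; exact: n3.
have [hP' hq' hr' hs'] := L1_coef hp.
have sp := fund_sol (lam p) j ab hp.
have := slsys_dependence ab hP (L1_potential lam0 h0) hs hP' (L1_potential (lam p) hp) hs' s0 sp.
move=> /(_ (M1 + M2) (fun x ax xb => lerD (H1 x ax xb) (H2 x ax xb)) x ax xb).
rewrite !fy_a// !fu_a// /y0 /u0 fy_a// fu_a// !subrr !normr0 !add0r.
move=> /le_lt_trans; apply.
set cd := coef_dist _ _ _ _ _ _ _ _.
have cdD : cd <= D p by exact: coef_dist_le.
have cd0 : 0 <= cd.
  apply: intg_ge0_ae; last by apply: aeonW => t _; exact: slweight_ge0.
  by apply: slweight_L1; apply: L1B => //; exact: L1_potential.
set m' := slweight _ _ _.
have hm' : L1 a b m' by apply: slweight_L1 => //; exact: L1_potential.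
have mle : intg a b m' <= N0 + 1.
  apply: (@le_trans _ _ (N0 + cd)); last by rewrite lerD2l; apply: ltW; exact: le_lt_trans D2.
  rewrite /N0 /cd /coef_dist -intgD//; last first.
    by apply: slweight_L1; apply: L1B => //; exact: L1_potential.
  apply: le_intg => //.
    by apply: L1D => //; apply: slweight_L1; apply: L1B => //; exact: L1_potential.
  move=> t _; rewrite /m' /m0 /slweight.
  have tr (f g : R) : `|f| <= `|g| + `|f - g|.
    by rewrite -{1}(subrK g f) addrC; exact: ler_normD.
  have k1 := tr (sl_invp p.2 t) (sl_invp w0 t).
  have k2 := tr (sl_s p.2 t) (sl_s w0 t).
  have k3 := tr (sl_q p.2 t - lam p * sl_r p.2 t) (sl_q w0 t - lam0 * sl_r w0 t).
  lra.
apply: (@le_lt_trans _ _ (C * D p)).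
  rewrite /C mulrAC; apply: ler_pM => //; first by rewrite mulr_ge0 ?expR_ge0.
  by rewrite ler_wpM2l// ler_expR.
apply: (@le_lt_trans _ _ (C * (e / (C + 1)))); first by rewrite ler_wpM2l// ltW.
rewrite mulrA ltr_pdivrMr ?ltr_wpDl//; nra.
Unshelve. all: by end_near. Qed.

End Fundamental.

(** * Continuous dependence on the problem *)

Section UniformConvergence.
Context {R : realType} {T : Type} (F : set_system T) {FF : Filter F}.
Implicit Types (a b x : R).

Definition unif_cvg a b (f : T -> R -> R) (f0 : R -> R) := forall e : R, 0 < e ->
  \forall t \near F, forall x, a <= x -> x <= b -> `|f t x - f0 x| < e.

Lemma unif_cvgD a b f f0 g g0 : unif_cvg a b f f0 -> unif_cvg a b g g0 ->
  unif_cvg a b (fun t x => f t x + g t x) (fun x => f0 x + g0 x).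
Proof.
move=> hf hg e e0; have e20 : 0 < e / 2 by rewrite divr_gt0.
apply: filterS2 (hf _ e20) (hg _ e20) => t h1 h2 x ax xb.
rewrite opprD addrACA (le_lt_trans (ler_normD _ _))// [ltRHS]splitr ltrD//.
  exact: h1.
exact: h2.
Qed.

Lemma unif_cvgM a b f f0 g g0 (M N : R) :
  (forall x, a <= x -> x <= b -> `|f0 x| <= M) ->
  (forall x, a <= x -> x <= b -> `|g0 x| <= N) ->
  unif_cvg a b f f0 -> unif_cvg a b g g0 ->
  unif_cvg a b (fun t x => f t x * g t x) (fun x => f0 x * g0 x).
Proof.
move=> hM hN hf hg e e0.
pose K := `|M| + `|N| + 1.
have K0 : 0 < K by rewrite ltr_wpDl// addr_ge0.
pose d := Num.min 1 (e / (K + 1)).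
have d0 : 0 < d by rewrite lt_min ltr01 divr_gt0// addr_gt0.
apply: filterS2 (hf _ d0) (hg _ d0) => t h1 h2 x ax xb.
have {}h1 := h1 x ax xb; have {}h2 := h2 x ax xb.
have -> : f t x * g t x - f0 x * g0 x = (f t x - f0 x) * (g t x - g0 x) +
  (f t x - f0 x) * g0 x + f0 x * (g t x - g0 x) by ring.
set u := f t x - f0 x in h1 *; set v := g t x - g0 x in h2 *.
have k1 : `|u * v| <= d * 1.
  rewrite normrM ler_pM// ltW//; apply: lt_le_trans h2 _; by rewrite ge_min lexx.
have k2 : `|u * g0 x| <= d * `|N|.
  by rewrite normrM ler_pM// ?(ltW h1)// (le_trans (hN x ax xb))// ler_norm.
have k3 : `|f0 x * v| <= `|M| * d.
  by rewrite normrM ler_pM// ?(ltW h2)// (le_trans (hM x ax xb))// ler_norm.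
apply: (@le_lt_trans _ _ (d * K)).
  apply: (le_trans (ler_normD _ _)); apply: (le_trans (lerD (ler_normD _ _) (lexx _))).
  rewrite /K; lra.
apply: (@le_lt_trans _ _ (e / (K + 1) * K)).
  by rewrite ler_wpM2r ?(ltW K0)// ge_min lexx orbT.
have K1 : 0 < K + 1 by rewrite addr_gt0.
by rewrite mulrAC (ltr_pdivrMr _ _ K1) [ltRHS]mulrDr mulr1 ltrDl.
Qed.

(** Split g f - g0 f0 into (g - g0) f and g0 (f - f0): an L^1-small factor against a bounded one,
    and an integrable factor against a uniformly small one. *)
Lemma intg_cvg a b (g f : T -> R -> R) (g0 f0 : R -> R) : a <= b ->
  L1 a b g0 -> bmeas a b f0 -> (\forall t \near F, L1 a b (g t) /\ bmeas a b (f t)) ->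
  intg a b (fun x => `|g t x - g0 x|) @[t --> F] --> 0 ->
  unif_cvg a b f f0 ->
  intg a b (fun x => g t x * f t x) @[t --> F] --> intg a b (fun x => g0 x * f0 x).
Proof.
move=> ab hg0 bf0 near1 hg hf; apply/(@cvgrPdist_lt _ R^o) => e e0.
have [_ [M HM]] := bf0.
pose N := intg a b (fun x => `|g0 x|).
have N0 : 0 <= N by apply: intg_ge0_ae; [exact: L1_norm|exact: aeonW].
pose K := `|M| + 1 + N + 1.
have K0 : 0 < K by rewrite ltr_wpDl// !addr_ge0.
pose d := Num.min 1 (e / K).
have d0 : 0 < d by rewrite lt_min ltr01 divr_gt0.
have n1 := cvgr_lt _ hg _ d0.
have n2 := hf _ d0.
near=> t; have [h1 h2] : L1 a b (g t) /\ bmeas a b (f t) by near: t; exact: near1.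
have h3 : intg a b (fun x => `|g t x - g0 x|) < d by near: t; exact: n1.
have h4 : forall x, a <= x -> x <= b -> `|f t x - f0 x| < d by near: t; exact: n2.
rewrite distrC -intgB; [|exact: bmeas_L1M|exact: bmeas_L1M].
have i1 : L1 a b (fun x => g t x * f t x - g0 x * f0 x) by apply: L1B; exact: bmeas_L1M.
apply: (le_lt_trans (norm_intg i1)).
have i2 : L1 a b (fun x => (`|M| + 1) * `|g t x - g0 x| + d * `|g0 x|).
  by apply: L1D; apply: L1Z; apply: L1_norm => //; exact: L1B.
apply: (@le_lt_trans _ _ (intg a b (fun x => (`|M| + 1) * `|g t x - g0 x| + d * `|g0 x|))).
  apply: le_intg => //; first exact: L1_norm.
  move=> x xab; have := xab; rewrite in_itv/= => /andP[/ltW ax /ltW xb].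
  have -> : g t x * f t x - g0 x * f0 x = (g t x - g0 x) * f t x + g0 x * (f t x - f0 x) by ring.
  rewrite (le_trans (ler_normD _ _))// !normrM lerD//.
    rewrite mulrC ler_wpM2r// -[f t x](subrK (f0 x)) addrC (le_trans (ler_normD _ _))//.
    rewrite lerD//; first by rewrite (le_trans (HM _ xab))// ler_norm.
    by apply: ltW; apply: lt_le_trans (h4 x ax xb) _; rewrite ge_min lexx.
  by rewrite mulrC ler_wpM2r// ltW// h4.
rewrite intgD; [|by apply: L1Z; apply: L1_norm; exact: L1B|by apply: L1Z; exact: L1_norm].
rewrite !intgZ; [|by apply: L1_norm|by apply: L1_norm; exact: L1B].
apply: (@lt_le_trans _ _ (d * K)).
  have : (`|M| + 1) * intg a b (fun x => `|g t x - g0 x|) <= (`|M| + 1) * d.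
    by rewrite ler_wpM2l ?addr_ge0// ltW.
  rewrite /K -/N; lra.
by rewrite -ler_pdivlMr// ge_min lexx orbT.
Unshelve. all: by end_near. Qed.

End UniformConvergence.

Section Gram.
Context {R : realType}.
Implicit Types (a b c x lam : R) (w rho : sl_problem R).

Lemma fund_unif_cvg a b lam0 w0 (lam : R * R * sl_problem R -> R) j : a < b -> Omega a b w0 ->
  lam p @[p --> slnear a b lam0 w0] --> lam0 ->
  unif_cvg (slnear a b lam0 w0) a b (fun p => fy a b p.2 (lam p) j) (fy a b w0 lam0 j) /\
  unif_cvg (slnear a b lam0 w0) a b (fun p => fu a b p.2 (lam p) j) (fu a b w0 lam0 j).
Proof.
move=> ab h0 lc; split=> e /(fund_cvg j ab h0 lc);
  apply: filterS => p h x ax xb; apply: le_lt_trans (h x ax xb); rewrite ?lerDl ?lerDr//.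
Qed.

Lemma fund_bounded a b lam w j : a < b -> Omega a b w ->
  exists M : R, forall x, a <= x -> x <= b -> `|fy a b w lam j x| <= M /\ `|fu a b w lam j x| <= M.
Proof.
move=> ab h; have [s1 s2] := fund_sol lam j ab h.
have [M1 H1] := primitive_bounded s1; have [M2 H2] := primitive_bounded s2.
exists (Num.max M1 M2) => x ax xb; rewrite !le_max H1// H2// orbT; by split.
Qed.

Lemma fund_bmeas a b lam w j : a < b -> Omega a b w ->
  bmeas a b (fy a b w lam j) /\ bmeas a b (fu a b w lam j).
Proof. by move=> ab h; exact: slsys_bmeas (ltW ab) (fund_sol lam j ab h). Qed.

Definition gram a b w lam1 lam2 (i j : 'I_2) : R :=
  intg a b (fun x => sl_r w x * (fy a b w lam1 i x * fy a b w lam2 j x)).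

Lemma L1_cvg a b lam0 w0 (f : sl_problem R -> R -> R) : Omega a b w0 ->
  (forall w, Omega a b w -> L1 a b (f w)) ->
  (forall w x, `|f w x - f w0 x| <= `|sl_invp w x - sl_invp w0 x| + `|sl_q w x - sl_q w0 x| +
     `|sl_r w x - sl_r w0 x| + `|sl_s w x - sl_s w0 x|) ->
  intg a b (fun x => `|f p.2 x - f w0 x|) @[p --> slnear a b lam0 w0] --> 0.
Proof.
move=> h0 hf H; apply/(@cvgrPdist_lt _ R^o) => e e0.
have n1 := cvgr_lt _ (@slnear_coef R a b lam0 w0 h0) _ e0.
have n2 := @slnear_Omega R a b lam0 w0.
near=> p; have hp : Omega a b p.2 by near: p; exact: n2.
have le1 : sl_dist_coef a b w0 p.2 < e by near: p; exact: n1.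
have hL : L1 a b (fun x => `|f p.2 x - f w0 x|).
  by apply: L1_norm; apply: L1B; exact: hf.
rewrite sub0r normrN ger0_norm; last by apply: intg_ge0_ae => //; exact: aeonW.
apply: le_lt_trans le1; apply: le_intg => //; exact: sl_dist_coef_L1.
Unshelve. all: by end_near. Qed.

Lemma gram_cvg a b lam0 w0 i j : a < b -> Omega a b w0 ->
  gram a b p.2 p.1.1 p.1.2 i j @[p --> slnear a b lam0 w0] --> gram a b w0 lam0 lam0 i j.
Proof.
move=> ab h0; have ab' := ltW ab.
have [c1 _] := fund_unif_cvg i ab h0 (@slnear_lam1 R a b lam0 w0).
have [c2 _] := fund_unif_cvg j ab h0 (@slnear_lam2 R a b lam0 w0).
have [M HM] := fund_bounded lam0 i ab h0; have [N HN] := fund_bounded lam0 j ab h0.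
have [_ _ hr _] := L1_coef h0.
apply: (@intg_cvg _ _ _ _ _ _ (fun p => sl_r p.2)
  (fun p x => fy a b p.2 p.1.1 i x * fy a b p.2 p.1.2 j x)) => //.
- by apply: bmeasM; exact: (fund_bmeas _ _ ab h0).1.
- near=> p; have hp : Omega a b p.2 by near: p; exact: slnear_Omega.
  split; first by case: (L1_coef hp).
  by apply: bmeasM; exact: (fund_bmeas _ _ ab hp).1.
- apply: (@L1_cvg _ _ _ _ (fun w => sl_r w)) => //.
    by move=> w /L1_coef[].
  by move=> w x; rewrite -addrA [leRHS]addrC -addrA lerDl !addr_ge0.
- by apply: (unif_cvgM (M := M) (N := N)) => // x ax xb; [exact: (HM x ax xb).1|exact: (HN x ax xb).1].
Unshelve. all: by end_near. Qed.

End Gram.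

(** * Convergence of complex numbers and 2 x 2 matrices *)

Section ComplexConvergence.
Context {R : realType} {T : Type} (F : set_system T) {FF : Filter F}.
Implicit Types (f g : T -> R[i]) (l k : R[i]).

Definition cvC f l := complex.Re (f t) @[t --> F] --> complex.Re l /\
  complex.Im (f t) @[t --> F] --> complex.Im l.

Lemma cvC_cst l : cvC (fun=> l) l.
Proof. by split; exact: cvg_cst. Qed.

Lemma cvCD f g l k : cvC f l -> cvC g k -> cvC (fun t => f t + g t) (l + k).
Proof.
move=> [f1 f2] [g1 g2]; split; rewrite raddfD; under eq_cvg do rewrite raddfD;
  exact: (@cvgD _ R^o).
Qed.

Lemma cvCN f l : cvC f l -> cvC (fun t => - f t) (- l).
Proof.
move=> [f1 f2]; split; rewrite raddfN; under eq_cvg do rewrite raddfN;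
  exact: (@cvgN _ R^o).
Qed.

Lemma ReM (u v : R[i]) : complex.Re (u * v) =
  complex.Re u * complex.Re v - complex.Im u * complex.Im v.
Proof. by case: u => ? ?; case: v. Qed.

Lemma ImM (u v : R[i]) : complex.Im (u * v) =
  complex.Re u * complex.Im v + complex.Im u * complex.Re v.
Proof. by case: u => ? ?; case: v. Qed.

Lemma cvCM f g l k : cvC f l -> cvC g k -> cvC (fun t => f t * g t) (l * k).
Proof.
move=> [f1 f2] [g1 g2]; split; [rewrite ReM|rewrite ImM].
  under eq_cvg do rewrite ReM.
  by apply: (@cvgB _ R^o); exact: cvgM.
under eq_cvg do rewrite ImM.
by apply: (@cvgD _ R^o); exact: cvgM.
Qed.

Lemma cvC_conj f l : cvC f l -> cvC (fun t => conjc (f t)) (conjc l).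
Proof.
have eR (u : R[i]) : complex.Re (conjc u) = complex.Re u by case: u.
have eI (u : R[i]) : complex.Im (conjc u) = - complex.Im u by case: u.
move=> [f1 f2]; split; rewrite ?eR ?eI.
  by under eq_cvg do rewrite eR.
by under eq_cvg do rewrite eI; exact: (@cvgN _ R^o).
Qed.

Lemma cvC_real (f : T -> R) (l : R) : f t @[t --> F] --> l -> cvC (fun t => (f t)%:C) l%:C.
Proof. by move=> h; split => //=; exact: cvg_cst. Qed.

Lemma cvCV f l : l != 0 -> cvC f l -> cvC (fun t => (f t)^-1) l^-1.
Proof.
have eR (u : R[i]) : complex.Re u^-1 = complex.Re u / (complex.Re u ^+ 2 + complex.Im u ^+ 2).
  by case: u.
have eI (u : R[i]) : complex.Im u^-1 = - (complex.Im u / (complex.Re u ^+ 2 + complex.Im u ^+ 2)).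
  by case: u.
move=> l0 [f1 f2].
have n0 : complex.Re l ^+ 2 + complex.Im l ^+ 2 != 0.
  by apply: contra l0; case: (l) => x y /=; rewrite paddr_eq0 ?sqr_ge0// !sqrf_eq0 eq_complex.
have sq (g : T -> R) (k : R) : g t @[t --> F] --> k -> g t ^+ 2 @[t --> F] --> k ^+ 2.
  by move=> h; rewrite expr2; under eq_cvg do rewrite expr2; exact: cvgM.
have cN : complex.Re (f t) ^+ 2 + complex.Im (f t) ^+ 2 @[t --> F] -->
    complex.Re l ^+ 2 + complex.Im l ^+ 2.
  by apply: (@cvgD _ R^o); exact: sq.
have cV : (complex.Re (f t) ^+ 2 + complex.Im (f t) ^+ 2)^-1 @[t --> F] -->
    (complex.Re l ^+ 2 + complex.Im l ^+ 2)^-1.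
  exact: (cvgV n0 cN).
split; rewrite ?eR ?eI.
  rewrite (_ : (fun t => complex.Re (f t)^-1) = (fun t => complex.Re (f t) /
    (complex.Re (f t) ^+ 2 + complex.Im (f t) ^+ 2))).
    exact: cvgM.
  by apply/funext => t; rewrite eR.
rewrite (_ : (fun t => complex.Im (f t)^-1) = (fun t => - (complex.Im (f t) /
    (complex.Re (f t) ^+ 2 + complex.Im (f t) ^+ 2)))).
  apply: (@cvgN _ R^o); exact: cvgM.
by apply/funext => t; rewrite eI.
Qed.

Lemma cvC_sum2 (f : 'I_2 -> T -> R[i]) (l : 'I_2 -> R[i]) :
  (forall i, cvC (f i) (l i)) -> cvC (fun t => \sum_i f i t) (\sum_i l i).
Proof.
move=> H; have E (g : 'I_2 -> R[i]) : \sum_i g i = g 0 + g 1.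
  by rewrite big_ord_recl big_ord1; congr (_ + g _); exact: val_inj.
rewrite E (_ : (fun t => _) = (fun t => f 0 t + f 1 t)); first exact: cvCD.
by apply/funext => t; rewrite E.
Qed.

Lemma cvC_near f g l : (\forall t \near F, f t = g t) -> cvC f l -> cvC g l.
Proof.
move=> fg [f1 f2]; split.
  by apply: cvg_trans f1; apply: near_eq_cvg; apply: filterS fg => t ->.
by apply: cvg_trans f2; apply: near_eq_cvg; apply: filterS fg => t ->.
Qed.

Definition cvM (M : T -> 'M[R[i]]_2) (L : 'M[R[i]]_2) :=
  forall i j, cvC (fun t => M t i j) (L i j).

Lemma cvM_cst L : cvM (fun=> L) L.
Proof. by move=> i j; exact: cvC_cst. Qed.

Lemma cvMD M N L K : cvM M L -> cvM N K -> cvM (fun t => M t + N t) (L + K).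
Proof.
move=> h k i j; rewrite mxE (_ : (fun t => _) = (fun t => M t i j + N t i j)); first exact: cvCD.
by apply/funext => t; rewrite mxE.
Qed.

Lemma cvMN M L : cvM M L -> cvM (fun t => - M t) (- L).
Proof.
move=> h i j; rewrite mxE (_ : (fun t => _) = (fun t => - M t i j)); first exact: cvCN.
by apply/funext => t; rewrite mxE.
Qed.

Lemma cvMM M N L K : cvM M L -> cvM N K -> cvM (fun t => M t *m N t) (L *m K).
Proof.
move=> h k i j; rewrite mxE (_ : (fun t => _) = (fun t => \sum_m M t i m * N t m j)).
  by apply: cvC_sum2 => m; exact: cvCM.
by apply/funext => t; rewrite mxE.
Qed.

Lemma cvMZ f M l L : cvC f l -> cvM M L -> cvM (fun t => f t *: M t) (l *: L).
Proof.
move=> h k i j; rewrite mxE (_ : (fun t => _) = (fun t => f t * M t i j)); first exact: cvCM.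
by apply/funext => t; rewrite mxE.
Qed.

Lemma cvM_adj M L : cvM M L -> cvM (fun t => adjoint_mx (M t)) (adjoint_mx L).
Proof.
move=> h i j; rewrite !mxE (_ : (fun t => _) = (fun t => conjc (M t j i))); first exact: cvC_conj.
by apply/funext => t; rewrite !mxE.
Qed.

Lemma det2 (M : 'M[R[i]]_2) : \det M = M 0 0 * M 1 1 - M 0 1 * M 1 0.
Proof.
rewrite (expand_det_row _ 0) !big_ord_recl big_ord0 /cofactor !det_mx11 !mxE/=.
rewrite !expr0 !expr1 addr0 mul1r mulN1r mulrN.
by congr (M _ _ * M _ _ - M _ _ * M _ _); exact: val_inj.
Qed.

Lemma cvM_det M L : cvM M L -> cvC (fun t => \det (M t)) (\det L).
Proof.
move=> h; rewrite det2 (_ : (fun t => _) = (fun t => M t 0 0 * M t 1 1 - M t 0 1 * M t 1 0)).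
  by apply: cvCD; [|apply: cvCN]; exact: cvCM.
by apply/funext => t; rewrite det2.
Qed.

Lemma adj2 (M : 'M[R[i]]_2) : \adj M =
  \matrix_(i, j) (if i == j then M (1 - i) (1 - i) else - M i j).
Proof.
apply/matrixP => i j; rewrite !mxE /cofactor det_mx11 !mxE.
have /orP[/eqP->|/eqP->] : (i == 0) || (i == 1) by case: i => [[|[|]]].
all: have /orP[/eqP->|/eqP->] : (j == 0) || (j == 1) by case: j => [[|[|]]].
all: rewrite /= ?expr0 ?expr1 ?expr2 ?mulrNN ?mulr1 ?mul1r ?mulN1r.
all: try congr (- _).
all: congr (M _ _); exact: val_inj.
Qed.

Lemma cvM_adjugate M L : cvM M L -> cvM (fun t => \adj (M t)) (\adj L).
Proof.
move=> h i j; rewrite adj2 mxE; under eq_fun do rewrite adj2 mxE.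
by case: ifP => _; [exact: h|apply: cvCN; exact: h].
Qed.

Lemma cvC_neq0 f l : l != 0 -> cvC f l -> \forall t \near F, f t != 0.
Proof.
case: l => x y l0 [/= f1 f2].
have [x0|x0] := eqVneq x 0.
  have y0 : y != 0 by apply: contra l0 => /eqP->; rewrite x0.
  by apply: filterS (cvgr_neq0 y f2 y0) => t; apply: contra => /eqP ->.
by apply: filterS (cvgr_neq0 x f1 x0) => t; apply: contra => /eqP ->.
Qed.

(** Where the determinant does not vanish, which is the case nearby, the inverse is the adjugate
    divided by the determinant. *)
Lemma cvM_inv M L : L \in unitmx -> cvM M L -> cvM (fun t => invmx (M t)) (invmx L).
Proof.
move=> uL h; have dL : \det L != 0 by rewrite -unitfE -unitmxE.
have nz := cvC_neq0 dL (cvM_det h).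
have c := cvMZ (cvCV dL (cvM_det h)) (cvM_adjugate h).
move=> i j; rewrite /invmx uL; apply: cvC_near (c i j).
by apply: filterS nz => t dt; rewrite unitmxE unitfE dt.
Qed.

End ComplexConvergence.

(** * Boundary conditions and multiplicities *)

Section Positivity.
Context {R : realType}.
Implicit Types (a b c x lam : R).
Notation leb := (@lebesgue_measure R).

Lemma intg_gt0 a b (f : R -> R) : a < b -> L1 a b f -> aeon a b (fun x => 0 < f x) ->
  0 < intg a b f.
Proof.
move=> ab hf f0; have f0' : aeon a b (fun x => 0 <= f x) by apply: aeonS f0 => x _ /ltW.
rewrite lt_neqAle intg_ge0_ae// andbT; apply/negP => /eqP e0.
have fin : (\int[leb]_(x in `]a, b[) `|f x|%:E)%E \is a fin_num.
  apply: integrable_fin_num => //; exact: L1_norm hf.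
have : (\int[leb]_(x in `]a, b[) `|(EFin \o f) x| = 0)%E.
  rewrite -[LHS]fineK//; congr EFin.
  by rewrite e0; apply: eq_intg_ae => //; [exact: L1_norm|apply: aeonS f0' => x _ /ger0_norm].
have mf : measurable_fun `]a, b[ (EFin \o f) by apply/measurable_EFinP; exact: L1_meas.
move=> /(ae_eq_integral_abs leb (measurable_itv _) mf) ae0.
have : aeon a b (fun=> False).
  have ae1 : aeon a b (fun x => f x = 0).
    by apply: (@filterS _ _ (ae_filter_ringOfSetsType leb) _ _ _ ae0) => x h xab; have [] := h xab.
  by apply: aeonS2 ae1 f0 => x _ ->; rewrite ltxx.
move=> [N [mN N0 sub]].
have : (leb `]a, b[%classic <= leb N)%E.
  apply: le_measure; rewrite ?inE//.
  by move=> x xab; apply: sub => /= h; exact: (h xab).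
by rewrite N0 (measure_itvoo (ltW ab)) lee_fin leNgt subr_gt0 ab.
Qed.

Lemma unif_cont_of_primitive a b (F f : R -> R) : a <= b -> primitive a b F f ->
  forall e : R, 0 < e -> exists2 d : R, 0 < d &
  forall x y, a <= x -> x <= b -> a <= y -> y <= b -> `|x - y| < d -> `|F x - F y| < e.
Proof. by move=> ab /(primitive_ac ab)/ac_unif_cont. Qed.

Lemma nonzero_subinterval a b (F f : R -> R) x0 : a < b -> primitive a b F f ->
  a <= x0 -> x0 <= b -> F x0 != 0 ->
  exists c d, [/\ a <= c, c < d, d <= b & forall x, c <= x -> x <= d -> F x != 0].
Proof.
move=> ab hF ax xb Fx0; have e0 : 0 < `|F x0| by rewrite normr_gt0.
have [d d0 Hd] := unif_cont_of_primitive (ltW ab) hF e0.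
have key x : a <= x -> x <= b -> `|x0 - x| < d -> F x != 0.
  move=> ax' xb' h; apply/eqP => Fx; have := Hd x0 x ax xb ax' xb' h.
  by rewrite Fx subr0 ltxx.
have [xm|xm] := ltP x0 b.
  exists x0, (Num.min b (x0 + d / 2)); split => //.
  - by rewrite lt_min xm ltrDl divr_gt0.
  - by rewrite ge_min lexx.
  - move=> x h1; rewrite le_min => /andP[h2 h3]; apply: key => //; first exact: le_trans h1.
    by rewrite ltr_norml; lra.
have xb0 : x0 = b by apply/eqP; rewrite eq_le xb xm.
exists (Num.max a (x0 - d / 2)), x0; split => //.
- by rewrite le_max lexx.
- by rewrite gt_max xb0 ab/= ltrBlDr ltrDl divr_gt0.
- move=> x; rewrite ge_max => /andP[h1 h2] h3; apply: key => //; first exact: le_trans xb.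
  by rewrite ltr_norml; lra.
Qed.

(** By continuity F^2 + G^2 is positive on a whole subinterval, and a weight that is positive almost
    everywhere gives it a positive integral there. *)
Lemma intg_weight_gt0 a b (r F f G g : R -> R) x0 : a < b -> L1 a b r ->
  aeon a b (fun x => 0 < r x) -> primitive a b F f -> primitive a b G g ->
  a <= x0 -> x0 <= b -> (F x0 != 0) || (G x0 != 0) ->
  0 < intg a b (fun x => r x * (F x ^+ 2 + G x ^+ 2)).
Proof.
move=> ab hr r0 hF hG ax xb FG; have ab' := ltW ab.
have bF := bmeas_primitive ab' hF; have bG := bmeas_primitive ab' hG.
have hL : L1 a b (fun x => r x * (F x ^+ 2 + G x ^+ 2)).
  by apply: bmeas_L1M => //; apply: bmeasD; exact: bmeasM.
have ge0 : aeon a b (fun x => 0 <= r x * (F x ^+ 2 + G x ^+ 2)).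
  by apply: aeonS r0 => x _ /ltW r0; rewrite mulr_ge0// addr_ge0 ?sqr_ge0.
have [c [d [ac cd db nz]]] : exists c d, [/\ a <= c, c < d, d <= b &
    forall x, c <= x -> x <= d -> (F x != 0) || (G x != 0)].
  have /orP[h|h] := FG.
    have [c [d [h1 h2 h3 h4]]] := nonzero_subinterval ab hF ax xb h.
    by exists c, d; split => // x cx xd; rewrite h4.
  have [c [d [h1 h2 h3 h4]]] := nonzero_subinterval ab hG ax xb h.
  by exists c, d; split => // x cx xd; rewrite h4 ?orbT.
apply: (@lt_le_trans _ _ (intg c d (fun x => r x * (F x ^+ 2 + G x ^+ 2)))).
  apply: intg_gt0 => //; first exact: L1_sub hL.
  apply: aeonS (aeon_sub ac db r0) => x; rewrite in_itv/= => /andP[/ltW cx /ltW xd] rx.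
  rewrite mulr_gt0// lt_neqAle addr_ge0 ?sqr_ge0// andbT eq_sym paddr_eq0 ?sqr_ge0//.
  by rewrite !sqrf_eq0 negb_and nz.
by apply: le_intg_sub => //; exact: ltW.
Qed.

(** If u(a) were nonzero, u would keep its sign on some [a, c], and y(c) - y(a) = int P u would not
    vanish, as P > 0 almost everywhere. Thus y alone determines the solution, which matters because
    eigenspaces are spaces of functions y. *)
Lemma slreal_zero a b (w : sl_problem R) lam (y u : R -> R) : a < b -> Omega a b w ->
  slreal a b w lam y u -> (forall x, a <= x -> x <= b -> y x = 0) -> u a = 0.
Proof.
move=> ab hw [hy hu] y0; apply/eqP; apply/negP => /negP ua.
have ab' := ltW ab.
have [hP _ _ hs] := L1_coef hw; have [_ [p0 _ _ _]] := hw.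
have e0 : 0 < `|u a| by rewrite normr_gt0.
have [d d0 Hd] := unif_cont_of_primitive ab' hu e0.
pose c := Num.min b (a + d / 2).
have ac : a < c by rewrite lt_min ab ltrDl divr_gt0.
have cb : c <= b by rewrite ge_min lexx.
have sg x : a <= x -> x <= c -> 0 < u a * u x.
  move=> ax xc; have h : `|u a - u x| < `|u a|.
    apply: Hd => //; first exact: le_trans cb.
    by move: xc; rewrite le_min => /andP[_ xc]; rewrite ltr_norml; lra.
  move: h; case: (ltrgt0P (u a)) ua => // ua _; rewrite ltr_norml => /andP[h1 h2].
    by rewrite mulr_gt0//; lra.
  by rewrite nmulr_rgt0//; lra.
have P0 : aeon a b (fun x => 0 < sl_invp w x).
  by apply: aeonS p0 => x _; rewrite /sl_p invr_gt0.
have hL : L1 a c (fun x => sl_invp w x * (u a * u x)).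
  apply: bmeas_L1M; last exact: L1_sub hP.
  by apply: bmeasM; [exact: bmeas_cst|apply: bmeas_sub (bmeas_primitive ab' hu)].
have : 0 < intg a c (fun x => sl_invp w x * (u a * u x)).
  apply: intg_gt0 => //; apply: aeonS (aeon_sub (lexx a) cb P0) => x.
  by rewrite in_itv/= => /andP[/ltW ax /ltW xc] Px; rewrite mulr_gt0// sg.
rewrite (@eq_intg _ _ _ _ (fun x => u a * (sl_invp w x * u x - sl_s w x * y x))); last first.
  move=> x; rewrite in_itv/= => /andP[/ltW ax /ltW xc].
  by rewrite y0//; [ring|exact: le_trans cb].
rewrite intgZ; last exact: L1_sub hy.1.
by rewrite -(primitive_sub hy (lexx a) (ltW ac) cb) !y0// ?(ltW ac)// subrr mulr0 ltxx.
Qed.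

End Positivity.

(** * Algebra of self-adjoint boundary conditions *)

Section BoundaryAlgebra.
Context {R : realType}.
Local Notation C := R[i].
Implicit Types (A B M : 'M[C]_2).

(** Conjugate transpose in arbitrary sizes; on 2 x 2 matrices it is [adjoint_mx] by definition. *)
Definition ctr m n (M : 'M[C]_(m, n)) : 'M[C]_(n, m) := map_mx conjc M^T.

Lemma ctrM m n p (M : 'M[C]_(m, n)) (N : 'M[C]_(n, p)) : ctr (M *m N) = ctr N *m ctr M.
Proof. by rewrite /ctr trmx_mul map_mxM. Qed.

Lemma ctrD m n (M N : 'M[C]_(m, n)) : ctr (M + N) = ctr M + ctr N.
Proof. by rewrite /ctr linearD map_mxD. Qed.

Lemma ctrN m n (M : 'M[C]_(m, n)) : ctr (- M) = - ctr M.
Proof. by rewrite /ctr linearN map_mxN. Qed.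

Lemma ctrK m n (M : 'M[C]_(m, n)) : ctr (ctr M) = M.
Proof. by apply/matrixP => i j; rewrite !mxE conjcK. Qed.

Lemma ctr1 n : ctr (1%:M : 'M[C]_n) = 1%:M.
Proof. by rewrite /ctr trmx1 map_mx1. Qed.

Lemma ctr0 m n : ctr (0 : 'M[C]_(m, n)) = 0.
Proof. by rewrite /ctr trmx0 map_mx0. Qed.

Lemma ctr_col m1 m2 n (M1 : 'M[C]_(m1, n)) (M2 : 'M[C]_(m2, n)) :
  ctr (col_mx M1 M2) = row_mx (ctr M1) (ctr M2).
Proof. by rewrite /ctr tr_col_mx map_row_mx. Qed.

Lemma ctr_block m1 m2 n1 n2 (M1 : 'M[C]_(m1, n1)) (M2 : 'M[C]_(m1, n2))
    (M3 : 'M[C]_(m2, n1)) (M4 : 'M[C]_(m2, n2)) :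
  ctr (block_mx M1 M2 M3 M4) = block_mx (ctr M1) (ctr M3) (ctr M2) (ctr M4).
Proof. by rewrite /ctr tr_block_mx map_block_mx. Qed.

Local Notation E := (symplecticE R).

Lemma ctrE : ctr E = - E.
Proof.
apply/matrixP => i j; rewrite !mxE.
case: i => [[|[|]]] // ?; case: j => [[|[|]]] // ? /=; apply/eqP;
  by rewrite eq_complex/= ?oppr0 ?opprK ?eqxx.
Qed.

Lemma EE : E *m E = - 1%:M.
Proof.
apply/matrixP => i j; rewrite !mxE !big_ord_recl big_ord0 !mxE /=.
case: i => [[|[|]]] // ?; case: j => [[|[|]]] // ? /=;
  rewrite ?mulr0 ?mul0r ?mulN1r ?mulrN1 ?mulr1 ?addr0 ?add0r ?oppr0//.
Qed.

Definition gramN A B := A *m adjoint_mx A + B *m adjoint_mx B.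

Lemma row_norm_eq0 n (v : 'rV[C]_n) : 0 <= (v *m ctr v) 0 0 /\
  ((v *m ctr v) 0 0 = 0 -> v = 0).
Proof.
have e : (v *m ctr v) 0 0 = \sum_j `|v 0 j| ^+ 2.
  by rewrite mxE; apply: eq_bigr => j _; rewrite !mxE sqr_normc.
rewrite e; split; first by apply: sumr_ge0 => j _; rewrite exprn_ge0.
move=> /eqP; rewrite psumr_eq0; last by move=> j _; rewrite exprn_ge0.
move=> /allP h; apply/matrixP => i j; rewrite (ord1 i) mxE; apply/eqP.
by have := h j (mem_index_enum _); rewrite /= sqrf_eq0 normr_eq0.
Qed.

(** A row v with v N = 0 satisfies |v A|^2 + |v B|^2 = 0, so it annihilates (A | B), whose rows are
    independent. *)
Lemma gramN_unit A B : \rank (row_mx A B) = 2%N -> gramN A B \in unitmx.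
Proof.
move=> rk; rewrite -row_free_unit -kermx_eq0; apply/eqP; apply/row_matrixP => i.
rewrite row0; set v := row i _.
have vN : v *m gramN A B = 0.
  by apply/sub_kermxP; exact: row_sub.
have h : (v *m A *m ctr (v *m A)) + (v *m B *m ctr (v *m B)) = 0.
  by rewrite !ctrM !mulmxA -mulmxDl -!mulmxA -mulmxDr vN mul0mx.
have [a0 aE] := row_norm_eq0 (v *m A); have [b0 bE] := row_norm_eq0 (v *m B).
have /eqP : (v *m A *m ctr (v *m A)) 0 0 + (v *m B *m ctr (v *m B)) 0 0 = 0.
  by move: h => /matrixP/(_ 0 0); rewrite !mxE.
rewrite (paddr_eq0 a0 b0) => /andP[/eqP/aE vA /eqP/bE vB].
have : v *m row_mx A B = 0 by rewrite mul_mx_row vA vB row_mx0.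
move=> /sub_kermxP; have /eqP -> : kermx (row_mx A B) == 0.
  by rewrite kermx_eq0 /row_free rk.
by rewrite submx0 => /eqP.
Qed.

Lemma gramN_ctr A B : ctr (gramN A B) = gramN A B.
Proof. by rewrite /gramN ctrD !ctrM !ctrK. Qed.

(* [x^* J y] for [J = diag(E, -E)], expressed through the boundary values
   [W x], [W J x] with [W = (A | B)]: since [W J W^* = 0], the rows of [W] and [W J]
   span orthogonal complements of each other. *)
Lemma boundary_form A B k l (V1 V2 : 'M[C]_(2, k)) (U1 U2 : 'M[C]_(2, l)) :
  \rank (row_mx A B) = 2%N -> A *m E *m adjoint_mx A = B *m E *m adjoint_mx B ->
  let G := invmx (gramN A B) in
  ctr V1 *m E *m U1 - ctr V2 *m E *m U2 =
  ctr (A *m V1 + B *m V2) *m G *m (A *m E *m U1 - B *m E *m U2) -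
  ctr (A *m E *m V1 - B *m E *m V2) *m G *m (A *m U1 + B *m U2).
Proof.
move=> rk sa G; have uN := gramN_unit rk.
(* [K] stacks W = (A | B) over W J. As W J W^* = 0, the product [K *m ctr K] is block diagonal, and
   a right inverse of [K] is also a left inverse. *)
pose K := block_mx A B (A *m E) (- (B *m E)).
pose D : 'M[C]_(2 + 2) := block_mx G 0 0 G.
have KK : K *m ctr K = block_mx (gramN A B) 0 0 (gramN A B).
  have cA : ctr (A *m E) = - (E *m ctr A) by rewrite ctrM ctrE mulNmx.
  have cB : ctr (- (B *m E)) = E *m ctr B by rewrite ctrN ctrM ctrE mulNmx opprK.
  rewrite /K ctr_block mulmx_block cA cB; congr block_mx.
  - by rewrite mulmxN !mulmxA -[ctr A]/(adjoint_mx A) sa addNr.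
  - by rewrite mulNmx -[ctr A]/(adjoint_mx A) sa subrr.
  - rewrite mulmxN mulNmx -!mulmxA (mulmxA E E (ctr A)) (mulmxA E E (ctr B)) EE.
    by rewrite !mulNmx !mul1mx !mulmxN !opprK.
have KDK : ctr K *m D *m K = 1%:M.
  apply: mulmx1C; rewrite mulmxA KK mulmx_block !mul0mx !mulmx0 !addr0 !add0r.
  by rewrite mulmxV// -scalar_mx_block.
pose V := col_mx V1 V2; pose U' := col_mx (E *m U1) (- (E *m U2)).
have -> : ctr V1 *m E *m U1 - ctr V2 *m E *m U2 = ctr V *m U'.
  by rewrite /V ctr_col mul_row_col mulmxN !mulmxA.
rewrite -[U']mul1mx -KDK !mulmxA -[ctr V *m ctr K]ctrM -!mulmxA.
have -> : K *m V = col_mx (A *m V1 + B *m V2) (A *m E *m V1 - B *m E *m V2).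
  by rewrite /K mul_block_col mulNmx.
have -> : K *m U' = col_mx (A *m E *m U1 - B *m E *m U2) (- (A *m U1 + B *m U2)).
  rewrite /K mul_block_col; congr col_mx; first by rewrite mulmxN !mulmxA.
  rewrite mulmxN mulNmx opprK -!mulmxA (mulmxA E E U1) (mulmxA E E U2) EE.
  by rewrite !mulNmx !mul1mx !mulmxN opprD.
rewrite ctr_col /D mul_block_col !mul0mx addr0 add0r mul_row_col !mulmxA.
by rewrite mulmxN.
Qed.

End BoundaryAlgebra.

(** * Multiplicities as nullities of the boundary matrix *)

Section Multiplicity.
Context {R : realType}.
Local Notation C := R[i].
Local Notation E := (symplecticE R).
Implicit Types (a b x lam : R) (w : sl_problem R).

Lemma ord2P (i : 'I_2) : i = 0 \/ i = 1.
Proof. by case: i => [[|[|]]] // ?; [left|right]; exact: val_inj. Qed.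

Lemma sum2 (V : zmodType) (f : 'I_2 -> V) : \sum_i f i = f 0 + f 1.
Proof. by rewrite big_ord_recl big_ord1; congr (_ + f _); exact: val_inj. Qed.

Lemma itvccP a b x : x \in `[a, b] <-> a <= x /\ x <= b.
Proof. by rewrite in_itv/=; split => /andP. Qed.

Definition Phi a b w lam : 'M[C]_2 :=
  \matrix_(i, j) (if i == 0 then fy a b w lam j b else fu a b w lam j b)%:C.
(* The solutions Phi c satisfying the boundary condition are those with bcmx c = 0. *)
Definition bcmx a b w lam := sl_A w + sl_B w *m Phi a b w lam.
(** With W = (A | B), [bcmx] applies W to the boundary values (c, Phi c), and this matrix applies W
    J; together they determine the boundary values. *)
Definition bcmx_sympl a b w lam := sl_A w *m E - sl_B w *m E *m Phi a b w lam.

Definition cy a b w lam (c : 'cV[C]_2) x :=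
  (fy a b w lam 0 x)%:C * c 0 0 + (fy a b w lam 1 x)%:C * c 1 0.
Definition cu a b w lam (c : 'cV[C]_2) x :=
  (fu a b w lam 0 x)%:C * c 0 0 + (fu a b w lam 1 x)%:C * c 1 0.

Lemma Re_comb (f g : R) (k l : C) :
  complex.Re (f%:C * k + g%:C * l) = complex.Re k * f + complex.Re l * g.
Proof. by case: k => ? ?; case: l => ? ? /=; ring. Qed.

Lemma Im_comb (f g : R) (k l : C) :
  complex.Im (f%:C * k + g%:C * l) = complex.Im k * f + complex.Im l * g.
Proof. by case: k => ? ?; case: l => ? ? /=; ring. Qed.

Lemma cplx_eq (k l : C) : complex.Re k = complex.Re l -> complex.Im k = complex.Im l -> k = l.
Proof. by case: k => ? ?; case: l => ? ? /= -> ->. Qed.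

Lemma csol_sol a b w lam c : a < b -> Omega a b w ->
  sl_solution a b w lam%:C (cy a b w lam c) (cu a b w lam c).
Proof.
move=> ab hw; apply/sl_solution_real => //.
have L k l := slsys_lin k l (fund_sol lam 0 ab hw) (fund_sol lam 1 ab hw).
split.
  have := L (complex.Re (c 0 0)) (complex.Re (c 1 0)); rewrite /slreal.
  by congr slsys; apply/funext => x; rewrite /cy /cu Re_comb.
have := L (complex.Im (c 0 0)) (complex.Im (c 1 0)); rewrite /slreal.
by congr slsys; apply/funext => x; rewrite /cy /cu Im_comb.
Qed.

Lemma csol_a a b w lam c : a < b -> Omega a b w ->
  boundary_vec (cy a b w lam c) (cu a b w lam c) a = c.
Proof.
move=> ab hw; apply/matrixP => i j; rewrite (ord1 j) !mxE /cy /cu.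
by have [->|->] := ord2P i; rewrite /= !(fy_a, fu_a)//= ?mul1r ?mul0r ?addr0 ?add0r.
Qed.

Lemma csol_b a b w lam c :
  boundary_vec (cy a b w lam c) (cu a b w lam c) b = Phi a b w lam *m c.
Proof.
apply/matrixP => i j; rewrite (ord1 j) !mxE sum2 !mxE /cy /cu.
by have [->|->] := ord2P i.
Qed.

Lemma csol_bc a b w lam c : a < b -> Omega a b w ->
  boundary_condition a b w (cy a b w lam c) (cu a b w lam c) <-> bcmx a b w lam *m c = 0.
Proof.
move=> ab hw; rewrite /boundary_condition csol_a// csol_b mulmxA -mulmxDl.
by [].
Qed.

Lemma sol_csol a b w lam (y u : R -> C) : a < b -> Omega a b w ->
  sl_solution a b w lam%:C y u -> forall x, a <= x -> x <= b ->
  y x = cy a b w lam (boundary_vec y u a) x /\ u x = cu a b w lam (boundary_vec y u a) x.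
Proof.
move=> ab hw /(sl_solution_real _ _ _ ab hw)[h1 h2] x ax xb.
have [e1 e2] := slreal_fund ab hw h1 ax xb; have [e3 e4] := slreal_fund ab hw h2 ax xb.
split; apply: cplx_eq; rewrite /cy /cu ?Re_comb ?Im_comb !mxE/= ?e1 ?e2 ?e3 ?e4; ring.
Qed.

Lemma csol_inj a b w lam c : a < b -> Omega a b w ->
  (forall x, a <= x -> x <= b -> cy a b w lam c x = 0) -> c = 0.
Proof.
move=> ab hw h; have := csol_sol lam c ab hw => /(sl_solution_real _ _ _ ab hw)[h1 h2].
have ca := csol_a lam c ab hw.
have y0 : c 0 0 = 0.
  by rewrite -[in LHS]ca mxE /= h// ltW.
have u0 : c 1 0 = 0.
  rewrite -[in LHS]ca mxE /=; apply: cplx_eq => /=.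
    by apply: (slreal_zero ab hw h1) => x ax xb; rewrite h.
  by apply: (slreal_zero ab hw h2) => x ax xb; rewrite h.
by apply/matrixP => i j; rewrite (ord1 j) mxE; have [->|->] := ord2P i.
Qed.

Lemma cy_lin a b w lam k (d : 'I_k -> C) (f : 'I_k -> 'cV[C]_2) x :
  \sum_i d i * cy a b w lam (f i) x = cy a b w lam (\sum_i d i *: f i) x.
Proof.
rewrite /cy !summxE !mulr_sumr -big_split/=; apply: eq_bigr => i _; rewrite !mxE; ring.
Qed.

(** The map sending c to the solution with initial value c is a bijection, on [a, b], from the
    kernel of [bcmx] to the eigenspace. Kernels of matrices consist of row vectors, hence the
    transposes. *)
Lemma multiplicity_rank a b w lam : a < b -> Omega a b w ->
  multiplicity a b w lam%:C (2 - \rank (bcmx a b w lam)).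
Proof.
move=> ab hw; pose X := bcmx a b w lam.
have rk : \rank (kermx X^T) = (2 - \rank X)%N by rewrite mxrank_ker mxrank_tr.
rewrite -/X -rk; pose K := row_base (kermx X^T).
have KX : K *m X^T = 0 by apply/sub_kermxP; rewrite eq_row_base.
have colK c : (c^T <= K)%MS <-> X *m c = 0.
  rewrite eq_row_base; split.
    by move/sub_kermxP => h; rewrite -[LHS]trmxK trmx_mul h trmx0.
  by move=> h; apply/sub_kermxP; rewrite -trmx_mul h trmx0.
have rK i : X *m (row i K)^T = 0 by apply/colK; rewrite trmxK row_sub.
exists (fun i => cy a b w lam (row i K)^T); split.
- move=> i; exists (cu a b w lam (row i K)^T); first exact: csol_sol.
  by apply/csol_bc.
- move=> c h; have s0 : \sum_i c i *: (row i K)^T = 0.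
    apply: (csol_inj ab hw (lam := lam)) => x ax xb; rewrite -cy_lin; apply: h.
    by apply/itvccP.
  have : (\row_i c i) *m K = 0.
    rewrite mulmx_sum_row -[LHS]trmxK linear_sum/= -[RHS]trmx0; congr trmx.
    rewrite -[RHS]s0; apply: eq_bigr => i _; by rewrite linearZ/= mxE.
  have fK : row_free K by exact: row_base_free.
  move=> /eqP; rewrite mulmx_free_eq0// => /eqP/matrixP h0 i.
  by have := h0 0 i; rewrite !mxE.
- move=> y [u sol bc]; set c := boundary_vec y u a.
  have yc := sol_csol ab hw sol.
  have Xc : X *m c = 0.
    apply/(csol_bc lam c ab hw); rewrite /boundary_condition csol_a// csol_b.
    move: bc; rewrite /boundary_condition; congr (_ + _ *m _ = _).
    rewrite -csol_b; apply/matrixP => i j; rewrite !mxE.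
    by have [e1 e2] := yc b (ltW ab) (lexx b); rewrite -e1 -e2.
  have /submxP[D cD] : (c^T <= K)%MS by apply/colK.
  exists (fun i => D 0 i) => x /itvccP[ax xb].
  rewrite (yc x ax xb).1 cy_lin; congr (cy _ _ _ _ _ _).
  rewrite -[LHS]trmxK -/c cD mulmx_sum_row linear_sum/=.
  by apply: eq_bigr => i _; rewrite linearZ.
Qed.

(** The matrix expressing the first basis through the second has independent rows. *)
Lemma multiplicity_le a b w (lam : C) k k' :
  multiplicity a b w lam k -> multiplicity a b w lam k' -> (k <= k')%N.
Proof.
move=> [f [ef If _]] [g [eg Ig Sg]].
have Sf' i := Sg _ (ef i); have /choice[D HD] := Sf'.
pose M := \matrix_(i < k, j < k') D i j.
suff fM : row_free M by rewrite -(eqP fM) rank_leq_col.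
rewrite -kermx_eq0; apply/eqP; apply/row_matrixP => i0; rewrite row0.
set v := row i0 _; have vM : v *m M = 0 by apply/sub_kermxP; exact: row_sub.
have h x : x \in `[a, b] -> \sum_i v 0 i * f i x = 0.
  move=> xab; transitivity (\sum_j (v *m M) 0 j * g j x).
    under eq_bigr => i _ do rewrite (HD i x xab) mulr_sumr.
    rewrite exchange_big/=; apply: eq_bigr => j _; rewrite mxE mulr_suml.
    by apply: eq_bigr => i _; rewrite !mxE mulrA.
  by rewrite vM big1// => j _; rewrite mxE mul0r.
by apply/matrixP => i j; rewrite (ord1 i) (If (fun i => v 0 i) h j) mxE.
Qed.

Lemma multiplicity_unique a b w (lam : C) k k' :
  multiplicity a b w lam k -> multiplicity a b w lam k' -> k = k'.
Proof. by move=> h h'; apply/eqP; rewrite eqn_leq !(multiplicity_le h, multiplicity_le h'). Qed.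

Lemma multiplicity_gt0 a b w (lam : C) k : multiplicity a b w lam k ->
  is_eigenvalue a b w lam <-> (0 < k)%N.
Proof.
move=> [f [ef If Sf]]; split.
  move=> [y [u [sol bc [x xab]]]].
  have [|c hc] := Sf y; first by exists u.
  rewrite (hc x xab) lt0n; apply: contraNneq => k0.
  by rewrite big1// => i _; have := ltn_ord i; rewrite [X in (_ < X)%N]k0.
move=> k0; have [u sol bc] := ef (Ordinal k0).
exists (f (Ordinal k0)), u; split => //; apply: contrapT => h.
have := If (fun i => (i == Ordinal k0)%:R); move=> /(_ _ (Ordinal k0)); rewrite eqxx.
move=> H; suff : 1 = 0 :> C by move/eqP; rewrite oner_eq0.
apply: H => x xab; rewrite (bigD1 (Ordinal k0))// eqxx mul1r big1; last first.
  by move=> i /negPf ->; rewrite mul0r.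
by rewrite [LHS]addr0; apply: contrapT => /eqP fx; apply: h; exists x.
Qed.

Lemma simple_eigenvalue_of_mult a b w (lam : C) : multiplicity a b w lam 1 ->
  simple_eigenvalue a b w lam.
Proof. by move=> h; split => //; apply/(multiplicity_gt0 h). Qed.

Lemma eigenvalue_rank a b w lam : a < b -> Omega a b w ->
  is_eigenvalue a b w lam%:C <-> bcmx a b w lam \notin unitmx.
Proof.
move=> ab hw; rewrite (multiplicity_gt0 (multiplicity_rank lam ab hw)) subn_gt0.
rewrite -row_free_unit /row_free neq_ltn (ltnNge 2%N) rank_leq_row orbF.
by [].
Qed.

End Multiplicity.

(** * The boundary form and the Hermitian chart *)

Section BoundaryForm.
Context {R : realType}.
Local Notation C := R[i].
Local Notation E := (symplecticE R).
Implicit Types (a b x lam : R) (w : sl_problem R).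

Lemma form_entry (V U : 'cV[C]_2) :
  (ctr V *m E *m U) 0 0 = conjc (V 1 0) * U 0 0 - conjc (V 0 0) * U 1 0.
Proof.
rewrite !mxE !sum2 !mxE !sum2 !mxE /= !mulr0 !mulr1 !mulrN1 add0r addr0.
by rewrite mulNr addrC addrC.
Qed.

(** Self-adjointness of the boundary condition: both terms on the right of [boundary_form] contain a
    factor that vanishes. *)
Lemma bc_form a b w (y u z v : R -> C) : Omega a b w ->
  boundary_condition a b w y u -> boundary_condition a b w z v ->
  conjc (u a) * z a - conjc (y a) * v a = conjc (u b) * z b - conjc (y b) * v b.
Proof.
move=> [_ [_ _ rk sa]] bc1 bc2.
have := @boundary_form _ _ _ _ _ (boundary_vec y u a) (boundary_vec y u b)
  (boundary_vec z v a) (boundary_vec z v b) rk sa.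
have e1 : sl_A w *m boundary_vec y u a + sl_B w *m boundary_vec y u b = 0 by exact: bc1.
have e2 : sl_A w *m boundary_vec z v a + sl_B w *m boundary_vec z v b = 0 by exact: bc2.
rewrite /= e1 e2 ctr0 !mul0mx mulmx0 subrr => /eqP; rewrite subr_eq0 => /eqP/matrixP/(_ 0 0).
by rewrite !form_entry !mxE.
Qed.

(** The function Im (conj y u) has density - be r |y|^2, and self-adjointness gives it equal values
    at [a] and [b]; as the integral of r |y|^2 is positive, be = 0. *)
Lemma eigenvalue_real a b w (lam : C) : a < b -> Omega a b w ->
  is_eigenvalue a b w lam -> complex.Im lam = 0.
Proof.
case: lam => al be ab hw [y [u [sol bc [x0 /itvccP[ax xb] yx]]]] /=.
have [h1 h2 h3 h4] := sl_solution_parts ab hw sol.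
have [_ _ hr _] := L1_coef hw; have [_ [_ r0 _ _]] := hw.
have hF := primitiveB (primitiveM ab h1 h4) (primitiveM ab h2 h3).
set F := (fun x => _) in hF.
have pos : 0 < intg a b (fun x => sl_r w x * (complex.Re (y x) ^+ 2 + complex.Im (y x) ^+ 2)).
  apply: (intg_weight_gt0 ab hr r0 h1 h2 ax xb).
  by move: yx; case: (y x0) => p q; rewrite eq_complex negb_and.
have e1 : F b - F a = - be * intg a b (fun x => sl_r w x * (complex.Re (y x) ^+ 2 + complex.Im (y x) ^+ 2)).
  rewrite (primitive_sub hF (lexx a) (ltW ab) (lexx b)) -intgZ.
    by apply: eq_intg => t _; ring.
  apply: bmeas_L1M => //; apply: bmeasD; apply: bmeasM;
    by [exact: bmeas_primitive (ltW ab) h1|exact: bmeas_primitive (ltW ab) h2].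
have e2 : F b - F a = 0.
  have := bc_form hw bc bc; rewrite /F.
  case: (u a) (u b) (y a) (y b) => [a1 a2] [b1 b2] [c1 c2] [d1 d2] /= [_ h]; lra.
move: e1; rewrite e2 => /esym/eqP; rewrite mulf_eq0 oppr_eq0 (gt_eqF pos) orbF.
by move/eqP.
Qed.

Definition Gram a b w l1 l2 : 'M[C]_2 := \matrix_(i, j) (gram a b w l1 l2 i j)%:C.

(** The bracket of the fundamental solutions is E at [a], where the fundamental matrix is the
    identity, and between equal problems only the term (l1 - l2) r remains in its derivative. *)
Lemma lagrange_mx a b w l1 l2 : a < b -> Omega a b w ->
  E - ctr (Phi a b w l1) *m E *m Phi a b w l2 = (l1 - l2)%:C *: Gram a b w l1 l2.
Proof.
move=> ab hw; apply/matrixP => i j.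
have [_] := slsys_lagrange ab (fund_sol l1 i ab hw) (fund_sol l2 j ab hw).
rewrite (@eq_intg _ _ _ _ (fun x => (l1 - l2) * (sl_r w x * (fy a b w l1 i x * fy a b w l2 j x)))); last first.
  by move=> x _; ring.
have [_ _ hr _] := L1_coef hw.
rewrite intgZ; last first.
  by apply: bmeas_L1M => //; apply: bmeasM; exact: (fund_bmeas _ _ ab hw).1.
rewrite !fy_a// !fu_a// => h.
rewrite [RHS]mxE [Gram _ _ _ _ _ _ _]mxE -rmorphM/= /gram -h.
rewrite !mxE !sum2 !mxE !sum2 !mxE /=.
apply: cplx_eq; have [->|->] := ord2P i; have [->|->] := ord2P j; rewrite /=; ring.
Qed.

(* In the pair (bcmx, bcmx_sympl), which is isotropic by the Lagrange identity, [bcpencil] replaces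
   bcmx_sympl so as to become invertible; [chart_mx] is then a Hermitian matrix with the kernel
   dimension of bcmx and increasing in lam. *)
Definition bcpencil a b w lam (t : R) : 'M[C]_2 := bcmx_sympl a b w lam + t%:C *: bcmx a b w lam.
Definition bcnorm w := gramN (sl_A w) (sl_B w).
Definition chart_inv a b w lam t := invmx (bcpencil a b w lam t) *m bcnorm w.
Definition chart_mx a b w lam t := bcmx a b w lam *m chart_inv a b w lam t.

Lemma ctrZ m n (k : R) (M : 'M[C]_(m, n)) : ctr (k%:C *: M) = k%:C *: ctr M.
Proof. by apply/matrixP => i j; rewrite !mxE rmorphM/= oppr0. Qed.

Lemma boundary_form_fund a b w l1 l2 k l (c1 : 'M[C]_(2, k)) (c2 : 'M[C]_(2, l)) :
  a < b -> Omega a b w -> let G := invmx (bcnorm w) in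
  (l1 - l2)%:C *: (ctr c1 *m Gram a b w l1 l2 *m c2) =
  ctr (bcmx a b w l1 *m c1) *m G *m (bcmx_sympl a b w l2 *m c2) -
  ctr (bcmx_sympl a b w l1 *m c1) *m G *m (bcmx a b w l2 *m c2).
Proof.
move=> ab hw G; have [_ [_ _ rk sa]] := hw.
have bXc p m (c : 'M[C]_(2, m)) : sl_A w *m c + sl_B w *m (Phi a b w p *m c) = bcmx a b w p *m c.
  by rewrite mulmxA -mulmxDl.
have bYc p m (c : 'M[C]_(2, m)) : sl_A w *m E *m c - sl_B w *m E *m (Phi a b w p *m c) = bcmx_sympl a b w p *m c.
  by rewrite mulmxA -mulmxBl.
have := @boundary_form _ _ _ _ _ c1 (Phi a b w l1 *m c1) c2 (Phi a b w l2 *m c2) rk sa.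
rewrite /= !bXc !bYc => <-.
rewrite scalemxAl scalemxAr -(lagrange_mx _ _ ab hw) mulmxBr mulmxBl ctrM.
by rewrite !mulmxA.
Qed.

(** Put H_i = X_i K_i; then Y_i K_i = N - t H_i. Substituted into the hypothesis multiplied by K1^*
    and K2, the terms with t cancel and the difference of H1^* and H2 remains. *)
Lemma cayley_identity (X1 Y1 X2 Y2 N S : 'M[C]_2) (t : R) (d : C) :
  N \in unitmx -> ctr N = N ->
  Y1 + t%:C *: X1 \in unitmx -> Y2 + t%:C *: X2 \in unitmx ->
  d *: S = ctr X1 *m invmx N *m Y2 - ctr Y1 *m invmx N *m X2 ->
  let K1 := invmx (Y1 + t%:C *: X1) *m N in let K2 := invmx (Y2 + t%:C *: X2) *m N in
  ctr (X1 *m K1) - X2 *m K2 = d *: (ctr K1 *m S *m K2).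
Proof.
move=> uN cN u1 u2 h K1 K2.
have e1 : Y1 *m K1 = N - t%:C *: (X1 *m K1).
  rewrite -{1}[Y1](addrK (t%:C *: X1)) mulmxBl -scalemxAl; congr (_ - _).
  by rewrite mulmxA mulmxV// mul1mx.
have e2 : Y2 *m K2 = N - t%:C *: (X2 *m K2).
  rewrite -{1}[Y2](addrK (t%:C *: X2)) mulmxBl -scalemxAl; congr (_ - _).
  by rewrite mulmxA mulmxV// mul1mx.
have -> : d *: (ctr K1 *m S *m K2) = ctr (X1 *m K1) *m invmx N *m (Y2 *m K2) -
    ctr (Y1 *m K1) *m invmx N *m (X2 *m K2).
  rewrite (scalemxAl d (ctr K1 *m S) K2) (scalemxAr d (ctr K1) S) h.
  by rewrite mulmxBr mulmxBl !ctrM !mulmxA.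
rewrite e1 e2; move: (X1 *m K1) (X2 *m K2) => H1 H2.
rewrite ctrD ctrN ctrZ cN mulmxBr mulmxBl -mulmxA mulVmx// mulmx1 mulmxBl mulmxV// mul1mx.
by rewrite -scalemxAr -!scalemxAl opprB addrA subrK.
Qed.

(** Equal parameters give the Hermitian symmetry of the chart; distinct ones give its increment
    through a Gram matrix, hence its monotonicity. *)
Lemma chart_identity a b w l1 l2 t : a < b -> Omega a b w ->
  bcpencil a b w l1 t \in unitmx -> bcpencil a b w l2 t \in unitmx ->
  ctr (chart_mx a b w l1 t) - chart_mx a b w l2 t =
  (l1 - l2)%:C *: (ctr (chart_inv a b w l1 t) *m Gram a b w l1 l2 *m chart_inv a b w l2 t).
Proof.
move=> ab hw u1 u2; have [_ [_ _ rk sa]] := hw; have uN := gramN_unit rk.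
have h := boundary_form_fund l1 l2 (1%:M : 'M[C]_2) (1%:M : 'M[C]_2) ab hw.
have unit_form (X1 Y1 X2 Y2 G S : 'M[C]_2) d :
    d *: (ctr (1%:M : 'M[C]_2) *m S *m 1%:M) =
    ctr (X1 *m 1%:M) *m G *m (Y2 *m 1%:M) - ctr (Y1 *m 1%:M) *m G *m (X2 *m 1%:M) ->
    d *: S = ctr X1 *m G *m Y2 - ctr Y1 *m G *m X2.
  by rewrite ctr1 mul1mx !mulmx1.
have {}h := unit_form _ _ _ _ _ _ _ h.
exact: (@cayley_identity _ _ _ _ _ _ t _ uN (gramN_ctr (sl_A w) (sl_B w)) u1 u2 h).
Qed.

Lemma chart_herm a b w lam t : a < b -> Omega a b w ->
  bcpencil a b w lam t \in unitmx -> ctr (chart_mx a b w lam t) = chart_mx a b w lam t.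
Proof.
move=> ab hw u1; have := chart_identity ab hw u1 u1.
by rewrite subrr scale0r => /eqP; rewrite subr_eq0 => /eqP.
Qed.

Lemma ctr_mul_eq0 n (v : 'cV[C]_n) : (ctr v *m v) 0 0 = 0 -> v = 0.
Proof.
rewrite -{2}[v]ctrK => h; have [_ /(_ h) h'] := row_norm_eq0 (ctr v).
by rewrite -[LHS]ctrK h' ctr0.
Qed.

Lemma gramN_definite w (d : 'cV[C]_2) : (ctr d *m bcnorm w *m d) 0 0 = 0 -> bcnorm w *m d = 0.
Proof.
have e : ctr d *m bcnorm w *m d = ctr (ctr (sl_A w) *m d) *m (ctr (sl_A w) *m d) +
    ctr (ctr (sl_B w) *m d) *m (ctr (sl_B w) *m d).
  by rewrite /bcnorm /gramN !ctrM !ctrK mulmxDr mulmxDl !mulmxA.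
have pos (v : 'cV[C]_2) : 0 <= (ctr v *m v) 0 0.
  by rewrite -{2}[v]ctrK; exact: (row_norm_eq0 _).1.
rewrite e mxE => /eqP; rewrite paddr_eq0// => /andP[/eqP/ctr_mul_eq0 h1 /eqP/ctr_mul_eq0 h2].
by rewrite /bcnorm /gramN mulmxDl -!mulmxA [adjoint_mx (sl_A w) *m d]h1
  [adjoint_mx (sl_B w) *m d]h2 !mulmx0 addr0.
Qed.

Lemma ctrNi n (x : 'cV[C]_n) : ctr (- 'i *: x) = 'i *: ctr x.
Proof.
apply/matrixP => i j; rewrite !mxE; case: (x j i) => p q.
by apply: cplx_eq; rewrite /=; ring.
Qed.

Lemma isotropic_i (x : 'cV[C]_2) (G : 'M[C]_2) :
  0 = ctr x *m G *m (- 'i *: x) - 'i *: ctr x *m G *m x -> ctr x *m G *m x = 0.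
Proof.
have -> : ctr x *m G *m (- 'i *: x) - 'i *: ctr x *m G *m x = (- 'i - 'i) *: (ctr x *m G *m x).
  by rewrite -scalemxAr -!scalemxAl scalerBl.
move=> /esym/eqP; rewrite scaler_eq0.
have /negPf -> : - 'i - 'i != 0 :> C.
  by rewrite -opprD oppr_eq0 -mulr2n mulrn_eq0/= eq_complex/= oner_eq0 andbF.
by move/eqP.
Qed.

Lemma det_pencil_i (X Y : 'M[C]_2) :
  (forall t : R, \det (Y + t%:C *: X) = 0) -> \det (Y + 'i *: X) = 0.
Proof.
move=> H'.
have e (t : C) i j : (Y + t *: X) i j = Y i j + t * X i j by rewrite !mxE.
have dE (t : C) : \det (Y + t *: X) = (Y 0 0 + t * X 0 0) * (Y 1 1 + t * X 1 1) -
    (Y 0 1 + t * X 0 1) * (Y 1 0 + t * X 1 0) by rewrite det2 !e.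
have e0 := etrans (esym (dE 0%:C)) (H' 0).
have e1 := etrans (esym (dE 1%:C)) (H' 1).
have e2 := etrans (esym (dE 2%:C)) (H' 2).
rewrite dE; move: e0 e1 e2.
  move: (X 0 0) (X 0 1) (X 1 0) (X 1 1) (Y 0 0) (Y 0 1) (Y 1 0) (Y 1 1).
  move=> x1 x2 x3 x4 y1 y2 y3 y4.
  rewrite rmorph1 rmorph0 (_ : 2%:C = 2); last by rewrite rmorphMn rmorph1.
  move=> e0 e1 e2; pose dX := x1 * x4 - x2 * x3.
  pose m := y1 * x4 + x1 * y4 - y2 * x3 - x2 * y3.
  have f0 : y1 * y4 - y2 * y3 = 0 by rewrite -e0; ring.
  have f1 : m + dX = 0 by rewrite -[RHS]subr0 -{1}e1 -f0 /m /dX; ring.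
  have f2 : 2 * m + 4 * dX = 0 by rewrite -[RHS]subr0 -{1}e2 -f0 /m /dX; ring.
  have f3 : dX = 0.
    have : 2 * dX = 0 by rewrite -[RHS]subr0 -{1}f2 -[X in _ - X](mulr0 2) -f1; ring.
    by move=> /eqP; rewrite mulf_eq0 pnatr_eq0/= => /eqP.
  have f4 : m = 0 by move: f1; rewrite f3 addr0.
  transitivity (y1 * y4 - y2 * y3 + 'i * m + 'i ^+ 2 * dX); first by rewrite /m /dX; ring.
  by rewrite f0 f3 f4 !mulr0 !addr0.
Qed.

(* det(Y + t X) is quadratic in t; if it vanished at 0, 1, 2 it would vanish at 'i,
   contradicting the symplectic identity. *)
Lemma chart_exists a b w lam : a < b -> Omega a b w ->
  exists t : R, bcpencil a b w lam t \in unitmx.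
Proof.
move=> ab hw; have [_ [_ _ rk sa]] := hw; have uN := gramN_unit rk.
apply: contrapT => H.
have H' t : \det (bcpencil a b w lam t) = 0.
  by apply/eqP; apply: contrapT => /negP h; apply: H; exists t; rewrite unitmxE unitfE.
pose X := bcmx a b w lam; pose Y := bcmx_sympl a b w lam.
have d0 : \det (Y + 'i *: X) = 0 by apply: det_pencil_i => t; exact: H'.
have [c c0 cE] : exists2 c : 'cV[C]_2, c != 0 & (Y + 'i *: X) *m c = 0.
  have /eqP/det0P[v v0 vE] : \det (Y + 'i *: X)^T = 0 by rewrite det_tr.
  exists v^T; first by rewrite -trmx0 (inj_eq trmx_inj).
  by rewrite -[LHS]trmxK trmx_mul trmxK vE trmx0.
have Yc : Y *m c = - 'i *: (X *m c).
  by apply/eqP; rewrite -subr_eq0 scaleNr opprK scalemxAl -mulmxDl cE.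
(* At equal parameters the left side is 0, and Y c = - i X c turns the right side into -2i x^* G x
   with x = X c; definiteness then forces x = 0. *)
have h := boundary_form_fund lam lam c c ab hw.
rewrite subrr scale0r -/X -/Y Yc ctrNi in h.
set G := invmx (bcnorm w) in h; set x := X *m c in h Yc.
have g0 : ctr x *m G *m x = 0 by exact: isotropic_i h.
have xE : x = bcnorm w *m (G *m x) by rewrite mulmxA mulmxV// mul1mx.
have x0 : x = 0.
  rewrite xE; apply: gramN_definite; rewrite -mulmxA -xE ctrM.
  have -> : ctr G = G.
    have hG : ctr G *m bcnorm w = 1%:M.
      have cN : ctr (bcnorm w) = bcnorm w by exact: gramN_ctr.
      by rewrite -{1}cN -ctrM mulmxV// ctr1.
    by rewrite -[LHS](mulmxK uN) hG mul1mx.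
  by rewrite g0 mxE.
have y0 : Y *m c = 0 by rewrite Yc -/x x0 scaler0.
(* Now X c = Y c = 0, so the right side vanishes; tested against the pair (E c, 0), the left side is
   - c^* c, because E E = -1. *)
have := @boundary_form _ _ _ _ _ c (Phi a b w lam *m c) (E *m c) (0 : 'M[C]_(2, 1)) rk sa.
have -> : sl_A w *m c + sl_B w *m (Phi a b w lam *m c) = 0.
  by rewrite mulmxA -mulmxDl.
have -> : sl_A w *m E *m c - sl_B w *m E *m (Phi a b w lam *m c) = 0.
  by rewrite mulmxA -mulmxBl.
rewrite /= ctr0 !mul0mx subrr mulmx0 subr0 -!mulmxA (mulmxA E E) EE mulNmx mul1mx.
rewrite mulmxN => /eqP; rewrite oppr_eq0 => /eqP cc.
by move/eqP : c0; apply; apply: ctr_mul_eq0; rewrite cc mxE.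
Qed.

End BoundaryForm.

(** * Ordered eigenvalues of Hermitian 2 x 2 matrices *)

Section Hermitian.
Context {R : realType}.
Local Notation C := R[i].
Implicit Types (H M : 'M[C]_2) (d : 'cV[C]_2).

Definition nrm2 d : R := (complex.Re (d 0 0) ^+ 2 + complex.Im (d 0 0) ^+ 2) +
  (complex.Re (d 1 0) ^+ 2 + complex.Im (d 1 0) ^+ 2).
Definition qf H d : R := complex.Re ((ctr d *m H *m d) 0 0).
(** Half the gap between the eigenvalues of a Hermitian matrix, which are half the trace plus or
    minus this number. *)
Definition radius H : R := Num.sqrt (((complex.Re (H 0 0) - complex.Re (H 1 1)) / 2) ^+ 2 +
  (complex.Re (H 0 1) ^+ 2 + complex.Im (H 0 1) ^+ 2)).
(* The larger eigenvalue of a Hermitian 2 x 2 matrix. *)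
Definition evp H : R := (complex.Re (H 0 0) + complex.Re (H 1 1)) / 2 + radius H.

Lemma nrm2_ge0 d : 0 <= nrm2 d.
Proof. by rewrite !addr_ge0 ?sqr_ge0. Qed.

Lemma nrm2_gt0 d : d != 0 -> 0 < nrm2 d.
Proof.
move=> d0; rewrite lt_neqAle nrm2_ge0 andbT eq_sym; apply: contra d0.
rewrite /nrm2 !paddr_eq0 ?addr_ge0 ?sqr_ge0// !sqrf_eq0.
move=> /andP[/andP[/eqP h1 /eqP h2] /andP[/eqP h3 /eqP h4]].
apply/eqP/matrixP => i j; rewrite (ord1 j) mxE.
by have [->|->] := ord2P i; apply: cplx_eq.
Qed.

Lemma herm_entries H : ctr H = H ->
  [/\ complex.Im (H 0 0) = 0, complex.Im (H 1 1) = 0 & H 1 0 = conjc (H 0 1)].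
Proof.
move=> h; have e i j : conjc (H j i) = H i j.
  by have := congr1 (fun M : 'M[C]_2 => M i j) h; rewrite !mxE.
split; last by rewrite -e.
  by have := e 0 0; case: (H 0 0) => x y /= [/eqP]; rewrite -subr_eq0; lra.
by have := e 1 1; case: (H 1 1) => x y /= [/eqP]; rewrite -subr_eq0; lra.
Qed.

Lemma qfE M d : qf M d =
  complex.Re (conjc (d 0 0) * M 0 0 * d 0 0 + conjc (d 0 0) * M 0 1 * d 1 0 +
   conjc (d 1 0) * M 1 0 * d 0 0 + conjc (d 1 0) * M 1 1 * d 1 0).
Proof.
by rewrite /qf !mxE !sum2 !mxE !sum2 !mxE; congr complex.Re; ring.
Qed.

Lemma qf_herm H d : ctr H = H -> qf H d =
  complex.Re (H 0 0) * (complex.Re (d 0 0) ^+ 2 + complex.Im (d 0 0) ^+ 2) +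
  complex.Re (H 1 1) * (complex.Re (d 1 0) ^+ 2 + complex.Im (d 1 0) ^+ 2) +
  2 * (complex.Re (H 0 1) * (complex.Re (d 0 0) * complex.Re (d 1 0) + complex.Im (d 0 0) * complex.Im (d 1 0)) -
       complex.Im (H 0 1) * (complex.Re (d 0 0) * complex.Im (d 1 0) - complex.Im (d 0 0) * complex.Re (d 1 0))).
Proof.
move=> /herm_entries[h1 h2 h3]; rewrite qfE h3; move: h1 h2.
case: (H 0 0) (H 0 1) (H 1 1) (d 0 0) (d 1 0) => [? ?] [? ?] [? ?] [? ?] [? ?] /= -> ->.
ring.
Qed.

(** Let P = |d0|^2, Q = |d1|^2 and z1 + i z2 = conj d0 d1. After removal of half the trace, the form
    is the scalar product of (k, x, -y) with (P - Q, 2 z1, 2 z2), a vector of length P + Q. The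
    bound is the Cauchy-Schwarz inequality, and the three squares are those of Lagrange's
    identity. *)
Lemma evp_ge H d : ctr H = H -> qf H d <= evp H * nrm2 d.
Proof.
move=> /qf_herm ->; rewrite /evp /nrm2.
set al := complex.Re (H 0 0); set de := complex.Re (H 1 1).
set x := complex.Re (H 0 1); set y := complex.Im (H 0 1).
move: (complex.Re (d 0 0)) (complex.Im (d 0 0)) (complex.Re (d 1 0)) (complex.Im (d 1 0)).
move=> a1 a2 b1 b2.
pose k := (al - de) / 2; pose s := radius H.
have s0 : 0 <= s by exact: sqrtr_ge0.
have s2 : s ^+ 2 = k ^+ 2 + (x ^+ 2 + y ^+ 2) by rewrite sqr_sqrtr// !addr_ge0 ?sqr_ge0.
pose P := a1 ^+ 2 + a2 ^+ 2; pose Q := b1 ^+ 2 + b2 ^+ 2.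
pose z1 := a1 * b1 + a2 * b2; pose z2 := a1 * b2 - a2 * b1.
have zz : z1 ^+ 2 + z2 ^+ 2 = P * Q by rewrite /z1 /z2 /P /Q; ring.
have P0 : 0 <= P by rewrite addr_ge0 ?sqr_ge0.
have Q0 : 0 <= Q by rewrite addr_ge0 ?sqr_ge0.
suff key : k * (P - Q) + 2 * (x * z1 - y * z2) <= s * (P + Q).
  rewrite -/s -/P -/Q -/z1 -/z2 [leRHS]mulrDl.
  have -> : al * P + de * Q = (al + de) / 2 * (P + Q) + k * (P - Q) by rewrite /k; field.
  by rewrite -addrA lerD2l.
apply: (le_trans (ler_norm _)).
have sPQ : 0 <= s * (P + Q) by rewrite mulr_ge0// addr_ge0.
rewrite -(@ler_pXn2r _ 2)// real_normK ?num_real//.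
rewrite exprMn s2 -subr_ge0.
have -> : (k ^+ 2 + (x ^+ 2 + y ^+ 2)) * (P + Q) ^+ 2 - (k * (P - Q) + 2 * (x * z1 - y * z2)) ^+ 2 =
  (2 * k * z1 - x * (P - Q)) ^+ 2 + (2 * k * z2 + y * (P - Q)) ^+ 2 + (2 * x * z2 + 2 * y * z1) ^+ 2.
  have -> : (P + Q) ^+ 2 = (P - Q) ^+ 2 + 4 * (z1 ^+ 2 + z2 ^+ 2) by rewrite zz; ring.
  ring.
by rewrite !addr_ge0 ?sqr_ge0.
Qed.

(** Explicit eigenvectors: (s + k, conj h01) if k >= 0 and (h01, s - k) if k < 0, the sign of k
    being used to keep one entry positive. For s = 0 the matrix is scalar and any vector serves. *)
Lemma evp_attained H : ctr H = H -> exists2 d, d != 0 & qf H d = evp H * nrm2 d.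
Proof.
move=> hH; pose al := complex.Re (H 0 0); pose de := complex.Re (H 1 1).
pose x := complex.Re (H 0 1); pose y := complex.Im (H 0 1).
pose k := (al - de) / 2; pose s := radius H.
have s0 : 0 <= s by exact: sqrtr_ge0.
have s2 : s ^+ 2 = k ^+ 2 + (x ^+ 2 + y ^+ 2) by rewrite sqr_sqrtr// !addr_ge0 ?sqr_ge0.
have sk : `|k| <= s.
  by rewrite -(@ler_pXn2r _ 2)// real_normK ?num_real// s2 lerDl addr_ge0 ?sqr_ge0.
pose dv (p q : C) : 'cV[C]_2 := \col_i (if i == 0 then p else q).
have dv0 p q : dv p q 0 0 = p by rewrite mxE.
have dv1 p q : dv p q 1 0 = q by rewrite mxE.
have dvne p q : (p != 0) || (q != 0) -> dv p q != 0.
  by apply: contraTN => /eqP e; rewrite -(dv0 p q) -{2}(dv1 p q) e !mxE eqxx.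
pose m := (al + de) / 2.
have alE : al = m + k by rewrite /k /m; field.
have deE : de = m - k by rewrite /k /m; field.
have [sz|sz] := eqVneq s 0.
  have [k0 x0 y0] : [/\ k = 0, x = 0 & y = 0].
    move: s2; rewrite sz expr0n /= => /esym/eqP.
    by rewrite !paddr_eq0 ?addr_ge0 ?sqr_ge0// !sqrf_eq0 => /andP[/eqP-> /andP[/eqP-> /eqP->]].
  exists (dv 1 0); first by apply: dvne; rewrite oner_eq0.
  rewrite qf_herm// /nrm2 !dv0 !dv1 /evp -/s sz -/al -/de -/x -/y x0 y0 /=.
  by rewrite alE deE k0; field.
have [k0|k0] := leP 0 k.
  exists (dv (s + k)%:C (conjc (H 0 1))).
    apply: dvne; rewrite eq_complex/= eqxx andbT; apply/orP; left.
    by rewrite gt_eqF// ltr_wpDr// lt_neqAle eq_sym sz.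
  rewrite qf_herm// /nrm2 !dv0 !dv1 /evp -/s -/al -/de.
  have -> : complex.Re (conjc (H 0 1)) = x by rewrite /x; case: (H 0 1).
  have -> : complex.Im (conjc (H 0 1)) = - y by rewrite /y; case: (H 0 1).
  rewrite /= -/x -/y alE deE.
  have -> : x ^+ 2 = s ^+ 2 - k ^+ 2 - y ^+ 2 by rewrite s2; ring.
  have xx : x * x = s ^+ 2 - k ^+ 2 - y ^+ 2 by rewrite -expr2 s2; ring.
  rewrite (_ : x * ((s + k) * x + 0 * - y) = (s + k) * (x * x)); last by ring.
  by rewrite xx; field.
exists (dv (H 0 1) (s - k)%:C).
  apply: dvne; apply/orP; right; rewrite eq_complex/= eqxx andbT.
  by rewrite gt_eqF// subr_gt0 (lt_le_trans k0).
rewrite qf_herm// /nrm2 !dv0 !dv1 /evp -/s -/al -/de /= -/x -/y alE deE.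
have xx : x * x = s ^+ 2 - k ^+ 2 - y ^+ 2 by rewrite -expr2 s2; ring.
have -> : x ^+ 2 = s ^+ 2 - k ^+ 2 - y ^+ 2 by rewrite s2; ring.
rewrite (_ : x * (x * (s - k) + y * 0) = (s - k) * (x * x)); last by ring.
by rewrite xx; field.
Qed.

Lemma qfN H d : qf (- H) d = - qf H d.
Proof. by rewrite /qf mulmxN mulNmx mxE raddfN. Qed.

Lemma qfB H M d : qf (H - M) d = qf H d - qf M d.
Proof. by rewrite /qf mulmxBr mulmxBl !mxE raddfB. Qed.

Lemma qfZ (k : R) M d : qf (k%:C *: M) d = k * qf M d.
Proof.
rewrite /qf -scalemxAr -scalemxAl; move: (ctr d *m M *m d) => N.
by rewrite mxE; case: (N 0 0) => x y /=; rewrite mul0r subr0.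
Qed.

(** Variational principle: a vector attaining the larger eigenvalue of H2 is a test vector for
    H1. *)
Lemma evp_mono H1 H2 (c : R) : ctr H1 = H1 -> ctr H2 = H2 ->
  (forall d, qf H2 d + c * nrm2 d <= qf H1 d) -> evp H2 + c <= evp H1.
Proof.
move=> h1 h2 h; have [d d0 e] := evp_attained h2.
have p := nrm2_gt0 d0; rewrite -(ler_pM2r p) mulrDl -e.
exact: le_trans (h d) (evp_ge _ h1).
Qed.

Lemma ctr_herm_N H : ctr H = H -> ctr (- H) = - H.
Proof. by move=> h; rewrite ctrN h. Qed.

(** The smaller eigenvalue is minus the larger one of the opposite matrix; the boolean index treats
    both branches in one statement. *)
Definition ev (i : bool) H : R := if i then evp H else - evp (- H).

Lemma ev_mono i H1 H2 (c : R) : ctr H1 = H1 -> ctr H2 = H2 ->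
  (forall d, qf H2 d + c * nrm2 d <= qf H1 d) -> ev i H2 + c <= ev i H1.
Proof.
move=> h1 h2 h; case: i => /=; first exact: evp_mono.
rewrite -lerBrDr -opprD lerN2; apply: evp_mono; try exact: ctr_herm_N.
by move=> d; rewrite !qfN; have := h d; lra.
Qed.

Lemma ReN_ (z : C) : complex.Re (- z) = - complex.Re z. Proof. by case: z. Qed.
Lemma ImN_ (z : C) : complex.Im (- z) = - complex.Im z. Proof. by case: z. Qed.

Lemma radiusN H : radius (- H) = radius H.
Proof. by rewrite /radius !mxE !ReN_ ImN_; congr Num.sqrt; field. Qed.

Lemma ev_sum H : ev false H = (complex.Re (H 0 0) + complex.Re (H 1 1)) / 2 - radius H.
Proof. by rewrite /ev/= /evp radiusN !mxE !ReN_ /=; field. Qed.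

(** The determinant is the product (m + s)(m - s) of the two eigenvalues. If it vanishes, rank 1 is
    excluded from having both eigenvalues zero, since m = s = 0 forces H = 0. *)
Lemma rank_ev H : ctr H = H ->
  (2 - \rank H)%N = ((ev true H == 0%R) + (ev false H == 0%R))%N.
Proof.
move=> hH; have [i0 i1 e10] := herm_entries hH.
rewrite ev_sum /ev /evp; set s := radius H.
pose m := (complex.Re (H 0 0) + complex.Re (H 1 1)) / 2; rewrite -/m.
have s2 : s ^+ 2 = ((complex.Re (H 0 0) - complex.Re (H 1 1)) / 2) ^+ 2 +
    (complex.Re (H 0 1) ^+ 2 + complex.Im (H 0 1) ^+ 2).
  by rewrite sqr_sqrtr// !addr_ge0 ?sqr_ge0.
have dE : \det H = ((m + s) * (m - s))%:C.
  have -> : (m + s) * (m - s) = m ^+ 2 - s ^+ 2 by ring.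
  rewrite s2 det2 e10 /m; move: i0 i1.
  case: (H 0 0) (H 1 1) (H 0 1) => [? ?] [? ?] [? ?] /= -> ->.
  by apply: cplx_eq => /=; field.
have [d0|d0] := boolP (H \in unitmx).
  move: (d0); rewrite unitmxE unitfE dE eq_complex/= eqxx andbT mulf_eq0 negb_or.
  move=> /andP[/negPf-> /negPf->]; move: d0; rewrite -row_free_unit => /eqP ->.
  by [].
have : (m + s) * (m - s) = 0.
  by move: d0; rewrite unitmxE unitfE negbK dE eq_complex/= eqxx andbT => /eqP.
have rk1 : (\rank H < 2)%N.
  by move: d0; rewrite -row_free_unit /row_free neq_ltn (ltnNge 2%N) rank_leq_row orbF.
have [H0|H0] := eqVneq H 0.
  move=> _; rewrite H0 mxrank0.
  have [-> ->] : m = 0 /\ s = 0.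
    by rewrite /m /s /radius H0 !mxE /= !addr0 !subr0 mul0r expr0n/= !addr0 sqrtr0.
  by rewrite addr0 subr0 eqxx.
have rk2 : (0 < \rank H)%N by rewrite lt0n mxrank_eq0.
have -> : \rank H = 1%N by apply/eqP; rewrite eqn_leq rk2 -ltnS rk1.
move=> /eqP; rewrite mulf_eq0 => h.
suff : ~~ ((m + s == 0) && (m - s == 0)) by case: (m + s == 0) h; case: (m - s == 0).
apply/negP => /andP[/eqP k1 /eqP k2]; move/eqP : H0; apply.
have [s0 m0] : s = 0 /\ m = 0 by lra.
move: s2; rewrite s0 expr0n/= => /esym/eqP.
rewrite !paddr_eq0 ?addr_ge0 ?sqr_ge0// !sqrf_eq0 => /andP[/eqP k3 /andP[/eqP k4 /eqP k5]].
have H01 : H 0 1 = 0 by exact: cplx_eq.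
have [r0 r1] : complex.Re (H 0 0) = 0 /\ complex.Re (H 1 1) = 0.
  by move: m0 k3; rewrite /m; lra.
apply/matrixP => i j; rewrite mxE; have [->|->] := ord2P i; have [->|->] := ord2P j.
- exact: cplx_eq.
- exact: H01.
- by rewrite e10 H01; apply: cplx_eq; rewrite /= ?oppr0.
- exact: cplx_eq.
Qed.

End Hermitian.

Section EvConvergence.
Context {R : realType} {T : Type} (F : set_system T) {FF : Filter F}.

Lemma sqrt_cvg (f : T -> R) (l : R) : f t @[t --> F] --> l ->
  Num.sqrt (f t) @[t --> F] --> Num.sqrt l.
Proof. by move=> h; apply: (cvg_comp _ _ h); exact: sqrt_continuous. Qed.

Lemma sqr_cvg (f : T -> R) (l : R) : f t @[t --> F] --> l -> f t ^+ 2 @[t --> F] --> l ^+ 2.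
Proof. by move=> h; rewrite expr2; under eq_cvg do rewrite expr2; exact: cvgM. Qed.

Lemma evp_cvg (M : T -> 'M[R[i]]_2) L : cvM F M L -> evp (M t) @[t --> F] --> evp L.
Proof.
move=> h; have h1 i j := (h i j).1; have h2 i j := (h i j).2.
apply: (@cvgD _ R^o).
  by apply: cvgM; [apply: (@cvgD _ R^o)|exact: cvg_cst].
apply: sqrt_cvg; apply: (@cvgD _ R^o).
  by apply: sqr_cvg; apply: cvgM; [apply: (@cvgB _ R^o)|exact: cvg_cst].
by apply: (@cvgD _ R^o); exact: sqr_cvg.
Qed.

Lemma ev_cvg i (M : T -> 'M[R[i]]_2) L : cvM F M L -> ev i (M t) @[t --> F] --> ev i L.
Proof.
case: i => h /=; first exact: evp_cvg.
by apply: (@cvgN _ R^o); apply: evp_cvg; exact: cvMN.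
Qed.

End EvConvergence.

(** * Local counting of eigenvalues *)

Section Chart.
Context {R : realType}.
Local Notation C := R[i].
Local Notation E := (symplecticE R).
Implicit Types (a b x lam : R) (w : sl_problem R).

Lemma unitmx_det (M : 'M[C]_2) : (M \in unitmx) = (\det M != 0).
Proof. by rewrite unitmxE unitfE. Qed.

Lemma entry_cvg a b lam0 w0 (M : sl_problem R -> 'M[C]_2) :
  (forall w, entry_norm (M w - M w0) <= sl_dist a b w w0 \/ ~ Omega a b w) ->
  cvM (slnear a b lam0 w0) (fun p => M p.2) (M w0).
Proof.
move=> H i j; split; apply/(@cvgrPdist_lt _ R^o) => e e0; exists e => // l1 l2 w _ _ hw hd /=;
  have [h|//] := H w; apply: le_lt_trans (le_lt_trans h hd);
  apply: le_trans (entry_norm_ge _ i j); rewrite distrC !mxE;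
  case: (M w i j) (M w0 i j) => [x1 x2] [y1 y2] /=.
  exact: (Re_le_normc ((x1 - y1) +i* (x2 - y2))).
exact: (Im_le_normc ((x1 - y1) +i* (x2 - y2))).
Qed.

Lemma A_cvg a b lam0 w0 : Omega a b w0 ->
  cvM (slnear a b lam0 w0) (fun p => sl_A p.2) (sl_A w0).
Proof.
move=> h0; apply: (@entry_cvg _ _ _ _ (@sl_A R)) => w.
have [hw|] := pselect (Omega a b w); last by right.
by left; rewrite sl_distE -addrA lerDl addr_ge0 ?entry_norm_ge0// sl_dist_coef_ge0.
Qed.

Lemma B_cvg a b lam0 w0 : Omega a b w0 ->
  cvM (slnear a b lam0 w0) (fun p => sl_B p.2) (sl_B w0).
Proof.
move=> h0; apply: (@entry_cvg _ _ _ _ (@sl_B R)) => w.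
have [hw|] := pselect (Omega a b w); last by right.
left; rewrite sl_distE -addrA addrCA lerDl addr_ge0 ?entry_norm_ge0// sl_dist_coef_ge0//.
Qed.

Section Along.
Variables (a b lam0 : R) (w0 : sl_problem R) (lam : R * R * sl_problem R -> R).
Hypotheses (ab : a < b) (h0 : Omega a b w0)
  (lamc : lam p @[p --> slnear a b lam0 w0] --> lam0).
Local Notation F := (slnear a b lam0 w0).

Lemma Phi_cvg : cvM F (fun p => Phi a b p.2 (lam p)) (Phi a b w0 lam0).
Proof.
move=> i j; have [c1 c2] := fund_unif_cvg j ab h0 lamc.
have pt (f : R * R * sl_problem R -> R -> R) g :
    unif_cvg F a b f g -> f p b @[p --> F] --> g b.
  move=> H; apply/(@cvgrPdist_lt _ R^o) => e e0; have n := H e e0.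
  by apply: filterS n => p h; rewrite distrC; apply: h => //; exact: ltW.
rewrite mxE (_ : (fun t => _) = (fun t => (if i == 0 then fy a b t.2 (lam t) j b
  else fu a b t.2 (lam t) j b)%:C)); last by apply/funext => t; rewrite mxE.
by apply: cvC_real; case: (i == 0); [exact: (pt _ _ c1)|exact: (pt _ _ c2)].
Qed.

Lemma bcmx_cvg : cvM F (fun p => bcmx a b p.2 (lam p)) (bcmx a b w0 lam0).
Proof. by apply: cvMD; [exact: A_cvg|apply: cvMM; [exact: B_cvg|exact: Phi_cvg]]. Qed.

Lemma bcmx_sympl_cvg : cvM F (fun p => bcmx_sympl a b p.2 (lam p)) (bcmx_sympl a b w0 lam0).
Proof.
apply: cvMD; first by apply: cvMM; [exact: A_cvg|exact: cvM_cst].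
apply: cvMN; apply: cvMM; last exact: Phi_cvg.
by apply: cvMM; [exact: B_cvg|exact: cvM_cst].
Qed.

Lemma bcpencil_cvg t : cvM F (fun p => bcpencil a b p.2 (lam p) t) (bcpencil a b w0 lam0 t).
Proof. by apply: cvMD; [exact: bcmx_sympl_cvg|apply: cvMZ; [exact: cvC_cst|exact: bcmx_cvg]]. Qed.

Lemma bcnorm_cvg : cvM F (fun p => bcnorm p.2) (bcnorm w0).
Proof.
by apply: cvMD; (apply: cvMM; last apply: cvM_adj); [exact: A_cvg|exact: A_cvg|exact: B_cvg|exact: B_cvg].
Qed.

Lemma chart_inv_cvg t : bcpencil a b w0 lam0 t \in unitmx ->
  cvM F (fun p => chart_inv a b p.2 (lam p) t) (chart_inv a b w0 lam0 t).
Proof. by move=> u; apply: cvMM; [apply: cvM_inv => //; exact: bcpencil_cvg|exact: bcnorm_cvg]. Qed.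

Lemma chart_mx_cvg t : bcpencil a b w0 lam0 t \in unitmx ->
  cvM F (fun p => chart_mx a b p.2 (lam p) t) (chart_mx a b w0 lam0 t).
Proof. by move=> u; apply: cvMM; [exact: bcmx_cvg|exact: chart_inv_cvg]. Qed.

Lemma bcpencil_unit_near t : bcpencil a b w0 lam0 t \in unitmx ->
  \forall p \near F, bcpencil a b p.2 (lam p) t \in unitmx.
Proof.
move=> u; rewrite unitmx_det in u; have n := cvC_neq0 u (cvM_det (bcpencil_cvg t)).
by near=> p; rewrite unitmx_det; near: p; exact: n.
Unshelve. all: by end_near. Qed.

End Along.

Lemma cvM_real {T : Type} (F : set_system T) {FF : Filter F} (M : T -> 'M[C]_2) (L : 'M[C]_2)
    (m : T -> 'I_2 -> 'I_2 -> R) (l : 'I_2 -> 'I_2 -> R) :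
  (forall t i j, M t i j = (m t i j)%:C) -> (forall i j, L i j = (l i j)%:C) ->
  (forall i j, m t i j @[t --> F] --> l i j) -> cvM F M L.
Proof.
move=> hM hL h i j; rewrite hL (_ : (fun t => M t i j) = fun t => (m t i j)%:C).
  exact: cvC_real.
exact/funext.
Qed.

Lemma Gram_cvg a b lam0 w0 : a < b -> Omega a b w0 ->
  cvM (slnear a b lam0 w0) (fun p => Gram a b p.2 p.1.1 p.1.2) (Gram a b w0 lam0 lam0).
Proof.
move=> ab h0; apply: (cvM_real (m := fun p => gram a b p.2 p.1.1 p.1.2)).
- by move=> t i j; rewrite mxE.
- by move=> i j; rewrite mxE.
- by move=> i j; exact: gram_cvg.
Qed.

Lemma qf_conj (K M : 'M[C]_2) d : qf (ctr K *m M *m K) d = qf M (K *m d).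
Proof. by rewrite /qf ctrM !mulmxA. Qed.

Lemma qf_ctr (M : 'M[C]_2) d : qf (ctr M) d = qf M d.
Proof.
rewrite !qfE !mxE; move: (M 0 0) (M 0 1) (M 1 0) (M 1 1) (d 0 0) (d 1 0).
by move=> [? ?] [? ?] [? ?] [? ?] [? ?] [? ?] /=; ring.
Qed.

Lemma qfD (H M : 'M[C]_2) d : qf (H + M) d = qf H d + qf M d.
Proof. by have := qfB H (- M) d; rewrite qfN !opprK. Qed.

(** The quadratic form at d is the integral of r |y|^2 for the solution y with initial value d,
    which is not identically zero. *)
Lemma qf_Gram_gt0 a b w lam d : a < b -> Omega a b w -> d != 0 ->
  0 < qf (Gram a b w lam lam) d.
Proof.
move=> ab hw d0; have [_ _ hr _] := L1_coef hw; have [_ [_ r0 _ _]] := hw.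
have [h1 h2] := (sl_solution_real _ _ _ ab hw).1 (csol_sol lam d ab hw).
have [x0 [ax xb yx]] : exists x, [/\ a <= x, x <= b & cy a b w lam d x != 0].
  apply: contrapT => H; move/eqP : d0; apply; apply: (csol_inj ab hw (lam := lam)) => x ax xb.
  by apply: contrapT => /eqP h; apply: H; exists x.
have pos := intg_weight_gt0 ab hr r0 h1.1 h2.1 ax xb.
have {pos} : 0 < intg a b (fun x => sl_r w x * (complex.Re (cy a b w lam d x) ^+ 2 + complex.Im (cy a b w lam d x) ^+ 2)).
  by apply: pos; move: yx; case: (cy a b w lam d x0) => p q; rewrite eq_complex negb_and.
congr (0 < _); rewrite qfE !mxE.
have bf i : bmeas a b (fy a b w lam i) by exact: (fund_bmeas lam i ab hw).1.
pose g i j x := sl_r w x * (fy a b w lam i x * fy a b w lam j x).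
have lg i j : L1 a b (g i j) by apply: bmeas_L1M => //; exact: bmeasM.
pose al i j := complex.Re (conjc (d i 0) * d j 0).
transitivity (intg a b (fun x => (al 0 0 * g 0 0 x + al 0 1 * g 0 1 x) +
    (al 1 0 * g 1 0 x + al 1 1 * g 1 1 x))).
  apply: eq_intg => x _; rewrite /al /g /cy Re_comb Im_comb.
  by move: (d 0 0) (d 1 0) => [? ?] [? ?] /=; ring.
rewrite !intgD; try (by do ?apply: L1D; exact: L1Z).
rewrite !intgZ; try exact: lg.
rewrite -!/(gram a b w lam lam _ _) /al.
by move: (d 0 0) (d 1 0) => [? ?] [? ?] /=; ring.
Qed.

(** The difference quotient of the chart between the two parameters, in the form supplied by
    [chart_identity]; on the diagonal it is meaningful without division. *)
Definition chart_speed a b t (p : R * R * sl_problem R) : 'M[C]_2 :=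
  ctr (chart_inv a b p.2 p.1.1 t) *m Gram a b p.2 p.1.1 p.1.2 *m chart_inv a b p.2 p.1.2 t.

(** The Hermitian part [hS] has the same quadratic form. Its smaller eigenvalue is continuous and
    positive at [p0], where the Gram matrix is positive definite; half of this value is a lower
    bound nearby. *)
Lemma chart_speed_near a b lam0 w0 t : a < b -> Omega a b w0 -> bcpencil a b w0 lam0 t \in unitmx ->
  exists2 k : R, 0 < k & \forall p \near slnear a b lam0 w0,
    forall d, k * nrm2 d <= qf (chart_speed a b t p) d.
Proof.
move=> ab h0 u; pose hS p := (2^-1)%:C *: (chart_speed a b t p + ctr (chart_speed a b t p)).
have qh p d : qf (hS p) d = qf (chart_speed a b t p) d.
  by rewrite qfZ qfD qf_ctr; field.
have ch p : ctr (hS p) = hS p by rewrite ctrZ ctrD ctrK addrC.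
pose p0 := (lam0, lam0, w0); have u1 := @slnear_lam1 R a b lam0 w0.
have u2 := @slnear_lam2 R a b lam0 w0.
have cS : cvM (slnear a b lam0 w0) (chart_speed a b t) (chart_speed a b t p0).
  apply: cvMM; last exact: chart_inv_cvg.
  by apply: cvMM; [apply: cvM_adj; exact: chart_inv_cvg|exact: Gram_cvg].
have chS : cvM (slnear a b lam0 w0) hS (hS p0).
  by apply: cvMZ; [exact: cvC_cst|apply: cvMD => //; exact: cvM_adj].
have cev : ev false (hS p) @[p --> slnear a b lam0 w0] --> ev false (hS p0).
  exact: ev_cvg.
have lb p d : ev false (hS p) * nrm2 d <= qf (chart_speed a b t p) d.
  rewrite -qh /ev mulNr lerNl -qfN; apply: evp_ge; exact: ctr_herm_N.
have k0 : 0 < ev false (hS p0).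
  have [d d0] := evp_attained (ctr_herm_N (ch p0)).
  have p := nrm2_gt0 d0; rewrite qfN qh => h.
  rewrite -(pmulr_lgt0 _ p) /ev mulNr -h opprK /chart_speed qf_conj; apply: qf_Gram_gt0 => //.
  apply: contra d0 => /eqP Kd; have uK : chart_inv a b w0 lam0 t \in unitmx.
    have [_ [_ _ rk _]] := h0; rewrite /chart_inv unitmx_mul unitmx_inv u /=.
    exact: gramN_unit.
  by rewrite -[d](mulKmx uK) Kd mulmx0.
exists (ev false (hS p0) / 2); first by rewrite divr_gt0.
have lt2 : ev false (hS p0) / 2 < ev false (hS p0) by rewrite ltr_pdivrMr//; lra.
have n : \forall p \near slnear a b lam0 w0, ev false (hS p0) / 2 < ev false (hS p) by exact: (cvgr_gt _ cev).
move: n.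
case=> e e0 he; exists e => // l1 l2 w i1 i2 i3 i4 d; apply: le_trans (lb _ d).
apply: ler_wpM2r; first exact: nrm2_ge0.
apply: ltW; exact: (he l1 l2 w i1 i2 i3 i4).
Qed.

Lemma qf_increment (H1 H2 S : 'M[C]_2) (c k : R) d : ctr H2 = H2 ->
  ctr H2 - H1 = c%:C *: S -> 0 <= c -> k * nrm2 d <= qf S d ->
  qf H1 d + c * k * nrm2 d <= qf H2 d.
Proof.
move=> -> e c0 h; have := qfB H2 H1 d; rewrite e qfZ => e2.
by rewrite addrC -lerBrDr -e2 -mulrA ler_wpM2l.
Qed.

(* The functions [f true] and [f false] are the ordered eigenvalues of [chart_mx]. *)
Definition slchart a b w0 lam0 (f : bool -> R -> sl_problem R -> R) (d : R) : Prop :=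
  [/\ 0 < d,
   forall w l, Omega a b w -> sl_dist a b w w0 < d -> `|l - lam0| < d ->
     multiplicity a b w l%:C ((f true l w == 0%R) + (f false l w == 0%R))%N,
   forall i w l1 l2, Omega a b w -> sl_dist a b w w0 < d -> `|l1 - lam0| < d ->
     `|l2 - lam0| < d -> l1 < l2 -> f i l1 w < f i l2 w &
   forall i w l, Omega a b w -> sl_dist a b w w0 < d -> `|l - lam0| < d ->
     f i p.1.1 p.2 @[p --> slnear a b l w] --> f i l w].

(** The right factor of the chart is invertible, so chart and [bcmx] have the same rank. The uniform
    lower bound for the speed makes both ordered eigenvalues strictly increasing. *)
Lemma slchart_exists a b w0 lam0 : a < b -> Omega a b w0 ->
  exists f d, slchart a b w0 lam0 f d.
Proof.
move=> ab h0; have [t u] := chart_exists lam0 ab h0.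
have n1 := bcpencil_unit_near ab h0 (@slnear_lam1 R a b lam0 w0) u.
have [k k0 n2] := chart_speed_near ab h0 u.
have [d d0 hd] := filterI n1 n2.
exists (fun i l w => ev i (chart_mx a b w l t)), d.
have U w l : Omega a b w -> sl_dist a b w w0 < d -> `|l - lam0| < d -> bcpencil a b w l t \in unitmx.
  by move=> hw hd1 hl; have [] := hd l l w hl hl hw hd1.
split => //.
- move=> w l hw hd1 hl; have ut := U w l hw hd1 hl.
  rewrite -rank_ev; last exact: chart_herm.
  have -> : \rank (chart_mx a b w l t) = \rank (bcmx a b w l).
    apply: mxrankMfree; rewrite row_free_unit /chart_inv unitmx_mul unitmx_inv ut /=.
    have [_ [_ _ rk _]] := hw; exact: gramN_unit.
  exact: multiplicity_rank.
- move=> i w l1 l2 hw hd1 hl1 hl2 l12.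
  have ut1 := U w l1 hw hd1 hl1; have ut2 := U w l2 hw hd1 hl2.
  have c0 : 0 < (l2 - l1) * k by rewrite mulr_gt0// subr_gt0.
  apply: (@lt_le_trans _ _ (ev i (chart_mx a b w l1 t) + (l2 - l1) * k)); first by rewrite ltrDl.
  apply: ev_mono; try exact: chart_herm.
  move=> v; have [_ /(_ v) h] := hd l2 l1 w hl2 hl1 hw hd1.
  apply: (qf_increment (chart_herm ab hw ut2) (chart_identity ab hw ut2 ut1) _ h).
  by rewrite subr_ge0 ltW.
- move=> i w l hw hd1 hl.
  have c := chart_mx_cvg ab hw (@slnear_lam1 R a b l w) (U w l hw hd1 hl).
  exact: (ev_cvg c).
Qed.

End Chart.

(** * Counting eigenvalues and continuity of the n-th one *)

Section Counting.
Context {R : realType}.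
Implicit Types (a b x lam : R) (w : sl_problem R).

Lemma sl_dist_refl a b w : sl_dist a b w w = 0.
Proof.
rewrite sl_distE !subrr !entry_norm0 /sl_dist_coef.
rewrite (@eq_intg _ _ _ _ (fun=> 0)); last by move=> t _; rewrite !subrr normr0 !addr0.
by rewrite /intg Rintegral_cst//= mul0r !addr0.
Qed.

(** The zero, if there is one, is returned as a list, so that the lists of both branches can be
    concatenated and counted with multiplicity. *)
Lemma increasing_zeros (g : R -> R) y z : y < z -> g y != 0 -> g z != 0 ->
  {within `[y, z], continuous g} ->
  (forall s t, y <= s -> s < t -> t <= z -> g s < g t) ->
  exists t : seq R, [/\ size t = (g y < 0 < g z) :> nat, all (fun s => y < s < z) t &
    forall mu, y <= mu <= z -> count_mem mu t = (g mu == 0) :> nat].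
Proof.
move=> yz gy gz cg mono.
have lt0 s : y <= s -> s <= z -> s != y -> g y < g s.
  by move=> ys sz ne; apply: mono => //; rewrite lt_neqAle eq_sym ne.
have gt0 s : y <= s -> s <= z -> s != z -> g s < g z.
  by move=> ys sz ne; apply: mono => //; rewrite lt_neqAle ne.
have [/andP[y0 z0]|no] := boolP (g y < 0 < g z).
  have [|c cyz gc] := IVT (v := 0) (ltW yz) cg.
    by rewrite min_l ?max_r ?(ltW y0) ?(ltW z0)// ltW// (lt_trans y0).
  move: cyz; rewrite in_itv/= => /andP[yc cz].
  have cny : c != y by apply: contraTneq y0 => <-; rewrite gc ltxx.
  have cnz : c != z by apply: contraTneq z0 => <-; rewrite gc ltxx.
  exists [:: c]; split => //=; first by rewrite !lt_neqAle yc cz cnz eq_sym cny.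
  move=> mu /andP[ymu muz]; rewrite addn0; congr nat_of_bool.
  apply/eqP/eqP => [<- //|gmu]; have [h|h|//] := ltgtP c mu.
    by have := mono c mu yc h muz; rewrite gc gmu ltxx.
  by have := mono mu c ymu h cz; rewrite gc gmu ltxx.
exists [::]; split => // mu /andP[ymu muz] /=; apply/esym/eqP; rewrite eqb0.
apply: contra no => /eqP gmu.
have h1 : mu != y by apply: contraNneq gy => <-; rewrite gmu.
have h2 : mu != z by apply: contraNneq gz => <-; rewrite gmu.
by rewrite -gmu lt0//= gt0.
Qed.

Lemma slchart_continuous a b w0 lam0 f d i w (l : R) : slchart a b w0 lam0 f d ->
  Omega a b w -> sl_dist a b w w0 < d -> `|l - lam0| < d ->
  {for l, continuous (fun l => f i l w)}.
Proof.
move=> [d0 _ _ cf] hw wd ld; apply/(@cvgrPdist_lt _ R^o) => e e0.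
have /(@cvgrPdist_lt _ R^o)/(_ e e0)[k k0 hk] := cf i w l hw wd ld.
exists k => //= s ls; have sl : `|s - l| < k by rewrite distrC.
by apply: (hk s s w) => //; rewrite sl_dist_refl.
Qed.

Lemma ball_itv (x y z s e : R) : `|y - x| < e -> `|z - x| < e -> y <= s -> s <= z ->
  `|s - x| < e.
Proof. by rewrite !ltr_norml => /andP[? ?] /andP[? ?] ? ?; apply/andP; split; lra. Qed.

Lemma sign_near (u v : R) : `|u - v| < `|u| ->
  [/\ v != 0, (v < 0) = (u < 0) & (0 < v) = (0 < u)].
Proof.
move=> h; have [u0|u0|u0] := ltgtP u 0; last by rewrite u0 normr0 normr_lt0 in h.
  have v0 : v < 0 by move: h; rewrite (ltr0_norm u0) ltr_norml => /andP[]; lra.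
  by rewrite lt_eqF// v0 (lt_gtF v0).
have v0 : 0 < v by move: h; rewrite (gtr0_norm u0) ltr_norml => /andP[]; lra.
by rewrite gt_eqF// v0 (lt_gtF v0).
Qed.

Lemma slchart_sign a b w0 lam0 f d i (l : R) : slchart a b w0 lam0 f d -> Omega a b w0 ->
  `|l - lam0| < d -> f i l w0 != 0 -> exists2 e : R, 0 < e &
  forall w, Omega a b w -> sl_dist a b w w0 < e ->
    [/\ f i l w != 0, (f i l w < 0) = (f i l w0 < 0) & (0 < f i l w) = (0 < f i l w0)].
Proof.
move=> [d0 _ _ cf] h0 ld ne.
have w0d : sl_dist a b w0 w0 < d by rewrite sl_dist_refl.
have /(@cvgrPdist_lt _ R^o)/(_ `|f i l w0|) := cf i w0 l h0 w0d ld.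
rewrite normr_gt0 => /(_ ne)[e e0 he]; exists e => // w hw we.
have /= := he l l w; rewrite subrr normr0 => /(_ e0 e0 hw we).
exact: sign_near.
Qed.

(** An increasing branch has no zero near [lam0] other than possibly [lam0]. Between regular
    endpoints, the eigenvalues are as many as the branches that go from negative to positive, and
    the signs at the endpoints persist under small perturbations. *)
Lemma local_count a b w0 lam0 : a < b -> Omega a b w0 -> exists2 e : R, 0 < e &
  (forall x, `|x - lam0| < e -> x != lam0 -> multiplicity a b w0 x%:C 0) /\
  forall y z, `|y - lam0| < e -> `|z - lam0| < e -> y < z ->
  multiplicity a b w0 y%:C 0 -> multiplicity a b w0 z%:C 0 ->
  exists m d, 0 < d /\ forall w, Omega a b w -> sl_dist a b w w0 < d ->
    exists t : seq R, [/\ size t = m, all (fun s => y < s < z) t &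
      forall mu, y <= mu <= z -> multiplicity a b w mu%:C (count_mem mu t)].
Proof.
move=> ab h0; have [f [d ch]] := slchart_exists lam0 ab h0.
have [d0 mul mono cf] := ch.
have w0d : sl_dist a b w0 w0 < d by rewrite sl_dist_refl.
have iso i : exists2 e, 0 < e & forall x, `|x - lam0| < e -> x != lam0 -> f i x w0 != 0.
  have [fz|fz] := eqVneq (f i lam0 w0) 0.
    exists d => // x xd; have l0d : `|lam0 - lam0| < d by rewrite subrr normr0.
    have [h|h|//] := ltgtP x lam0 => _.
      by have := mono i w0 x lam0 h0 w0d xd l0d h; rewrite fz => /lt_eqF ->.
    by have := mono i w0 lam0 x h0 w0d l0d xd h; rewrite fz => /gt_eqF ->.
  have l0d : `|lam0 - lam0| < d by rewrite subrr normr0.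
  have /(@cvgrPdist_lt _ R^o)/(_ `|f i lam0 w0|) := cf i w0 lam0 h0 w0d l0d.
  rewrite normr_gt0 => /(_ fz)[e e0 he]; exists e => // x xe _.
  have /= := he x x w0 xe xe h0; rewrite sl_dist_refl => /(_ e0).
  by apply: contraTneq => ->; rewrite subr0 ltxx.
have [e1 e10 iso1] := iso true; have [e2 e20 iso2] := iso false.
pose e := Num.min d (Num.min e1 e2).
have e0 : 0 < e by rewrite !lt_min d0 e10.
have iso' i x : `|x - lam0| < e -> x != lam0 -> f i x w0 != 0.
  rewrite !lt_min => /and3P[_ h1 h2] ne.
  by case: i; [exact: iso1|exact: iso2].
have lee x : `|x - lam0| < e -> `|x - lam0| < d by rewrite lt_min => /andP[].
exists e => //; split.
  move=> x xe ne; have := mul w0 x h0 w0d (lee x xe).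
  by rewrite !(negbTE (iso' _ x xe ne)).
move=> y z ye ze yz yl zl.
have nz i x : `|x - lam0| < e -> multiplicity a b w0 x%:C 0 -> f i x w0 != 0.
  move=> xe m0; have := multiplicity_unique m0 (mul w0 x h0 w0d (lee x xe)).
  by case: i; do 2!case: eqP.
have sg i x : `|x - lam0| < e -> multiplicity a b w0 x%:C 0 -> exists2 e : R, 0 < e &
    forall w, Omega a b w -> sl_dist a b w w0 < e ->
    [/\ f i x w != 0, (f i x w < 0) = (f i x w0 < 0) & (0 < f i x w) = (0 < f i x w0)].
  by move=> xe ne; apply: (slchart_sign ch h0 (lee x xe)); exact: nz.
have [c1 c10 s1] := sg true y ye yl; have [c2 c20 s2] := sg false y ye yl.
have [c3 c30 s3] := sg true z ze zl; have [c4 c40 s4] := sg false z ze zl.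
exists ((f true y w0 < 0 < f true z w0)%R + (f false y w0 < 0 < f false z w0)%R)%N.
exists (Num.min d (Num.min (Num.min c1 c2) (Num.min c3 c4))).
split; first by rewrite !lt_min d0 c10 c20 c30 c40.
move=> w hw; rewrite !lt_min => /and3P[wd /andP[w1 w2] /andP[w3 w4]].
have [n1 l1 g1] := s1 w hw w1; have [n2 l2 g2] := s2 w hw w2.
have [n3 l3 g3] := s3 w hw w3; have [n4 l4 g4] := s4 w hw w4.
have inR s : y <= s -> s <= z -> `|s - lam0| < d.
  exact: ball_itv (lee y ye) (lee z ze).
have cw i : {within `[y, z], continuous (fun l => f i l w)}.
  apply: continuous_in_subspaceT => s; rewrite inE/= in_itv/= => /andP[ys sz].
  exact: (slchart_continuous ch hw wd (inR s ys sz)).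
have mw i s t : y <= s -> s < t -> t <= z -> f i s w < f i t w.
  move=> ys st tz; apply: mono => //; apply: inR => //.
    exact: le_trans (ltW st) tz.
  exact: le_trans ys (ltW st).
have [t1 [k1 a1 m1]] := increasing_zeros yz n1 n3 (cw true) (mw true).
have [t2 [k2 a2 m2]] := increasing_zeros yz n2 n4 (cw false) (mw false).
exists (t1 ++ t2); split.
- by rewrite size_cat k1 k2 l1 l2 g3 g4.
- by rewrite all_cat a1 a2.
- move=> mu muyz; rewrite count_cat m1// m2//; apply: mul => //.
  by case/andP: muyz; exact: inR.
Qed.

Lemma count0_lt (t : seq R) (P : pred R) mu : all P t -> ~~ P mu -> count_mem mu t = 0%N.
Proof. by move=> /allP h n; apply/count_memPn; apply: contra n; exact: h. Qed.

(** The existence of such a list also says that only finitely many real eigenvalues lie below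
    [x]. *)
Definition counts a b w x (t : seq R) : Prop :=
  all (fun s => s < x) t /\
  forall mu, mu < x -> multiplicity a b w mu%:C (count_mem mu t).

Lemma counts_size a b w x t t' : counts a b w x t -> counts a b w x t' -> size t = size t'.
Proof.
move=> [a1 m1] [a2 m2]; apply: perm_size; apply/allP => mu _ /=.
apply/eqP; have [h|h] := ltP mu x; first exact: multiplicity_unique (m1 mu h) (m2 mu h).
by rewrite !(count0_lt (P := fun s => s < x))// -leNgt.
Qed.

Definition same_bc w w' := sl_A w = sl_A w' /\ sl_B w = sl_B w'.

(** Regularity of [x] belongs to the notion: an eigenvalue at [x] could move to either side under
    perturbation. *)
Definition stable a b w0 x k := exists2 d : R, 0 < d & forall w, Omega a b w ->
  same_bc w w0 -> sl_dist a b w w0 < d ->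
  multiplicity a b w x%:C 0 /\ exists2 t, size t = k & counts a b w x t.

Lemma stable_step a b w0 lam0 : a < b -> Omega a b w0 -> exists2 e : R, 0 < e &
  (forall x, `|x - lam0| < e -> x != lam0 -> multiplicity a b w0 x%:C 0) /\
  forall y z k, `|y - lam0| < e -> `|z - lam0| < e -> y < z ->
  multiplicity a b w0 y%:C 0 -> multiplicity a b w0 z%:C 0 ->
  stable a b w0 y k -> exists m, stable a b w0 z m.
Proof.
move=> ab h0; have [e e0 [iso loc]] := local_count lam0 ab h0.
exists e => //; split => // y z k ye ze yz yl zl [d1 d10 st].
have [m [d [d0 H]]] := loc y z ye ze yz yl zl.
exists (k + m)%N, (Num.min d1 d); first by rewrite lt_min d10.
move=> w hw sb; rewrite lt_min => /andP[wd1 wd].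
have [my [t sz [at1 ct]]] := st w hw sb wd1; have [t' [sz' at2 mt]] := H w hw wd.
split.
  have := mt z; rewrite (ltW yz) lexx => /(_ isT).
  by rewrite (count0_lt at2)// ltxx andbF.
exists (t ++ t'); first by rewrite size_cat sz sz'.
split.
  rewrite all_cat; apply/andP; split.
    by apply: sub_all at1 => s sy; exact: lt_trans sy yz.
  by apply: sub_all at2 => s /andP[].
move=> mu muz; rewrite count_cat; have [h|h] := ltP mu y.
  rewrite (count0_lt at2) ?addn0; first exact: ct.
  by rewrite lt_gtF.
rewrite (count0_lt at1) ?add0n -?leNgt//; apply: mt; by rewrite h ltW.
Qed.

Definition bounded_spectrum a b w0 := exists x0 : R, exists2 d : R, 0 < d &
  forall w x, Omega a b w -> same_bc w w0 -> sl_dist a b w w0 < d -> x <= x0 ->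
  multiplicity a b w x%:C 0.

(** Continuation in x. The set [T] is closed downwards and contains the uniform lower bound of the
    spectrum; were it bounded by x, the local step around sup T would carry stability beyond sup
    T. *)
Lemma stable_all a b w0 x : a < b -> Omega a b w0 -> bounded_spectrum a b w0 ->
  multiplicity a b w0 x%:C 0 -> exists k, stable a b w0 x k.
Proof.
move=> ab h0 [x0 [d0 d00 low]].
pose good y := multiplicity a b w0 y%:C 0 -> exists k, stable a b w0 y k.
pose T := [set z : R | forall y, y <= z -> good y].
have Tx0 : T x0.
  move=> y yx0 _; exists 0%N, d0 => // w hw sb wd; split; first exact: low.
  exists [::] => //; split => // mu muy; apply: (low w mu) => //.
  exact: le_trans (ltW muy) yx0.
have Tdown s t : s <= t -> T t -> T s by move=> st Tt y ys; apply: Tt; exact: le_trans ys st.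
suff : T x by move=> Tx; exact: (Tx x (lexx x)).
apply: contrapT => nTx.
have ubT : ubound T x by move=> t Tt; rewrite leNgt; apply/negP => /ltW h; apply: nTx; exact: Tdown Tt.
have hs : has_sup T by split; [exists x0|exists x].
have [e e0 [iso step]] := stable_step (sup T) ab h0.
(* Close to sup T the only possible eigenvalue is sup T itself, so [y] is regular, and it lies in
   [T]. *)
pose y := sup T - e / 2.
have e20 : 0 < e / 2 by rewrite divr_gt0.
have [t Tt ht] := sup_adherent e20 hs.
have ye : `|y - sup T| < e.
  by rewrite /y addrAC subrr sub0r normrN gtr0_norm// ltr_pdivrMr// ltr_pMr// ltr1n.
have ys : y < sup T by rewrite /y ltrBlDr ltrDl.
have Ty : T y by exact: Tdown (ltW ht) Tt.
have [k stk] := Ty y (lexx y) (iso y ye (negbT (lt_eqF ys))).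
have : T (sup T + e / 2).
  move=> z ze mz; have [zy|yz] := leP z y; first exact: (Ty z zy mz).
  apply: (step y z k) => //; last by apply: iso; rewrite ?lt_eqF.
  by rewrite ltr_norml; apply/andP; split; move: yz ze; rewrite /y; clear -e0; lra.
by move=> /(ub_le_sup hs.2); rewrite gerDl leNgt e20.
Qed.

Lemma sorted_last_ge (t : seq R) s : sorted <=%R t -> s \in t -> s <= last 0 t.
Proof.
case: t => // x t /=; elim: t x s => [|y t IH] x s /=; first by rewrite inE => _ /eqP ->.
move=> /andP[xy p]; rewrite inE => /orP[/eqP ->|]; last exact: IH.
by apply: le_trans xy _; apply: IH => //; exact: mem_head.
Qed.

(** If l < l', the n + 1 terms of [t] would all occur, with multiplicity, among the terms of [t']
    below l', of which there are at most n. *)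
Lemma nth_eigenvalue_le a b w n l l' : nth_eigenvalue a b w n l ->
  nth_eigenvalue a b w n l' -> l' <= l.
Proof.
move=> [t [sz so la mt [k mk ck]]] [t' [sz' so' la' mt' _]]; rewrite leNgt; apply/negP => ll'.
pose s := [seq x <- t' | x < l'].
have sn : (size s <= n)%N.
  rewrite -ltnS -sz' size_filter; have := count_predC (fun x => x < l') t'.
  move=> <-; rewrite -addn1 leq_add2l -has_count; apply/hasP; exists l'; last by rewrite /= ltxx.
  by rewrite -la'; case: (t') sz' => //= x u _; exact: mem_last.
suff : (size t <= size s)%N by rewrite sz leqNgt ltnS sn.
have /count_subseqP[u us pu] : forall x, (count_mem x t <= count_mem x s)%N.
  move=> x; have [xt|xt] := boolP (x \in t); last by rewrite (count_memPn xt).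
  have xl : x <= l by rewrite -la; exact: sorted_last_ge.
  have xl' : x < l' := le_lt_trans xl ll'.
  have -> : count_mem x s = count_mem x t'.
    rewrite count_filter; apply: eq_count => z /=; case: eqP => // -> ; by rewrite xl'.
  have [h|h] := ltP x l.
    by rewrite (multiplicity_unique (mt x h) (mt' x xl')).
  have e : x = l by apply/eqP; rewrite eq_le xl h.
  by rewrite e in xl' *; rewrite (multiplicity_unique (mt' l xl') mk).
by rewrite (perm_size pu); exact: size_subseq.
Qed.

Lemma lambda_eq a b w n l : nth_eigenvalue a b w n l -> lambda a b n w = l.
Proof.
move=> h; have h' := xgetPex 0 (ex_intro [set l | nth_eigenvalue a b w n l] l h).
by apply/eqP; rewrite eq_le (nth_eigenvalue_le h h') (nth_eigenvalue_le h' h).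
Qed.

(** Simplicity lets [l] occur exactly once in its list, so precisely n terms lie strictly below
    it. *)
Lemma nth_eigenvalue_counts a b w n l : nth_eigenvalue a b w n l ->
  multiplicity a b w l%:C 1 -> exists2 t, size t = n & counts a b w l t.
Proof.
move=> [t [sz so la mt [k mk ck]]] m1.
rewrite (multiplicity_unique mk m1) in ck.
have lt : l \in t by rewrite -la; case: (t) sz => //= x u _; exact: mem_last.
have c1 : count_mem l t = 1%N.
  by apply/eqP; rewrite eqn_leq ck -has_count has_pred1.
exists [seq x <- t | x < l].
  rewrite size_filter; have := count_predC (fun x => x < l) t; rewrite sz.
  rewrite [X in (_ + X)%N](_ : _ = 1%N); first by rewrite addn1 => -[].
  rewrite -c1; apply: eq_in_count => x xt /=; rewrite -leNgt eq_le -{2}la.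
  by rewrite sorted_last_ge.
split; first exact: filter_all.
move=> mu mul; rewrite count_filter (_ : count _ t = count_mem mu t); first exact: mt.
by apply: eq_count => z /=; case: eqP => // ->; rewrite mul.
Qed.

Lemma counts_nth a b w z n t mu : counts a b w z (rcons t mu) -> size t = n ->
  all (fun s => s < mu) t -> nth_eigenvalue a b w n mu /\ multiplicity a b w mu%:C 1.
Proof.
move=> [+ ct] sz at1; rewrite all_rcons => /andP[muz az].
have m1 : multiplicity a b w mu%:C 1.
  by have := ct mu muz; rewrite -cats1 count_cat (count0_lt at1) ?ltxx//= eqxx.
split => //; exists (rcons (sort <=%R t) mu); split.
- by rewrite size_rcons size_sort sz.
- have tr : transitive (<=%R : rel R) by exact: le_trans.
  rewrite (sorted_pairwise tr) pairwise_rcons -(sorted_pairwise tr) sort_le_sorted andbT.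
  by rewrite all_sort; apply: sub_all at1 => s; exact: ltW.
- by rewrite last_rcons.
- move=> nu numu; have := ct nu (lt_trans numu muz).
  by rewrite -!cats1 !count_cat (permP (permEl (perm_sort _ t))).
- exists 1%N => //; rewrite -cats1 count_cat (permP (permEl (perm_sort _ t))).
  by rewrite (count0_lt at1) ?ltxx//= eqxx.
Qed.

(** The interval is small enough to contain no other eigenvalue of [w0]; its total count, evaluated
    at [w0] itself, is 1 and persists. *)
Lemma simple_eigenvalue_near a b w0 l : a < b -> Omega a b w0 ->
  multiplicity a b w0 l%:C 1 -> forall e, 0 < e -> exists h d,
  [/\ 0 < h, h < e, 0 < d, (forall x, l - h <= x -> x < l -> multiplicity a b w0 x%:C 0) &
    forall w, Omega a b w -> sl_dist a b w w0 < d -> exists2 mu, l - h < mu < l + h &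
    forall nu, l - h <= nu <= l + h -> multiplicity a b w nu%:C (nu == mu)].
Proof.
move=> ab h0 m1 e e0.
have [e1 e10 [iso loc]] := local_count l ab h0.
pose h := Num.min e e1 / 2.
have me : 0 < Num.min e e1 by rewrite lt_min e0.
have h0' : 0 < h by rewrite divr_gt0.
have hm : h < Num.min e e1 by rewrite ltr_pdivrMr// ltr_pMr// ltr1n.
have [he he1] : h < e /\ h < e1 by move: hm; rewrite lt_min => /andP[].
have yb : `|(l - h) - l| < e1 by rewrite addrAC subrr sub0r normrN gtr0_norm.
have zb : `|(l + h) - l| < e1 by rewrite addrAC subrr add0r gtr0_norm.
have yl : l - h < l by rewrite ltrBlDr ltrDl.
have lz : l < l + h by rewrite ltrDl.
have my := iso _ yb (negbT (lt_eqF yl)); have mz := iso _ zb (negbT (gt_eqF lz)).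
have [m [d [d0 H]]] := loc _ _ yb zb (lt_trans yl lz) my mz.
have m1' : m = 1%N.
  have [|t [<- /allP at1 ct]] := H w0 h0; first by rewrite sl_dist_refl.
  have inl : l - h <= l <= l + h by rewrite !ltW.
  rewrite -(multiplicity_unique (ct l inl) m1) -(count_predC (pred1 l)) -[RHS]addn0.
  congr addn; apply/eqP; rewrite -leqn0 leqNgt -has_count; apply/hasPn => x xt /=.
  rewrite negbK; apply: contraT => xl; have /andP[/ltW ? /ltW ?] := at1 x xt.
  have mx : multiplicity a b w0 x%:C 0 by apply: iso => //; exact: (ball_itv yb zb).
  have xin : l - h <= x <= l + h by apply/andP.
  have /eqP := multiplicity_unique (ct x xin) mx.
  by rewrite -leqn0 leqNgt -has_count has_pred1 xt.
exists h, d; split => //.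
  move=> x yx xl; apply: iso (negbT (lt_eqF xl)).
  by apply: (ball_itv yb zb) => //; rewrite ltW// (lt_trans xl).
move=> w hw wd; have [t [sz at1 mt]] := H w hw wd.
move: sz at1 mt; rewrite m1'; case: t => [//|mu [|//]] _ /=; rewrite andbT => mui mt.
by exists mu => // nu /mt; rewrite addn0 eq_sym.
Qed.

(** Nearby problems keep n eigenvalues below l - h and a single simple one between l - h and l + h;
    the latter therefore has index n. *)
Lemma lambda_near a b w0 n l : a < b -> Omega a b w0 -> bounded_spectrum a b w0 ->
  nth_eigenvalue a b w0 n l -> multiplicity a b w0 l%:C 1 ->
  forall e, 0 < e -> exists2 d, 0 < d & forall w, Omega a b w -> same_bc w w0 ->
  sl_dist a b w w0 < d -> `|lambda a b n w - l| < e /\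
  multiplicity a b w (lambda a b n w)%:C 1.
Proof.
move=> ab h0 low nl m1 e e0.
have [h [d [h0' he d0 iso H]]] := simple_eigenvalue_near ab h0 m1 e0.
have yl : l - h < l by rewrite ltrBlDr ltrDl.
have lz : l < l + h by rewrite ltrDl.
have my := iso _ (lexx _) yl.
have [k [d1 d10 st]] := stable_all ab h0 low my.
have bc0 : same_bc w0 w0 by [].
have kn : k = n.
  have [tn <- cn] := nth_eigenvalue_counts nl m1.
  have [_ [t <- [at1 ct]]] : multiplicity a b w0 (l - h)%:C 0 /\
      exists2 t, size t = k & counts a b w0 (l - h) t.
    by apply: st => //; rewrite sl_dist_refl.
  apply: (counts_size (x := l) (w := w0) (a := a) (b := b)) => //; split.
    by apply: sub_all at1 => s sy; exact: lt_trans sy yl.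
  move=> mu mul; have [q|q] := ltP mu (l - h); first exact: ct.
  by rewrite (count0_lt at1) -?leNgt//; exact: iso.
exists (Num.min d1 d); first by rewrite lt_min d10.
move=> w hw sb; rewrite lt_min => /andP[wd1 wd].
have [_ [t sz [at1 ct]]] := st w hw sb wd1.
have [mu /andP[ymu muz] mt] := H w hw wd.
have [|//||hn hm1] := @counts_nth a b w (l + h) n t mu; last first.
- rewrite (lambda_eq hn); split => //.
  by rewrite ltr_norml; apply/andP; split; move: ymu muz he; clear; lra.
- by apply: sub_all at1 => s sy; exact: lt_trans sy ymu.
- by rewrite sz.
split.
  rewrite all_rcons muz; apply: sub_all at1 => s sy.
  exact: lt_trans sy (lt_trans yl lz).
move=> nu nuz; rewrite -cats1 count_cat; have [q|q] := ltP nu (l - h).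
  by rewrite /= gt_eqF ?(lt_trans q)// !addn0; exact: ct.
rewrite (count0_lt at1) ?add0n -?leNgt//= addn0 eq_sym; apply: mt; by rewrite q ltW.
Qed.

End Counting.

(** * Lower bound of the spectrum *)

Section BoundaryBound.
Context {R : realType}.
Local Notation C := R[i].
Implicit Types (a b x lam : R) (w : sl_problem R).

Lemma normc2E (z : C) : normc z ^+ 2 = complex.Re z ^+ 2 + complex.Im z ^+ 2.
Proof. by case: z => x y /=; rewrite sqr_sqrtr// addr_ge0 ?sqr_ge0. Qed.

Lemma normc_conj (z : C) : normc (conjc z) = normc z.
Proof. by case: z => x y /=; rewrite sqrrN. Qed.

Lemma Re_form_le (y z p q : C) : `|complex.Re (conjc y * (p * y + q * z))| <=
  (normc p + normc q) * (normc y ^+ 2 + normc z ^+ 2).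
Proof.
apply: le_trans (Re_le_normc _) _; rewrite ComplexField.Normc.normcM normc_conj.
have h := le_normcD (p * y) (q * z); rewrite !ComplexField.Normc.normcM in h.
apply: le_trans (ler_wpM2l (normc_ge0 y) h) _.
move: (normc_ge0 y) (normc_ge0 z) (normc_ge0 p) (normc_ge0 q).
move: (normc y) (normc z) (normc p) (normc q) => Y Z P Q Y0 Z0 P0 Q0.
have : 0 <= Q * ((Y - Z) ^+ 2 + Y ^+ 2 + Z ^+ 2) by rewrite mulr_ge0// !addr_ge0 ?sqr_ge0.
have : 0 <= P * Z ^+ 2 by rewrite mulr_ge0 ?sqr_ge0.
rewrite !expr2; lra.
Qed.

(** On the kernel of M, the map D has a linear section over its image, obtained from a
    pseudo-inverse. *)
Lemma kernel_section (m n k : nat) (M : 'M[C]_(n, m)) (D : 'M[C]_(n, k)) :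
  exists S : 'M[C]_(k, n), forall v : 'rV[C]_n, v *m M = 0 ->
    v *m D *m S *m M = 0 /\ v *m D *m S *m D = v *m D.
Proof.
exists (pinvmx (kermx M *m D) *m kermx M) => v /eqP; rewrite -sub_kermx => /submxP[c ->].
set K := kermx M; set P := pinvmx _; split.
  by rewrite -mulmxA -(mulmxA P) mulmx_ker !mulmx0.
by rewrite -(mulmxA c) -(mulmxA (c *m _)) -(mulmxA P) mulmxA mulmxKpV// submxMl.
Qed.

(** [D] extracts (y(a), y(b)) from the boundary values. A section over the admissible pairs makes a
    compatible choice of quasi-derivatives linear in them; p, q, r, s are its coefficients. *)
Lemma boundary_section (A B : 'M[C]_2) : exists p q r s : C,
  forall Ya Yb : 'cV[C]_2, A *m Ya + B *m Yb = 0 ->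
  forall Ya' Yb' : 'cV[C]_2, Ya' 0 0 = Ya 0 0 -> Yb' 0 0 = Yb 0 0 ->
  Ya' 1 0 = p * Ya 0 0 + q * Yb 0 0 -> Yb' 1 0 = r * Yb 0 0 + s * Ya 0 0 ->
  A *m Ya' + B *m Yb' = 0.
Proof.
pose D : 'M[C]_(2 + 2, 2) := col_mx (delta_mx 0 0) (delta_mx 0 1).
have [S HS] := kernel_section (row_mx A B)^T D.
exists (S 0 (lshift 2 1)), (S 1 (lshift 2 1)), (S 1 (rshift 2 1)), (S 0 (rshift 2 1)).
move=> Ya Yb e Ya' Yb' e1 e2 e3 e4.
have rowE (u v : 'cV[C]_2) : row_mx u^T v^T *m (row_mx A B)^T = (A *m u + B *m v)^T.
  by rewrite tr_row_mx mul_row_col raddfD/= !trmx_mul.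
have DE (u v : 'cV[C]_2) j : (row_mx u^T v^T *m D) 0 j = if j == 0 then u 0 0 else v 0 0.
  rewrite mul_row_col !mxE !sum2 !mxE.
  by case: (ord2P j) => ->; rewrite !eqxx /= ?(mulr1, mulr0, addr0, add0r).
have [h1 h2] := HS (row_mx Ya^T Yb^T) (etrans (rowE _ _) (etrans (congr1 _ e) (trmx0 _ _ _))).
set d := row_mx Ya^T Yb^T *m D in h1 h2; set s := d *m S in h1 h2.
have dE j : d 0 j = if j == 0 then Ya 0 0 else Yb 0 0 by exact: DE.
have sE j : s 0 j = Ya 0 0 * S 0 j + Yb 0 0 * S 1 j by rewrite mxE sum2 !dE.
clearbody s.
have sD : s = row_mx ((lsubmx s)^T)^T ((rsubmx s)^T)^T by rewrite !trmxK hsubmxK.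
have s0 j : (if j == 0 then (lsubmx s)^T 0 0 else (rsubmx s)^T 0 0) = d 0 j.
  by rewrite -h2 [in RHS]sD DE.
have e5 : (lsubmx s)^T = Ya'.
  apply/colP => j; case: (ord2P j) => ->; first by rewrite e1; have := s0 0; rewrite dE.
  by rewrite e3 !mxE sE mulrC (mulrC (Yb 0 0)).
have e6 : (rsubmx s)^T = Yb'.
  apply/colP => j; case: (ord2P j) => ->; first by rewrite e2; have := s0 1; rewrite dE.
  by rewrite e4 !mxE sE addrC mulrC (mulrC (Ya 0 0)).
by move: h1; rewrite sD rowE e5 e6 => /(congr1 trmx); rewrite trmxK trmx0.
Qed.

(* The boundary form vanishes against the solutions of the boundary condition with
   y(a) = y(b) = 0, so u may be replaced by a linear function of (y(a), y(b)). *)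
Lemma boundary_bound a b w0 : a < b -> Omega a b w0 -> exists2 K : R, 0 <= K &
  forall y u : R -> C, boundary_condition a b w0 y u ->
  complex.Re (conjc (y b) * u b) - complex.Re (conjc (y a) * u a) <=
  K * (normc (y a) ^+ 2 + normc (y b) ^+ 2).
Proof.
move=> ab h0; have [p [q [r [s H]]]] := boundary_section (sl_A w0) (sl_B w0).
exists (normc p + normc q + (normc r + normc s)); first by rewrite !addr_ge0 ?normc_ge0.
move=> y u bc; pose u' x := if x == a then p * y a + q * y b else r * y b + s * y a.
have u'a : u' a = p * y a + q * y b by rewrite /u' eqxx.
have u'b : u' b = r * y b + s * y a by rewrite /u' gt_eqF.
have bc' : boundary_condition a b w0 y u'.
  by apply: (H _ _ bc); rewrite !mxE //= ?u'a ?u'b.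
(* Pairing (y, u) with itself and with (y, u') shows that conj y u and conj y u' have the same
   difference of values between [a] and [b]. *)
have e1 := bc_form h0 bc bc; have e2 := bc_form h0 bc bc'.
have e : complex.Re (conjc (y b) * u b) - complex.Re (conjc (y a) * u a) =
    complex.Re (conjc (y b) * u' b) - complex.Re (conjc (y a) * u' a).
  have : conjc (y b) * u b - conjc (y a) * u a = conjc (y b) * u' b - conjc (y a) * u' a.
    have -> : conjc (y b) * u b - conjc (y a) * u a = (conjc (u b) * y b - conjc (u a) * y a) -
      ((conjc (u b) * y b - conjc (y b) * u b) - (conjc (u a) * y a - conjc (y a) * u a)) by ring.
    rewrite e1 subrr subr0.
    have -> : conjc (y b) * u' b - conjc (y a) * u' a = (conjc (u b) * y b - conjc (u a) * y a) -
      ((conjc (u b) * y b - conjc (y b) * u' b) - (conjc (u a) * y a - conjc (y a) * u' a)) by ring.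
    by rewrite e2 subrr subr0.
  move=> /(congr1 (@complex.Re R)).
  by case: (conjc (y b) * u b) (conjc (y a) * u a) (conjc (y b) * u' b) (conjc (y a) * u' a)
    => [? ?] [? ?] [? ?] [? ?].
rewrite {}e u'a u'b addrC mulrDl.
have h1 := Re_form_le (y a) (y b) p q; have h2 := Re_form_le (y b) (y a) r s.
rewrite (addrC (normc (y b) ^+ 2)) in h2.
apply: lerD; last by exact: le_trans (ler_norm _) h2.
by apply: le_trans h1; rewrite -normrN ler_norm.
Qed.

End BoundaryBound.

(** * Energy estimates *)

Section LowerBound.
Context {R : realType}.
Implicit Types (a b x lam : R) (w : sl_problem R).

Lemma Omega_pos a b w : Omega a b w -> aeon a b (fun x => 0 < sl_invp w x) /\
  aeon a b (fun x => 0 < sl_r w x).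
Proof.
move=> [_ [p0 r0 _ _]]; split => //.
by apply: aeonS p0 => x _; rewrite /sl_p invr_gt0.
Qed.

Lemma energy_identity a b w lam y u : a < b -> Omega a b w -> slreal a b w lam y u ->
  y b * u b - y a * u a = intg a b (fun x => sl_invp w x * (u x * u x)) +
    intg a b (fun x => sl_q w x * (y x * y x)) - lam * intg a b (fun x => sl_r w x * (y x * y x)).
Proof.
move=> ab hw h; have [hP hq hr hs] := L1_coef hw.
have [by_ bu] := slsys_bmeas (ltW ab) h.
have l1 : L1 a b (fun x => sl_invp w x * (u x * u x)) by apply: bmeas_L1M => //; exact: bmeasM.
have l2 : L1 a b (fun x => sl_q w x * (y x * y x)) by apply: bmeas_L1M => //; exact: bmeasM.
have l3 : L1 a b (fun x => sl_r w x * (y x * y x)) by apply: bmeas_L1M => //; exact: bmeasM.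
have := primitive_sub (primitiveM ab h.1 h.2) (lexx a) (ltW ab) (lexx b) => /= ->.
rewrite -intgZ// -intgD// -intgB//; [|exact: L1D|exact: L1Z].
by apply: eq_intg => x _; ring.
Qed.

Lemma intg_perturb a b c d f g h : a <= c -> c <= d -> d <= b ->
  L1 a b f -> L1 a b g -> L1 a b h -> (forall x, `|f x - g x| <= h x) ->
  `|intg c d f - intg c d g| <= intg a b h.
Proof.
move=> ac cd db hf hg hh H.
have s k : L1 a b k -> L1 c d k by exact: L1_sub.
rewrite -intgB; [|exact: s|exact: s].
apply: le_trans (norm_intg (L1B (s _ hf) (s _ hg))) _.
apply: (@le_trans _ _ (intg c d h)).
  by apply: le_intg; [apply: L1_norm; apply: L1B; exact: s|exact: s|move=> x _; exact: H].
apply: le_intg_sub => //; apply: aeonW => x _; exact: le_trans (H x).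
Qed.

(* The maximum of |y|^2 is controlled by its weighted mean over [c, d] and, through
   (|y|^2)' = 2 P (y . u) - 2 s |y|^2 and AM-GM, by a small part of the energy. *)
Lemma slsys_sup a b P Q s r y1 u1 y2 u2 (eps m c d x0 : R) : a < b ->
  L1 a b P -> L1 a b s -> L1 a b r ->
  aeon a b (fun x => 0 < P x) -> aeon a b (fun x => 0 < r x) ->
  slsys a b P Q s y1 u1 -> slsys a b P Q s y2 u2 ->
  let Y x := y1 x * y1 x + y2 x * y2 x in let U x := u1 x * u1 x + u2 x * u2 x in
  0 < eps -> a <= c -> c <= x0 -> x0 <= d -> d <= b ->
  (forall x, a <= x -> x <= b -> Y x <= Y x0) ->
  intg c d P <= eps / 4 -> intg c d (fun x => `|s x|) <= 1 / 8 -> 0 < m -> m <= intg c d r ->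
  Y x0 <= 2 * eps * intg a b (fun x => P x * U x) + 2 / m * intg a b (fun x => r x * Y x).
Proof.
move=> ab hP hs hr P0 r0 h1 h2 Y U e0 ac cx xd db mx iP isn m0 im.
have [by1 bu1] := slsys_bmeas (ltW ab) h1; have [by2 bu2] := slsys_bmeas (ltW ab) h2.
have cd := le_trans cx xd.
have bcmx_sympl : bmeas a b Y by apply: bmeasD; exact: bmeasM.
have bU : bmeas a b U by apply: bmeasD; exact: bmeasM.
have Y0 x : 0 <= Y x by rewrite addr_ge0// -expr2 sqr_ge0.
have U0 x : 0 <= U x by rewrite addr_ge0// -expr2 sqr_ge0.
have lPU : L1 a b (fun x => P x * U x) by exact: bmeas_L1M.
have lrY : L1 a b (fun x => r x * Y x) by exact: bmeas_L1M.
have lns := L1_norm hs.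
set E := intg a b (fun x => P x * U x); set W := intg a b (fun x => r x * Y x); set S := Y x0.
have S0 : 0 <= S by exact: Y0.
have E0 : 0 <= E by apply: intg_ge0_ae => //; apply: aeonS P0 => x _ p; rewrite mulr_ge0// ltW.
have W0 : 0 <= W by apply: intg_ge0_ae => //; apply: aeonS r0 => x _ p; rewrite mulr_ge0// ltW.
have hY := primitiveD (primitiveM ab h1.1 h1.1) (primitiveM ab h2.1 h2.1).
rewrite -/Y in hY; move: hY; set g := (fun x => _ + _) => hY.
(* Dominates the density of Y. On [c, d] its two terms containing S integrate to at most S / 4 each,
   by the smallness of P and s there. *)
pose G x := eps * (P x * U x) + (S / eps * P x + 2 * S * `|s x|).
have lG : L1 a b G by apply: L1D; [exact: L1Z|apply: L1D; exact: L1Z].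
have gG : aeon a b (fun x => `|g x| <= G x).
  apply: aeonS P0 => x; rewrite in_itv/= => /andP[ax xb] p.
  have YS : Y x <= S by apply: mx; exact: ltW.
  have -> : g x = P x * (2 * (y1 x * u1 x + y2 x * u2 x)) - 2 * Y x * s x by rewrite /g /Y; ring.
  apply: le_trans (ler_normB _ _) _; rewrite /G addrA; apply: lerD.
    have -> : eps * (P x * U x) + S / eps * P x = P x * (eps * U x + S / eps) by ring.
    rewrite normrM (gtr0_norm p); apply: ler_wpM2l; first exact: ltW.
    apply: (@le_trans _ _ (eps * U x + Y x / eps)); last first.
      by rewrite lerD2l ler_wpM2r// invr_ge0 ltW.
    have sq z v : `|2 * (z * v)| <= eps * (v * v) + z * z / eps.
      have ei : eps * eps^-1 = 1 by rewrite divff// gt_eqF.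
      have ei0 : 0 < eps^-1 by rewrite invr_gt0.
      have k1 : 0 <= eps^-1 * (z - eps * v) ^+ 2 by rewrite mulr_ge0 ?sqr_ge0 ?ltW.
      have k2 : 0 <= eps^-1 * (z + eps * v) ^+ 2 by rewrite mulr_ge0 ?sqr_ge0 ?ltW.
      have e1 : eps^-1 * (z - eps * v) ^+ 2 = z * z / eps + (eps * eps^-1) * (eps * (v * v)) - (eps * eps^-1) * (2 * (z * v)) by ring.
      have e2 : eps^-1 * (z + eps * v) ^+ 2 = z * z / eps + (eps * eps^-1) * (eps * (v * v)) + (eps * eps^-1) * (2 * (z * v)) by ring.
      move: k1 k2; rewrite e1 e2 ei !mul1r ler_norml.
      by move: (z * z / eps) (eps * (v * v)) (z * v) => A B D ? ?; apply/andP; split; lra.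
    rewrite mulrDr; apply: le_trans (ler_normD _ _) _.
    have -> : eps * U x + Y x / eps = (eps * (u1 x * u1 x) + y1 x * y1 x / eps) +
       (eps * (u2 x * u2 x) + y2 x * y2 x / eps) by rewrite /U /Y; ring.
    by apply: lerD; exact: sq.
  rewrite normrM ler_wpM2r// normrM (ger0_norm (Y0 x)) ger0_norm//.
  by rewrite ler_wpM2l.
have IG : intg c d G <= eps * E + S / 2.
  have ss k : L1 a b k -> L1 c d k by exact: L1_sub.
  rewrite /G intgD; last first; [by apply: L1D; apply: L1Z; exact: ss|by apply: L1Z; exact: ss|].
  rewrite intgD; last first; [by apply: L1Z; exact: ss|by apply: L1Z; exact: ss|].
  rewrite !intgZ; try exact: ss.
  have k1 : eps * intg c d (fun x => P x * U x) <= eps * E.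
    apply: ler_wpM2l; first exact: ltW.
    apply: le_intg_sub => //.
    by apply: aeonS P0 => x _ p; rewrite mulr_ge0// ltW.
  have k2 : S / eps * intg c d P <= S / 4.
    have -> : S / 4 = S / eps * (eps / 4) by field; rewrite gt_eqF.
    by apply: ler_wpM2l => //; rewrite divr_ge0// ltW.
  have k3 : 2 * S * intg c d (fun x => `|s x|) <= S / 4.
    have -> : S / 4 = 2 * S * (1 / 8) by field.
    by apply: ler_wpM2l => //; rewrite mulr_ge0.
  apply: le_trans (lerD k1 (lerD k2 k3)) _; rewrite lerD2l.
  by rewrite (_ : S / 4 + S / 4 = S / 2)//; field.
have osc t : c <= t -> t <= d -> S - Y t <= eps * E + S / 2.
  move=> ct td; apply: le_trans IG.
  have at_ := le_trans ac ct; have tb := le_trans td db.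
  have axx := le_trans ac cx; have xb := le_trans xd db.
  have G0 p q : a <= p -> q <= b -> aeon p q (fun x => 0 <= G x).
    by move=> ap qb; apply: (aeon_sub ap qb); apply: aeonS gG => x _; exact: le_trans.
  have key p q : c <= p -> p <= q -> q <= d -> `|Y q - Y p| <= intg c d G.
    move=> cp pq qd; have ap := le_trans ac cp; have qb := le_trans qd db.
    rewrite (primitive_sub hY ap pq qb).
    have lg : L1 p q g by exact: L1_sub hY.1.
    apply: le_trans (norm_intg lg) _; apply: (@le_trans _ _ (intg p q G)).
      apply: le_intg_ae; [exact: L1_norm|exact: L1_sub lG|exact: (aeon_sub ap qb)].
    apply: le_intg_sub => //; [exact: L1_sub lG|exact: G0].
  have [tx|xt] := leP t x0.
    by apply: le_trans (ler_norm _) _; exact: key.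
  by apply: le_trans (ler_norm _) _; rewrite distrC; apply: key => //; exact: ltW.
(* By the oscillation bound Y >= k on [c, d], so the weighted mean of Y over that interval controls
   k. *)
pose k := S / 2 - eps * E.
have kW : k * intg c d r <= W.
  have lrc := L1_sub ac db hr.
  rewrite -intgZ//; apply: (@le_trans _ _ (intg c d (fun x => r x * Y x))).
    apply: le_intg_ae; [exact: L1Z|exact: L1_sub lrY|].
    apply: aeonS (aeon_sub ac db r0) => x; rewrite in_itv/= => /andP[cx' xd'] p.
    rewrite mulrC; apply: ler_wpM2l; first exact: ltW.
    have := osc x (ltW cx') (ltW xd'); rewrite /k; lra.
  by apply: le_intg_sub => //; apply: aeonS r0 => x _ p; rewrite mulr_ge0// ltW.
have [k0|k0] := leP k 0.
  have : 0 <= 2 / m * W by rewrite mulr_ge0// divr_ge0// ltW.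
  move: k0; rewrite /k; lra.
have : k <= W / m.
  by rewrite ler_pdivlMr//; apply: le_trans kW; apply: ler_wpM2l => //; exact: ltW.
rewrite -[2 / m * W]mulrA (mulrC m^-1) /k; lra.
Qed.

End LowerBound.

Section SpectrumLowerBound.
Context {R : realType}.
Implicit Types (a b x lam : R) (w : sl_problem R).

Lemma L1_small_intervals a b (f : R -> R) e : a < b -> L1 a b f -> 0 < e ->
  exists2 d, 0 < d & forall c c', a <= c -> c <= c' -> c' <= b -> c' - c < d ->
  intg c c' f < e.
Proof.
move=> ab hf e0; have hF := primitive_intg 0 hf.
have [d d0 hd] := ac_unif_cont (primitive_ac (ltW ab) hF) e0.
exists d => // c c' ac cc' c'b lt.
rewrite -(primitive_sub hF ac cc' c'b); apply: le_lt_trans (ler_norm _) _.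
apply: (hd c' c _ c'b ac (le_trans cc' c'b)); first exact: le_trans cc'.
by rewrite ger0_norm// subr_ge0.
Qed.

(** The mass of [c, c + d] is a positive continuous function of c on a compact interval, and its
    minimum is the bound. *)
Lemma interval_mass a b (r : R -> R) d : a < b -> L1 a b r -> aeon a b (fun x => 0 < r x) ->
  0 < d -> d <= b - a ->
  exists2 m, 0 < m & forall c, a <= c -> c + d <= b -> m <= intg c (c + d) r.
Proof.
move=> ab hr r0 d0 db; have hF := primitive_intg 0 hr.
pose F x := 0 + intg a x r; pose G c := F (c + d) - F c.
have acb : a <= b - d by rewrite lerBrDr addrC -lerBrDr.
have GE c : a <= c -> c + d <= b -> G c = intg c (c + d) r.
  by move=> ac cb; rewrite /G (primitive_sub hF)// lerDl ltW.
have cG : {within `[a, b - d], continuous G}.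
  apply: unif_cont_within => e e0; have e2 : 0 < e / 2 by rewrite divr_gt0.
  have [k k0 hk] := ac_unif_cont (primitive_ac (ltW ab) hF) e2.
  exists k => // x y ax xb ay yb xy.
  have db' z : z <= b - d -> z + d <= b /\ z <= b by move=> h; split; lra.
  have ad z : a <= z -> a <= z + d by move=> h; lra.
  have [xb1 xb2] := db' x xb; have [yb1 yb2] := db' y yb.
  have h1 := hk x y ax xb2 ay yb2 xy.
  have h2 := hk (x + d) (y + d) (ad x ax) xb1 (ad y ay) yb1.
  rewrite opprD addrACA subrr addr0 in h2; have {}h2 := h2 xy.
  have -> : G x - G y = (F (x + d) - F (y + d)) - (F x - F y) by rewrite /G; ring.
  apply: le_lt_trans (ler_normB _ _) _; rewrite [ltRHS](splitr e); exact: ltrD.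
have [c0 + hc0] := EVT_min acb cG; rewrite in_itv/= => /andP[ac0 cb0].
have c0b : c0 + d <= b by rewrite -lerBrDr.
exists (G c0).
  rewrite GE//; apply: intg_gt0; [by rewrite ltrDl|exact: L1_sub hr|exact: aeon_sub r0].
by move=> c ac cb; rewrite -GE//; apply: hc0; rewrite in_itv/= ac lerBrDr.
Qed.

Lemma coef_perturb a b w w0 : Omega a b w -> Omega a b w0 ->
  forall c d, a <= c -> c <= d -> d <= b ->
  [/\ intg c d (sl_invp w) <= intg c d (sl_invp w0) + sl_dist a b w w0,
      intg c d (fun x => `|sl_q w x|) <= intg c d (fun x => `|sl_q w0 x|) + sl_dist a b w w0,
      intg c d (sl_r w0) <= intg c d (sl_r w) + sl_dist a b w w0 &
      intg c d (fun x => `|sl_s w x|) <= intg c d (fun x => `|sl_s w0 x|) + sl_dist a b w w0].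
Proof.
move=> hw h0 c d ac cd db; have D := sl_dist_coef_le a b w0 w; have lD := sl_dist_coef_L1 h0 hw.
have [h1 h2 h3 h4] := L1_coef hw; have [h1' h2' h3' h4'] := L1_coef h0.
have key f g : L1 a b f -> L1 a b g -> (forall x, `|f x - g x| <=
    `|sl_invp w x - sl_invp w0 x| + `|sl_q w x - sl_q w0 x| +
     `|sl_r w x - sl_r w0 x| + `|sl_s w x - sl_s w0 x|) ->
    intg c d f <= intg c d g + sl_dist a b w w0.
  move=> hf hg H; rewrite addrC -lerBlDr; apply: le_trans D.
  apply: le_trans (ler_norm _) _; exact: intg_perturb.
have tri (p q : R) : Num.norm (`|p| - `|q|) <= `|p - q| by exact: ler_dist_dist.
have t1 x : 0 <= `|sl_invp w x - sl_invp w0 x| by [].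
have t2 x : 0 <= `|sl_q w x - sl_q w0 x| by [].
have t3 x : 0 <= `|sl_r w x - sl_r w0 x| by [].
have t4 x : 0 <= `|sl_s w x - sl_s w0 x| by [].
split; apply: key => //; try exact: L1_norm; move=> x; have := (t1 x, t2 x, t3 x, t4 x) => -[[[k1 k2] k3] k4].
- by rewrite -!addrA lerDl !addr_ge0.
- by apply: le_trans (tri _ _) _; rewrite addrAC -!addrA addrCA lerDl !addr_ge0.
- by rewrite distrC -addrA addrCA lerDl !addr_ge0.
- by apply: le_trans (tri _ _) _; rewrite lerDr !addr_ge0.
Qed.

(** With energy E = int P |u|^2, mass W = int r |y|^2 and S = max |y|^2, the energy identity and the
    boundary bound give E - x W <= N S, while the sup estimate gives N S <= E + (4 N / m) W. The
    energies cancel, and x <= - (4 N / m + 1) contradicts W > 0. *)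
Lemma spectrum_bounded_below a b w0 : a < b -> Omega a b w0 -> bounded_spectrum a b w0.
Proof.
move=> ab h0; have [K K0 bnd] := boundary_bound ab h0.
have [hP0 hq0 hr0 hs0] := L1_coef h0; have [P0 r0] := Omega_pos h0.
(* The boundary form contributes 2 K and the potential int |q|; the 1 covers the change of q for
   nearby problems. *)
pose N := 2 * K + intg a b (fun x => `|sl_q w0 x|) + 1.
have N0 : 0 < N.
  rewrite ltr_wpDl// addr_ge0 ?mulr_ge0//; apply: intg_ge0_ae; first exact: L1_norm.
  exact: aeonW.
(* Chosen so that N times the coefficient 2 eps of the energy is exactly 1. *)
pose eps := (2 * N)^-1; have eps0 : 0 < eps by rewrite invr_gt0 mulr_gt0.
have eps8 : 0 < eps / 8 by rewrite divr_gt0.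
have e16 : 0 < 1 / 16 :> R by rewrite divr_gt0.
have [d1 d10 H1] := L1_small_intervals ab hP0 eps8.
have [d2 d20 H2] := L1_small_intervals ab (L1_norm hs0) e16.
pose dd := Num.min (Num.min d1 d2) (b - a) / 2.
have mm0 : 0 < Num.min (Num.min d1 d2) (b - a) by rewrite !lt_min d10 d20 subr_gt0.
have dd0 : 0 < dd by rewrite divr_gt0.
have ddm : dd < Num.min (Num.min d1 d2) (b - a) by rewrite ltr_pdivrMr// ltr_pMr// ltr1n.
have [[dd1 dd2] ddb] : (dd < d1 /\ dd < d2) /\ dd < b - a.
  by move: ddm; rewrite !lt_min => /andP[/andP[]].
have [m m0 Hm] := interval_mass ab hr0 r0 dd0 (ltW ddb).
(* One entry for each of q, r, 1/p and s: together with the margins kept for [w0], the perturbed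
   problem still has the bounds eps / 4, 1 / 8 and m / 2 that the sup estimate asks for. *)
pose d := Num.min (Num.min 1 (m / 2)) (Num.min (eps / 8) (1 / 16)).
exists (- (4 * N / m + 1)), d; first by rewrite !lt_min ltr01 eps8 e16 divr_gt0.
move=> w x hw sb; rewrite !lt_min => /andP[/andP[wd1 wd2] /andP[wd3 wd4]] xle.
have [k mk] : exists k, multiplicity a b w x%:C k by eexists; exact: multiplicity_rank.
suff : ~ is_eigenvalue a b w x%:C.
  by rewrite (multiplicity_gt0 mk); case: (k) mk => // ? _ /(_ isT).
move=> [y [u [sol bc [z0 /itvccP[az zb] yz]]]].
have [hP hq hr hs] := L1_coef hw; have [P_ r_] := Omega_pos hw.
have [s1 s2] := (sl_solution_real _ _ _ ab hw).1 sol.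
set y1 := fun x => complex.Re (y x) in s1; set u1 := fun x => complex.Re (u x) in s1.
set y2 := fun x => complex.Im (y x) in s2; set u2 := fun x => complex.Im (u x) in s2.
pose Y x := y1 x * y1 x + y2 x * y2 x; pose U x := u1 x * u1 x + u2 x * u2 x.
have [by1 bu1] := slsys_bmeas (ltW ab) s1; have [by2 bu2] := slsys_bmeas (ltW ab) s2.
have bcmx_sympl : bmeas a b Y by apply: bmeasD; exact: bmeasM.
have bU : bmeas a b U by apply: bmeasD; exact: bmeasM.
have Y0 t : 0 <= Y t by rewrite addr_ge0// -expr2 sqr_ge0.
have U0 t : 0 <= U t by rewrite addr_ge0// -expr2 sqr_ge0.
have hY := primitiveD (primitiveM ab s1.1 s1.1) (primitiveM ab s2.1 s2.1).
have [xs + hxs] := EVT_max (ltW ab) (primitive_within (ltW ab) hY).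
rewrite in_itv/= => /andP[axs xsb].
have mx t : a <= t -> t <= b -> Y t <= Y xs.
  by move=> at_ tb; apply: hxs; rewrite in_itv/= at_.
pose E := intg a b (fun t => sl_invp w t * U t); pose W := intg a b (fun t => sl_r w t * Y t).
pose Q := intg a b (fun t => sl_q w t * Y t).
have E0 : 0 <= E.
  apply: intg_ge0_ae; first exact: bmeas_L1M.
  by apply: aeonS P_ => t _ p; rewrite mulr_ge0// ltW.
have W0 : 0 < W.
  have := intg_weight_gt0 ab hr r_ s1.1 s2.1 az zb.
  rewrite /W (eq_intg (g := fun t => sl_r w t * Y t)); last by move=> t _; rewrite /Y !expr2.
  apply; move: yz; rewrite /y1 /y2; case: (y z0) => p q.
  by rewrite eq_complex negb_and.
have en : (Y b * 0 + (y1 b * u1 b + y2 b * u2 b)) - (y1 a * u1 a + y2 a * u2 a) = E + Q - x * W.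
  have e1 := energy_identity ab hw s1; have e2 := energy_identity ab hw s2.
  have L (f g h : R -> R) : L1 a b f -> bmeas a b g -> bmeas a b h ->
      intg a b (fun t => f t * (g t * g t)) + intg a b (fun t => f t * (h t * h t)) =
      intg a b (fun t => f t * (g t * g t + h t * h t)).
    move=> hf hg hh; rewrite -intgD; try (by apply: bmeas_L1M => //; exact: bmeasM).
    by apply: eq_intg => t _; rewrite mulrDr.
  rewrite /E /Q /W -!L// mulr0 add0r.
  transitivity ((y1 b * u1 b - y1 a * u1 a) + (y2 b * u2 b - y2 a * u2 a)); first by ring.
  by rewrite e1 e2; ring.
have bd : (y1 b * u1 b + y2 b * u2 b) - (y1 a * u1 a + y2 a * u2 a) <= K * (Y a + Y b).
  have bc0 : boundary_condition a b w0 y u by case: sb => e1 e2; rewrite /boundary_condition -e1 -e2.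
  have := bnd y u bc0; rewrite !normc2E !expr2 /Y /y1 /y2 /u1 /u2.
  have ReE (p q : R[i]) : complex.Re (conjc p * q) =
    complex.Re p * complex.Re q + complex.Im p * complex.Im q by case: p q => ? ? [? ?] /=; ring.
  by rewrite !ReE.
have Qle : - Q <= Y xs * intg a b (fun t => `|sl_q w t|).
  rewrite -intgZ; last exact: L1_norm.
  rewrite /Q -intgN; last exact: bmeas_L1M.
  apply: le_intg; [by apply: L1N; exact: bmeas_L1M|by apply: L1Z; exact: L1_norm|].
  move=> t; rewrite in_itv/= => /andP[at_ tb]; rewrite -mulNr.
  apply: (@le_trans _ _ (`|sl_q w t| * Y t)); first by rewrite ler_wpM2r// -normrN ler_norm.
  by rewrite mulrC ler_wpM2r// mx// ltW.
have qN : 2 * K + intg a b (fun t => `|sl_q w t|) <= N.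
  have [_ + _ _] := coef_perturb hw h0 (lexx a) (ltW ab) (lexx b).
  rewrite /N; move: wd1; clear; lra.
(* Left end of an interval of length [dd] inside [a, b] that contains the maximum point, shifted
   left when that point is close to [b]. *)
pose c := Num.min xs (b - dd).
have ac : a <= c by rewrite le_min axs; move: ddb; clear; lra.
have cxs : c <= xs by rewrite ge_min lexx.
have cb : c + dd <= b by rewrite -lerBrDr ge_min lexx orbT.
have xsc : xs <= c + dd.
  by rewrite /c; case: (leP xs (b - dd)) => _; [rewrite lerDl ltW|rewrite subrK].
have cd : c <= c + dd by rewrite lerDl ltW.
have lc : c + dd - c = dd by ring.
have [q1 _ q3 q4] := coef_perturb hw h0 ac cd cb.
have S := slsys_sup ab hP hs hr P_ r_ s1 s2 (eps := eps) (m := m / 2) (c := c) (d := c + dd) (x0 := xs).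
have {}S : Y xs <= 2 * eps * E + 2 / (m / 2) * W.
  apply: S => //.
  - have := H1 c (c + dd) ac cd cb; rewrite lc => /(_ dd1); move: q1 wd3; clear; lra.
  - have := H2 c (c + dd) ac cd cb; rewrite lc => /(_ dd2); move: q4 wd4; clear; lra.
  - by rewrite divr_gt0.
  - have := Hm c ac cb; move: q3 wd2; clear; lra.
have NS : N * Y xs <= E + 4 * N / m * W.
  apply: le_trans (ler_wpM2l (ltW N0) S) _.
  have -> : N * (2 * eps * E + 2 / (m / 2) * W) = E + 4 * N / m * W; last by [].
  by rewrite /eps; field; rewrite !gt_eqF.
have t1 : (2 * K + intg a b (fun t => `|sl_q w t|)) * Y xs <= N * Y xs by rewrite ler_wpM2r.
have t2 : K * (Y a + Y b) <= K * (2 * Y xs).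
  rewrite ler_wpM2l//; have := mx a (lexx a) (ltW ab); have := mx b (ltW ab) (lexx b).
  clear; lra.
have t3 : (4 * N / m + 1) * W <= - x * W by apply: ler_wpM2r; [exact: ltW|move: xle; clear; lra].
rewrite mulr0 add0r in en; rewrite en in bd.
have r1 := le_trans bd t2.
have r2 : K * (2 * Y xs) + Y xs * intg a b (fun t => `|sl_q w t|) <= N * Y xs.
  by apply: le_trans t1; rewrite le_eqVlt; apply/orP; left; apply/eqP; ring.
have r3 : 4 * N / m * W + W <= - (x * W) by rewrite -mulNr -[X in _ + X]mul1r -mulrDl.
suff : W <= 0 by rewrite leNgt W0.
move: r1 Qle r2 r3 NS; clear.
move: (E) (Q) (W) (K * (2 * Y xs)) (Y xs * intg a b _) (N * Y xs) (4 * N / m * (W)) (x * (W)).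
by move=> *; lra.
Qed.

End SpectrumLowerBound.

(** * The increment of an eigenvalue *)

Section BoundedUniform.
Context {R : realType} {T : Type} (F : set_system T) {FF : Filter F}.
Implicit Types (a b x : R).

(** The bound on the limit is carried along because products converge uniformly only with it. *)
Definition ucvgb a b (f : T -> R -> R) (f0 : R -> R) := unif_cvg F a b f f0 /\
  exists M : R, forall x, a <= x -> x <= b -> `|f0 x| <= M.

Lemma ucvgbD a b f f0 g g0 : ucvgb a b f f0 -> ucvgb a b g g0 ->
  ucvgb a b (fun t x => f t x + g t x) (fun x => f0 x + g0 x).
Proof.
move=> [hf [M HM]] [hg [N HN]]; split; first exact: unif_cvgD.
by exists (M + N) => x ax xb; apply: le_trans (ler_normD _ _) _; rewrite lerD ?HM ?HN.
Qed.

Lemma ucvgbM a b f f0 g g0 : ucvgb a b f f0 -> ucvgb a b g g0 ->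
  ucvgb a b (fun t x => f t x * g t x) (fun x => f0 x * g0 x).
Proof.
move=> [hf [M HM]] [hg [N HN]]; split; first exact: unif_cvgM HM HN hf hg.
by exists (M * N) => x ax xb; rewrite normrM ler_pM ?HM ?HN.
Qed.

Lemma ucvgb_scalar a b (c : T -> R) (c0 : R) : c t @[t --> F] --> c0 ->
  ucvgb a b (fun t _ => c t) (fun=> c0).
Proof.
move=> /(@cvgrPdist_lt _ R^o) h; split; last by exists `|c0|.
by move=> e /h n; apply: filterS n => t h' x _ _; rewrite distrC.
Qed.

Lemma ucvgb_cst a b (f : R -> R) : (exists M : R, forall x, a <= x -> x <= b -> `|f x| <= M) ->
  ucvgb a b (fun _ => f) f.
Proof.
move=> h; split => // e e0; apply: filterE => t x _ _; by rewrite subrr normr0.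
Qed.

Lemma ucvgb_ext a b f f0 g g0 : (forall t x, f t x = g t x) ->
  (forall x, a <= x -> x <= b -> f0 x = g0 x) -> ucvgb a b f f0 -> ucvgb a b g g0.
Proof.
move=> fg fg0 [h [M HM]]; split; last by exists M => x ax xb; rewrite -fg0// HM.
move=> e /h n; apply: filterS n => t h' x ax xb; rewrite -fg -fg0//; exact: h'.
Qed.

End BoundedUniform.

Section Approx.
Context {R : realType}.
Local Notation C := R[i].
Implicit Types (a b x lam : R) (w : sl_problem R).

(** A kernel vector is orthogonal to a nonzero row (p, q) of X, hence a multiple of (-q, p), which
    up to sign is a column of the adjugate. *)
Lemma adj_range (X : 'M[C]_2) (c : 'cV[C]_2) : X != 0 -> X *m c = 0 ->
  exists v, c = \adj X *m v.
Proof.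
move=> X0 Xc.
have key (p q k m : C) : (p != 0) || (q != 0) -> p * k + q * m = 0 ->
    exists t, k = - q * t /\ m = p * t.
  move=> /orP[p0|q0] e.
    exists (m / p); split; last by field.
    by apply: (mulfI p0); rewrite (eqP (_ : p * k == - (q * m))) -?addr_eq0 ?e//; field.
  exists (- (k / q)); split; first by field.
  by apply: (mulfI q0); rewrite (eqP (_ : q * m == - (p * k))) -?addr_eq0 1?addrC ?e//; field.
have row i : X i 0 * c 0 0 + X i 1 * c 1 0 = 0.
  by move/matrixP/(_ i 0): Xc; rewrite !mxE sum2.
have [nz|/norP[/negbNE/eqP e1 /negbNE/eqP e2]] := boolP ((X 0 0 != 0) || (X 0 1 != 0)).
  have [t [h1 h2]] := key _ _ _ _ nz (row 0).
  exists (\col_i (if i == 0 then 0 else t)).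
  apply/colP => j; rewrite adj2 !mxE sum2 !mxE.
  by case: (ord2P j) => -> /=; rewrite ?h1 ?h2 /= ?mulr0 ?add0r ?subrr.
have nz : (X 1 0 != 0) || (X 1 1 != 0).
  rewrite -negb_and; apply: contra X0 => /andP[/eqP e3 /eqP e4].
  by apply/eqP/matrixP => i j; rewrite mxE; case: (ord2P i) (ord2P j) => -> [] ->.
have [t [h1 h2]] := key _ _ _ _ nz (row 1).
exists (\col_i (if i == 0 then - t else 0)).
apply/colP => j; rewrite adj2 !mxE sum2 !mxE.
by case: (ord2P j) => -> /=; rewrite ?h1 ?h2 /= ?mulr0 ?addr0 ?subr0 ?mulrN ?mulNr ?opprK.
Qed.

Lemma cvM_col {T : Type} (F : set_system T) {FF : Filter F} (M : T -> 'M[C]_2)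
    (L : 'M[C]_2) (v : 'cV[C]_2) i : cvM F M L ->
  cvC F (fun t => (M t *m v) i 0) ((L *m v) i 0).
Proof.
move=> h; rewrite mxE sum2 (_ : (fun t => _) = fun t => M t i 0 * v 0 0 + M t i 1 * v 1 0).
  by apply: cvCD; (apply: cvCM; [exact: h|exact: cvC_cst]).
by apply/funext => t; rewrite mxE sum2.
Qed.

(* [adj X] depends continuously on X and maps into the kernel of X when det X = 0. *)
Lemma approx_eigenfunction a b w0 l (y u : R -> C) : a < b -> Omega a b w0 ->
  multiplicity a b w0 l%:C 1 -> sl_solution a b w0 l%:C y u -> boundary_condition a b w0 y u ->
  let F := slnear a b l w0 in
  exists z v : R * R * sl_problem R -> R -> C,
  [/\ ucvgb F a b (fun p x => complex.Re (z p x)) (fun x => complex.Re (y x)) /\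
      ucvgb F a b (fun p x => complex.Im (z p x)) (fun x => complex.Im (y x)),
      ucvgb F a b (fun p x => complex.Re (v p x)) (fun x => complex.Re (u x)) /\
      ucvgb F a b (fun p x => complex.Im (v p x)) (fun x => complex.Im (u x)) &
      forall p, Omega a b p.2 -> is_eigenvalue a b p.2 p.1.1%:C ->
      sl_solution a b p.2 p.1.1%:C (z p) (v p) /\ boundary_condition a b p.2 (z p) (v p)].
Proof.
move=> ab h0 m1 sol bc F; pose c0 := boundary_vec y u a.
have yc := sol_csol ab h0 sol; rewrite -/c0 in yc.
have Xc : bcmx a b w0 l *m c0 = 0.
  apply/(csol_bc l c0 ab h0); move: bc; rewrite /boundary_condition.
  have e x : a <= x -> x <= b ->
      boundary_vec y u x = boundary_vec (cy a b w0 l c0) (cu a b w0 l c0) x.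
    by move=> ax xb; apply/colP => i; rewrite !mxE; have [-> ->] := yc x ax xb.
  by rewrite -!e// ltW.
have X0 : bcmx a b w0 l != 0.
  have e := multiplicity_unique m1 (multiplicity_rank l ab h0).
  by apply: contraPneq e => ->; rewrite mxrank0.
have [v0 ev] := adj_range X0 Xc.
have l1 := @slnear_lam1 R a b l w0.
pose c (p : R * R * sl_problem R) := \adj (bcmx a b p.2 p.1.1) *m v0.
have cA : cvM F (fun p => \adj (bcmx a b p.2 p.1.1)) (\adj (bcmx a b w0 l)).
  by apply: cvM_adjugate; exact: (bcmx_cvg ab h0 l1).
have cc i : cvC F (fun p => c p i 0) (c0 i 0).
  by rewrite ev; exact: (cvM_col v0 i cA).
have fb j : (exists M : R, forall x, a <= x -> x <= b -> `|fy a b w0 l j x| <= M) /\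
    (exists M : R, forall x, a <= x -> x <= b -> `|fu a b w0 l j x| <= M).
  have [M HM] := fund_bounded l j ab h0.
  by split; exists M => x ax xb; have [] := HM x ax xb.
have fyc j : ucvgb F a b (fun p => fy a b p.2 p.1.1 j) (fy a b w0 l j).
  by split; [have [] := fund_unif_cvg j ab h0 l1|have [] := fb j].
have fuc j : ucvgb F a b (fun p => fu a b p.2 p.1.1 j) (fu a b w0 l j).
  by split; [have [] := fund_unif_cvg j ab h0 l1|have [] := fb j].
exists (fun p => cy a b p.2 p.1.1 (c p)), (fun p => cu a b p.2 p.1.1 (c p)); split.
- split.
    apply: (ucvgb_ext _ _ (ucvgbD (ucvgbM (ucvgb_scalar a b (cc 0).1) (fyc 0))
       (ucvgbM (ucvgb_scalar a b (cc 1).1) (fyc 1)))).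
      by move=> t x; rewrite Re_comb.
    by move=> x ax xb; rewrite (yc x ax xb).1 Re_comb.
  apply: (ucvgb_ext _ _ (ucvgbD (ucvgbM (ucvgb_scalar a b (cc 0).2) (fyc 0))
     (ucvgbM (ucvgb_scalar a b (cc 1).2) (fyc 1)))).
    by move=> t x; rewrite Im_comb.
  by move=> x ax xb; rewrite (yc x ax xb).1 Im_comb.
- split.
    apply: (ucvgb_ext _ _ (ucvgbD (ucvgbM (ucvgb_scalar a b (cc 0).1) (fuc 0))
       (ucvgbM (ucvgb_scalar a b (cc 1).1) (fuc 1)))).
      by move=> t x; rewrite Re_comb.
    by move=> x ax xb; rewrite (yc x ax xb).2 Re_comb.
  apply: (ucvgb_ext _ _ (ucvgbD (ucvgbM (ucvgb_scalar a b (cc 0).2) (fuc 0))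
     (ucvgbM (ucvgb_scalar a b (cc 1).2) (fuc 1)))).
    by move=> t x; rewrite Im_comb.
  by move=> x ax xb; rewrite (yc x ax xb).2 Im_comb.
- move=> p hp /(eigenvalue_rank _ ab hp) nu; split; first exact: csol_sol.
  apply/(csol_bc _ _ ab hp); rewrite /c mulmxA mul_mx_adj.
  move: nu; rewrite unitmx_det negbK => /eqP ->.
  by rewrite mul_scalar_mx scale0r.
Qed.

End Approx.

(** * Exact increment and its linearization *)

Section Derivative.
Context {R : realType}.
Local Notation C := R[i].
Implicit Types (a b x lam : R) (w : sl_problem R).

Lemma ReMconj (p q : C) : complex.Re (conjc p * q) =
  complex.Re p * complex.Re q + complex.Im p * complex.Im q.
Proof. by case: p q => ? ? [? ?] /=; ring. Qed.

(** With weights formed from two eigenfunctions this is the exact increment, with those of the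
    unperturbed one the derivative. It is linear in the weights, so their difference is again of
    this form. *)
Definition sl_integrand w0 w (k1 k2 k3 k4 : R -> R) x : R :=
  (sl_q w x - sl_q w0 x) * k3 x - (sl_r w x - sl_r w0 x) * k4 x +
  (sl_s w x - sl_s w0 x) * k2 x - (sl_invp w x - sl_invp w0 x) * k1 x.

Lemma sl_integrand_L1 a b w0 w k1 k2 k3 k4 : Omega a b w0 -> Omega a b w ->
  bmeas a b k1 -> bmeas a b k2 -> bmeas a b k3 -> bmeas a b k4 ->
  L1 a b (sl_integrand w0 w k1 k2 k3 k4).
Proof.
move=> /L1_coef[? ? ? ?] /L1_coef[? ? ? ?] ? ? ? ?.
by apply: L1B; [apply: L1D; [apply: L1B|]|]; apply: bmeas_L1M => //; exact: L1B.
Qed.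

Lemma sl_integrand_le a b w0 w k1 k2 k3 k4 e : Omega a b w0 -> Omega a b w -> 0 <= e ->
  L1 a b (sl_integrand w0 w k1 k2 k3 k4) ->
  (forall x, a <= x -> x <= b -> [/\ `|k1 x| <= e, `|k2 x| <= e, `|k3 x| <= e & `|k4 x| <= e]) ->
  `|intg a b (sl_integrand w0 w k1 k2 k3 k4)| <= e * sl_dist a b w w0.
Proof.
move=> h0 hw e0 hL H; apply: le_trans (norm_intg hL) _.
apply: (@le_trans _ _ (e * sl_dist_coef a b w0 w)); last first.
  by rewrite ler_wpM2l// sl_dist_coef_le.
rewrite /sl_dist_coef -intgZ; last exact: sl_dist_coef_L1.
apply: le_intg; [exact: L1_norm|by apply: L1Z; exact: sl_dist_coef_L1|].
move=> x; rewrite in_itv/= => /andP[/ltW ax /ltW xb].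
have [h1 h2 h3 h4] := H x ax xb.
have t (p k : R) : `|k| <= e -> `|p * k| <= e * `|p|.
  by move=> h; rewrite normrM mulrC ler_wpM2r.
rewrite /sl_integrand !mulrDr.
apply: le_trans (ler_normB _ _) _; apply: le_trans (lerD (ler_normD _ _) (lexx _)) _.
apply: le_trans (lerD (lerD (ler_normB _ _) (lexx _)) (lexx _)) _.
have := t (sl_q w x - sl_q w0 x) _ h3; have := t (sl_r w x - sl_r w0 x) _ h4.
have := t (sl_s w x - sl_s w0 x) _ h2; have := t (sl_invp w x - sl_invp w0 x) _ h1.
lra.
Qed.

(** The Lagrange identities for the real and for the imaginary parts are added; the boundary terms
    cancel because both eigenfunctions satisfy the same boundary condition. *)
Lemma eigenvalue_increment a b w0 w l mu (y u z v : R -> C) : a < b ->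
  Omega a b w0 -> Omega a b w -> same_bc w w0 ->
  sl_solution a b w0 l%:C y u -> boundary_condition a b w0 y u ->
  sl_solution a b w mu%:C z v -> boundary_condition a b w z v ->
  let yz x := complex.Re (y x) * complex.Re (z x) + complex.Im (y x) * complex.Im (z x) in
  let uv x := complex.Re (u x) * complex.Re (v x) + complex.Im (u x) * complex.Im (v x) in
  let yv x := complex.Re (y x) * complex.Re (v x) + complex.Im (y x) * complex.Im (v x) +
    (complex.Re (u x) * complex.Re (z x) + complex.Im (u x) * complex.Im (z x)) in
  [/\ bmeas a b yz, bmeas a b uv, bmeas a b yv &
  (mu - l) * intg a b (fun x => sl_r w0 x * yz x) =
  intg a b (sl_integrand w0 w uv yv yz (fun x => mu * yz x))].
Proof.
move=> ab h0 hw sb sy bcy sz bcz yz uv yv.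
have [y1 y2] := (sl_solution_real _ _ _ ab h0).1 sy.
have [z1 z2] := (sl_solution_real _ _ _ ab hw).1 sz.
have [by1 bu1] := slsys_bmeas (ltW ab) y1; have [by2 bu2] := slsys_bmeas (ltW ab) y2.
have [bz1 bv1] := slsys_bmeas (ltW ab) z1; have [bz2 bv2] := slsys_bmeas (ltW ab) z2.
have byz : bmeas a b yz by apply: bmeasD; exact: bmeasM.
have buv : bmeas a b uv by apply: bmeasD; exact: bmeasM.
have byv : bmeas a b yv by apply: bmeasD; apply: bmeasD; exact: bmeasM.
split => //.
have [_ _ hr _] := L1_coef h0.
have lr : L1 a b (fun x => sl_r w0 x * yz x) by exact: bmeas_L1M.
have [L1I e1] := slsys_lagrange ab y1 z1; have [L2I e2] := slsys_lagrange ab y2 z2.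
have bcz0 : boundary_condition a b w0 z v.
  by case: sb => e e'; rewrite /boundary_condition -e -e'.
have := bc_form h0 bcy bcz0 => /(congr1 (@complex.Re R)).
have ReB (p q : C) : complex.Re (p - q) = complex.Re p - complex.Re q by case: p q => ? ? [? ?].
rewrite !ReB !ReMconj => e3.
have I0 : intg a b (fun x => (sl_invp w0 x - sl_invp w x) * (complex.Re (u x) * complex.Re (v x)) +
    (sl_s w x - sl_s w0 x) * (complex.Re (y x) * complex.Re (v x) + complex.Re (u x) * complex.Re (z x)) +
    (sl_q w x - mu * sl_r w x - (sl_q w0 x - l * sl_r w0 x)) * (complex.Re (y x) * complex.Re (z x))) +
  intg a b (fun x => (sl_invp w0 x - sl_invp w x) * (complex.Im (u x) * complex.Im (v x)) +
    (sl_s w x - sl_s w0 x) * (complex.Im (y x) * complex.Im (v x) + complex.Im (u x) * complex.Im (z x)) +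
    (sl_q w x - mu * sl_r w x - (sl_q w0 x - l * sl_r w0 x)) * (complex.Im (y x) * complex.Im (z x))) = 0.
  by rewrite -e1 -e2; move: e3; clear; lra.
rewrite -[LHS]add0r -I0 -intgZ// -!intgD//; [|exact: L1D|exact: L1Z].
by apply: eq_intg => x _; rewrite /sl_integrand /yz /yv /uv; ring.
Qed.

(** (d - Fd) D = (N - Fd) - Fd (D - 1), and D >= 1 / 2. Here D stands for the weighted product of
    the two eigenfunctions, N for the exact increment and Fd for its linearization. *)
Lemma increment_estimate (d D N Fd s eta M r : R) : d * D = N -> `|D - 1| <= eta * r ->
  eta * r <= 1 / 2 -> `|N - Fd| <= eta * s -> `|Fd| <= M * s -> 0 <= M -> 0 <= s ->
  `|d - Fd| <= 2 * eta * (1 + M * r) * s.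
Proof.
move=> e1 h1 h2 h3 h4 M0 s0.
have D2 : 1 / 2 <= D by move: (le_trans h1 h2); rewrite ler_norml => /andP[]; clear; lra.
have e : (d - Fd) * D = (N - Fd) - Fd * (D - 1) by rewrite -e1; ring.
have : `|d - Fd| * (1 / 2) <= `|(d - Fd) * D|.
  rewrite normrM ler_wpM2l// ger0_norm//; apply: le_trans D2; lra.
rewrite e => h5.
have h6 : `|Fd * (D - 1)| <= M * s * (eta * r) by rewrite normrM ler_pM.
have := ler_normB (N - Fd) (Fd * (D - 1)).
have -> : 2 * eta * (1 + M * r) * s = 2 * (eta * s + M * s * (eta * r)) by ring.
move: h5 h6 h3; clear; lra.
Qed.

Lemma derivative_estimate a b w0 l (y u : R -> C) : a < b -> Omega a b w0 ->
  multiplicity a b w0 l%:C 1 ->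
  sl_solution a b w0 l%:C y u -> boundary_condition a b w0 y u ->
  intg a b (fun x => sl_r w0 x * normc (y x) ^+ 2) = 1 ->
  forall e, 0 < e -> exists2 d, 0 < d & forall w mu, Omega a b w -> same_bc w w0 ->
  sl_dist a b w w0 < d -> `|mu - l| < d -> is_eigenvalue a b w mu%:C ->
  `|mu - l - intg a b (sl_integrand w0 w (fun x => normc (u x) ^+ 2)
     (fun x => 2 * complex.Re (y x * conjc (u x)))
     (fun x => normc (y x) ^+ 2) (fun x => l * normc (y x) ^+ 2))| <= e * sl_dist a b w w0.
Proof.
move=> ab h0 m1 sy bcy nrm e e0.
have [z [v [[cz1 cz2] [cv1 cv2] sol]]] := approx_eigenfunction ab h0 m1 sy bcy.
have [y1 y2] := (sl_solution_real _ _ _ ab h0).1 sy.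
have pb f g : primitive a b f g -> exists M : R, forall x, a <= x -> x <= b -> `|f x| <= M.
  exact: primitive_bounded.
pose F := slnear a b l w0.
have cst f g : primitive a b f g -> ucvgb F a b (fun _ => f) f.
  by move=> h; apply: ucvgb_cst; exact: pb h.
have DD f f0 g g0 : ucvgb F a b f f0 -> ucvgb F a b g g0 ->
    ucvgb F a b (fun t x => f t x + g t x) (fun x => f0 x + g0 x) by exact: ucvgbD.
have MM f f0 g g0 : ucvgb F a b f f0 -> ucvgb F a b g g0 ->
    ucvgb F a b (fun t x => f t x * g t x) (fun x => f0 x * g0 x) by exact: ucvgbM.
have cl : ucvgb F a b (fun p _ => p.1.1) (fun=> l) by apply: ucvgb_scalar; exact: slnear_lam1.
have k1 := cst _ _ y1.1; have k2 := cst _ _ y2.1.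
have k3 := cst _ _ y1.2; have k4 := cst _ _ y2.2.
have c1 := DD _ _ _ _ (MM _ _ _ _ k3 cv1) (MM _ _ _ _ k4 cv2).
have c3 := DD _ _ _ _ (MM _ _ _ _ k1 cz1) (MM _ _ _ _ k2 cz2).
have c2 := DD _ _ _ _ (DD _ _ _ _ (MM _ _ _ _ k1 cv1) (MM _ _ _ _ k2 cv2))
   (DD _ _ _ _ (MM _ _ _ _ k3 cz1) (MM _ _ _ _ k4 cz2)).
have c4 := MM _ _ _ _ cl c3.
have f1E x : normc (u x) ^+ 2 = complex.Re (u x) * complex.Re (u x) + complex.Im (u x) * complex.Im (u x).
  by rewrite normc2E !expr2.
have f3E x : normc (y x) ^+ 2 = complex.Re (y x) * complex.Re (y x) + complex.Im (y x) * complex.Im (y x).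
  by rewrite normc2E !expr2.
have f2E x : 2 * complex.Re (y x * conjc (u x)) =
   complex.Re (y x) * complex.Re (u x) + complex.Im (y x) * complex.Im (u x) +
    (complex.Re (u x) * complex.Re (y x) + complex.Im (u x) * complex.Im (y x)).
  by rewrite [y x * _]mulrC ReMconj; ring.
set f1 := fun x => normc (u x) ^+ 2; set f2 := fun x => 2 * complex.Re (y x * conjc (u x)).
set f3 := fun x => normc (y x) ^+ 2; set f4 := fun x => l * f3 x.
have [b3 b1 b2 _] := eigenvalue_increment ab h0 h0 (conj erefl erefl) sy bcy sy bcy.
have bf1 : bmeas a b f1 by rewrite /f1 (funext f1E).
have bf2 : bmeas a b f2 by rewrite /f2 (funext f2E).
have bf3 : bmeas a b f3 by rewrite /f3 (funext f3E).
have bf4 : bmeas a b f4 by apply: bmeasM => //; exact: bmeas_cst.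
have [n1 [M1 HM1]] := c1; have [n2 [M2 HM2]] := c2.
have [n3 [M3 HM3]] := c3; have [n4 [M4 HM4]] := c4.
pose M := `|M1| + `|M2| + `|M3| + `|M4|.
have M0 : 0 <= M by rewrite !addr_ge0.
have HM x : a <= x -> x <= b -> [/\ `|f1 x| <= M, `|f2 x| <= M, `|f3 x| <= M & `|f4 x| <= M].
  move=> ax xb; have q1 := HM1 x ax xb; have q2 := HM2 x ax xb.
  have q3 := HM3 x ax xb; have q4 := HM4 x ax xb.
  rewrite -f1E in q1; rewrite -f2E in q2; rewrite -f3E in q3 q4.
  have := ler_norm M1; have := ler_norm M2; have := ler_norm M3; have := ler_norm M4.
  have := normr_ge0 M1; have := normr_ge0 M2; have := normr_ge0 M3; have := normr_ge0 M4.
  rewrite -/(f1 x) in q1; rewrite -/(f2 x) in q2; rewrite -/(f3 x) -/(f4 x) in q3 q4.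
  move: q1 q2 q3 q4; rewrite /M; clear; move: `|f1 x| `|f2 x| `|f3 x| `|f4 x| => *; split; lra.
have [_ _ hr _] := L1_coef h0; have [_ r0] := Omega_pos h0.
pose r := intg a b (sl_r w0).
have rr : 0 <= r by apply: intg_ge0_ae => //; apply: aeonS r0 => x _ /ltW.
(* The first entry keeps eta r <= 1 / 2, so that the denominator is at least 1 / 2; the second makes
   the final factor 2 eta (1 + M r) at most e. *)
pose eta := Num.min (1 / (2 * (r + 1))) (e / (2 * (1 + M * r))).
have Mr : 0 <= M * r by rewrite mulr_ge0.
have p1 : 0 < 2 * (r + 1) by rewrite mulr_gt0// ltr_wpDl.
have p2 : 0 < 2 * (1 + M * r) by rewrite mulr_gt0// ltr_wpDr.
have eta0 : 0 < eta by rewrite lt_min !divr_gt0.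
have eta1 : eta * r <= 1 / 2.
  apply: (@le_trans _ _ (1 / (2 * (r + 1)) * r)); first by rewrite ler_wpM2r// ge_min lexx.
  rewrite mulrAC ler_pdivrMr//; move: rr; clear; lra.
have eta2 : 2 * eta * (1 + M * r) <= e.
  rewrite mulrAC mulrC -ler_pdivlMr//; by rewrite ge_min lexx orbT.
have [d d0 hd] := filterI (filterI (n1 _ eta0) (n2 _ eta0)) (filterI (n3 _ eta0) (n4 _ eta0)).
exists d => // w mu hw sb wd md ev.
have [sz bcz] := sol (mu, mu, w) hw ev.
have [[H1 H2] [H3 H4]] := hd mu mu w md md hw wd.
rewrite /= in H1 H2 H3 H4.
have [bg3 bg1 bg2 inc] := eigenvalue_increment ab h0 hw sb sy bcy sz bcz.
move: bg3 bg1 bg2 inc.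
set g3 := (fun x => _ * complex.Re (z _ x) + _).
set g1 := (fun x => _ * complex.Re (v _ x) + _).
set g2 := (fun x => _ + (_ + _)).
set g4 := (fun x => mu * _) => bg3 bg1 bg2 inc.
have bg4 : bmeas a b g4 by apply: bmeasM => //; exact: bmeas_cst.
have dist x : a <= x -> x <= b -> [/\ `|g1 x - f1 x| <= eta, `|g2 x - f2 x| <= eta,
    `|g3 x - f3 x| <= eta & `|g4 x - f4 x| <= eta].
  move=> ax xb; split; apply: ltW; rewrite /f4 /f1 /f2 /f3 ?f1E ?f2E ?f3E.
  - exact: H1.
  - exact: H2.
  - exact: H3.
  - exact: H4.
have lr f : bmeas a b f -> L1 a b (fun x => sl_r w0 x * f x) by move=> ?; exact: bmeas_L1M.
apply: le_trans (increment_estimate (M := M) (r := r) inc _ eta1 _ _ M0 _) _.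
- rewrite -nrm -intgB; [|exact: lr|exact: lr].
  have lB : L1 a b (fun x => sl_r w0 x * g3 x - sl_r w0 x * f3 x) by apply: L1B; exact: lr.
  apply: le_trans (norm_intg lB) _.
  rewrite /r -intgZ//; apply: le_intg_ae; [exact: L1_norm|exact: L1Z|].
  apply: aeonS r0 => x; rewrite in_itv/= => /andP[/ltW ax /ltW xb] rx.
  have [_ _ h _] := dist x ax xb.
  by rewrite -mulrBr normrM (gtr0_norm rx) mulrC ler_wpM2r// ltW.
- have lG := sl_integrand_L1 h0 hw bg1 bg2 bg3 bg4.
  have lF := sl_integrand_L1 h0 hw bf1 bf2 bf3 bf4.
  rewrite -intgB//.
  have -> : intg a b (fun x => sl_integrand w0 w g1 g2 g3 g4 x - sl_integrand w0 w f1 f2 f3 f4 x) =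
    intg a b (sl_integrand w0 w (fun x => g1 x - f1 x) (fun x => g2 x - f2 x)
      (fun x => g3 x - f3 x) (fun x => g4 x - f4 x)).
    by apply: eq_intg => x _; rewrite /sl_integrand; ring.
  apply: sl_integrand_le => //; first exact: ltW.
  by apply: sl_integrand_L1 => //; exact: bmeasB.
- apply: sl_integrand_le => //; exact: sl_integrand_L1.
- exact: le_trans (sl_dist_coef_ge0 h0 hw) (sl_dist_coef_le _ _ _ _).
apply: ler_wpM2r => //.
exact: le_trans (sl_dist_coef_ge0 h0 hw) (sl_dist_coef_le _ _ _ _).
Qed.

End Derivative.

(** * Circles *)

Section Circle.
Context {R : realType}.
Local Notation C := R[i].
Implicit Types (l z u : C) (e : R).

Lemma cvg_complex {T : Type} (F : set_system T) {FF : Filter F} (f : T -> C^o) (l : C^o) :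
  complex.Re (f t) @[t --> F] --> complex.Re l -> complex.Im (f t) @[t --> F] --> complex.Im l ->
  f t @[t --> F] --> l.
Proof.
move=> /(@cvgrPdist_lt _ R^o) h1 /(@cvgrPdist_lt _ R^o) h2; apply/(@cvgrPdist_lt _ C^o).
move=> [e1 e2]; rewrite ltcE /= => /andP[/eqP -> e0].
have e20 : 0 < e1 / 2 by rewrite divr_gt0.
apply: filterS2 (h1 _ e20) (h2 _ e20) => t k1 k2.
rewrite ltcE /=; apply/andP; split; first by case: (l) (f t) => ? ? [].
apply: (@le_lt_trans _ _ (normc (l - f t))); first by case: (l) (f t) => ? ? [].
apply: le_lt_trans (normc_le_ReIm _) _; rewrite [ltRHS]splitr.
move: k1 k2; case: (l) (f t) => ? ? [? ?] /= k1 k2; exact: ltrD.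
Qed.

Lemma normc_distC z u : normc (z - u) = normc (u - z).
Proof. by rewrite -[u - z]opprB; case: (z - u) => ? ? /=; rewrite !sqrrN. Qed.

Lemma normc_sub_continuous l : continuous (fun u : C^o => normc (u - l)).
Proof.
move=> u; apply/(@cvgrPdist_lt _ R^o C^o (nbhs (u : C^o)) (nbhs_filter (u : C^o))) => e e0.
have e0' : (0 : C) < e%:C by rewrite ltcR.
exists e%:C => // v /= hv.
have h : normc (u - v) < e by rewrite -ltcR.
have tri x y : normc (x - l) <= normc (x - y) + normc (y - l).
  by apply: le_trans (le_normcD _ _); rewrite (_ : x - y + (y - l) = x - l)//; ring.
apply: le_lt_trans h; rewrite ler_norml lerNl opprB !lerBlDr tri andbT.
by rewrite (normc_distC u v) tri.
Qed.

Definition circle_path l e (t : R) : C^o :=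
  (complex.Re l + e * cos (2 * pi * t)) +i* (complex.Im l + e * sin (2 * pi * t)).

Definition circle l e : set C := [set z | normc (z - l) = e].

(** The arc cosine parametrizes the upper half of the circle; the lower half is reached by replacing
    t with 1 - t. *)
Lemma circle_point (x y : R) : x ^+ 2 + y ^+ 2 = 1 ->
  exists t, [/\ 0 <= t, t <= 1, cos (2 * pi * t) = x & sin (2 * pi * t) = y].
Proof.
move=> xy; have x1 : -1 <= x <= 1.
  rewrite -ler_norml -(@ler_pXn2r _ 2) ?nnegrE// real_normK ?num_real// expr1n -xy lerDl.
  exact: sqr_ge0.
have p0 := pi_gt0 R; have p2 : 0 < 2 * pi :> R by rewrite mulr_gt0.
have [/andP[a0 ap] ca] := acos_def x1.
have sa : sin (acos x) = `|y|.
  by rewrite sin_acos// -xy addrAC subrr add0r sqrtr_sqr.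
have tE (s : R) : 2 * pi * (s / (2 * pi)) = s by rewrite mulrC divfK// gt_eqF.
have h1 : acos x / (2 * pi) <= 1.
  by rewrite ler_pdivrMr// mul1r; apply: le_trans ap _; move: p0; clear; lra.
have h0 : 0 <= acos x / (2 * pi) by rewrite divr_ge0// ltW.
have [y0|y0] := leP 0 y.
  by exists (acos x / (2 * pi)); rewrite tE; split => //; rewrite sa ger0_norm.
have := tE (acos x); move: h0 h1; move: (acos x / _) => k k0 k1 kE.
exists (1 - k); rewrite mulrBr kE mulr1 [2 * pi]mulr_natl.
split; first by rewrite subr_ge0.
- by rewrite gerBl.
- by rewrite cosB cos2pi sin2pi mul1r mul0r addr0.
- by rewrite sinB cos2pi sin2pi mul1r mul0r sub0r sa ltr0_norm// opprK.
Qed.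

Lemma circle_path_image l e : 0 < e -> circle_path l e @` `[0, 1] = circle l e.
Proof.
move=> e0; apply/seteqP; split => [_ [t _ <-]|].
  rewrite /circle /circle_path /=; case: l => l1 l2 /=.
  rewrite ![_ + e * _]addrC !addrK.
  by rewrite !exprMn -mulrDr cos2Dsin2 mulr1 sqrtr_sqr gtr0_norm.
case: l => l1 l2 [z1 z2]; rewrite /circle /= => hz.
have : ((z1 - l1) / e) ^+ 2 + ((z2 - l2) / e) ^+ 2 = 1.
  have h : (z1 - l1) ^+ 2 + (z2 - l2) ^+ 2 = e ^+ 2 by rewrite -hz sqr_sqrtr// addr_ge0 ?sqr_ge0.
  by rewrite !expr_div_n -mulrDl h divff// expf_neq0// gt_eqF.
move=> /circle_point[t [t0 t1 ct st]]; exists t; first by rewrite /= in_itv/= t0.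
rewrite /circle_path ct st /= !(mulrC e) !mulfVK ?gt_eqF//.
by rewrite ![_ + (_ - _)]addrC !subrK.
Qed.

(** Injectivity: equal values at s >= t give cos (2 pi (s - t)) = 1, hence sin (pi (s - t)) = 0,
    which with 0 <= s - t < 1 forces s = t. *)
Lemma circle_curve l e : 0 < e -> simple_closed_curve (circle l e).
Proof.
move=> e0; exists (circle_path l e); split; last by rewrite circle_path_image.
- have arg : continuous (fun t : R => 2 * pi * t) by move=> t; apply: cvgM; [exact: cvg_cst|exact: cvg_id].
  have aff (k : R) (f : R -> R) : continuous f -> continuous (fun t => k + e * f (2 * pi * t)).
    move=> cf t; apply: (@cvgD _ R^o); first exact: cvg_cst.
    apply: cvgM; first exact: cvg_cst.
    exact: (continuous_comp (arg t) (cf _)).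
  apply: continuous_subspaceT => t; apply: cvg_complex.
    exact: (aff (complex.Re l) _ (@continuous_cos R) t).
  exact: (aff (complex.Im l) _ (@continuous_sin R) t).
- rewrite /circle_path !mulr0 mulr1 [2 * pi]mulr_natl.
  by rewrite cos2pi sin2pi cos0 sin0.
- move=> s t; wlog st : s t / t <= s.
    move=> H si ti E; have [h|/ltW h] := leP t s; first exact: H.
    by apply/esym; apply: H.
  have in01 (x : R) : x \in `[0, 1[%R -> 0 <= x /\ x < 1 by rewrite in_itv/= => /andP.
  move=> /in01[s0 s1] /in01[t0 t1].
  move=> [/addrI/(mulfI (lt0r_neq0 e0)) ec /addrI/(mulfI (lt0r_neq0 e0)) es].
  have : cos (2 * pi * s - 2 * pi * t) = 1.
    by rewrite cosB -ec -es -!expr2 cos2Dsin2.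
  rewrite -mulrBr -mulrA mulrC mulr_natr cos_mulr2n => h.
  have {h} : sin (pi * (s - t)) ^+ 2 = 0.
    have := cos2Dsin2 (pi * (s - t)); move: h; rewrite !mulr2n; clear; lra.
  move=> /eqP; rewrite sqrf_eq0 => /eqP sz; apply/eqP; rewrite -subr_eq0.
  apply: contraTT (lexx (0 : R)) => ne.
  have p0 := pi_gt0 R; have st0 : 0 < s - t by rewrite lt_neqAle eq_sym ne subr_ge0.
  have st1 : s - t < 1 by move: t0 s1; clear; lra.
  have : 0 < sin (pi * (s - t)) by apply: sin_gt0_pi; rewrite mulr_gt0//= gtr_pMr.
  by rewrite sz ltxx.
Qed.

(** From an outer point the ray away from the centre stays in the complement and is unbounded. From
    an inner point the distance to the centre maps the component onto a connected set that avoids e,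
    so the component stays inside the disc. *)
Lemma circle_interior l e z : 0 < e -> curve_interior (circle l e) z <-> normc (z - l) < e.
Proof.
move=> e0; split=> [[nz [M HM]]|ze].
  rewrite ltNge le_eqVlt; apply/negP => /orP[/eqP h|h]; first exact: nz.
  pose ray (s : R) : C^o := (complex.Re l + s * complex.Re (z - l)) +i*
                            (complex.Im l + s * complex.Im (z - l)).
  have rayE s : ray s - l = s%:C * (z - l).
    by rewrite /ray; case: (l) (z - l) => l1 l2 [p q] /=; apply/eqP; rewrite eq_complex /= ; apply/andP; split; apply/eqP; ring.
  have nray s : 0 <= s -> normc (ray s - l) = s * normc (z - l).
    by move=> s0; rewrite rayE ComplexField.Normc.normcM /= expr0n addr0 sqrtr_sqr ger0_norm.
  have ray1 : ray 1 = z.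
    by apply: (addIr (- l)); rewrite rayE mul1r.
  have cray : continuous ray.
    move=> s; apply: cvg_complex => /=.
      by apply: (@cvgD _ R^o); [exact: cvg_cst|apply: cvgM; [exact: cvg_id|exact: cvg_cst]].
    by apply: (@cvgD _ R^o); [exact: cvg_cst|apply: cvgM; [exact: cvg_id|exact: cvg_cst]].
  have con : connected (ray @` `[1, +oo[).
    apply: connected_continuous_connected; last exact: continuous_subspaceT.
    apply/connected_intervalP => x y + _ t /andP[xt _].
    by rewrite /= !in_itv/= !andbT => x1; exact: le_trans x1 xt.
  have inc s : 1 <= s -> connected_component (~` circle l e : set C^o) z (ray s).
    move=> s1; apply: (@connected_component_max C^o _ (ray @` `[1, +oo[)) => //.
    - by exists 1 => //=; rewrite in_itv/= lexx.
    - move=> _ [t tt <-] hc; have t1 : 1 <= t by move: tt; rewrite /= in_itv/= andbT.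
      have te : t * normc (z - l) = e by rewrite -nray ?(le_trans ler01).
      have : e < e by rewrite -[ltRHS]te; apply: lt_le_trans h _; rewrite ler_peMl// normc_ge0.
      by rewrite ltxx.
    - by exists s => //=; rewrite in_itv/= s1.
  (* At this parameter the distance to the centre exceeds |M| + |l|, so the modulus exceeds M. *)
  pose s := 1 + (`|M| + normc l) / normc (z - l).
  have zl0 : 0 < normc (z - l) := lt_trans e0 h.
  have s1 : 1 <= s by rewrite lerDl divr_ge0 ?addr_ge0 ?normc_ge0// ltW.
  have := HM _ (inc s s1); rewrite leNgt => /negP; apply.
  have tri : normc (ray s - l) <= normc (ray s) + normc l.
    by apply: le_trans (le_normcD _ _) _; rewrite lerD2l; case: (l) => ? ? /=; rewrite !sqrrN.
  apply: le_lt_trans (ler_norm M) _; rewrite -(ltrD2r (normc l)); apply: lt_le_trans tri.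
  rewrite nray ?(le_trans ler01)// /s mulrDl mul1r divfK ?gt_eqF// ltrDr//.
split; first by move=> h; move: ze; rewrite h ltxx.
exists (normc l + e) => u Hu.
have ue : normc (u - l) < e.
  rewrite ltNge; apply/negP => eu.
  have con : connected ((fun u : C^o => normc (u - l)) @` connected_component (~` circle l e : set C^o) z).
    apply: connected_continuous_connected; first exact: component_connected.
    exact: continuous_subspaceT (@normc_sub_continuous l).
  have nz : (~` circle l e) z by move=> h; move: ze; rewrite h ltxx.
  have /connected_intervalP iv := con.
  have := iv (normc (z - l)) (normc (u - l)) _ _ e.
  case; [by exists z => //; exact: connected_component_refl|by exists u|by rewrite (ltW ze) eu|].
  by move=> v /connected_component_sub.
have -> : u = (u - l) + l by rewrite subrK.
by apply: le_trans (le_normcD _ _) _; rewrite addrC lerD2l ltW.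
Qed.

End Circle.

(** * Isolation of the eigenvalue and the four derivatives *)

Section Frechet.
Context {R : realType}.
Implicit Types (a b x lam : R) (w : sl_problem R).

(** Eigenvalues are real, so those in the disc around l lie in the interval from l - h to l + h,
    where the count is known. *)
Lemma eigenvalue_isolated a b w0 l : a < b -> Omega a b w0 ->
  multiplicity a b w0 l%:C 1 ->
  exists (G : set R[i]) (O : set (sl_problem R)),
     [/\ simple_closed_curve G, curve_interior G l%:C, Omega_nbhs a b w0 O &
         forall w, O w -> exists mu : R[i],
             [/\ curve_interior G mu, simple_eigenvalue a b w mu &
                 forall nu, curve_interior G nu -> is_eigenvalue a b w nu -> nu = mu]].
Proof.
move=> ab h0 m1; have [h [d [hp _ d0 _ H]]] := simple_eigenvalue_near ab h0 m1 ltr01.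
have nE (nu : R) : normc (nu%:C - l%:C) = `|nu - l|.
  by rewrite -raddfB /= expr0n addr0 sqrtr_sqr.
have inE (nu : R) : curve_interior (circle l%:C h) nu%:C <-> l - h < nu < l + h.
  by rewrite circle_interior// nE ltr_distl.
exists (circle l%:C h), [set w | Omega a b w /\ sl_dist a b w w0 < d]; split.
- exact: circle_curve.
- by apply/inE; rewrite ltrBlDr ltrDl hp.
- by split; [move=> w []|exists d].
- move=> w [hw wd]; have [mu mui mt] := H w hw wd.
  exists mu%:C; split; first exact/inE.
    apply: simple_eigenvalue_of_mult; rewrite -[1%N]/(nat_of_bool true) -(eqxx mu); apply: mt.
    by case/andP: mui => ? ?; rewrite !ltW.
  move=> nu ni ev; have nu0 := eigenvalue_real ab hw ev.
  have nuE : nu = (complex.Re nu)%:C by move: nu0; case: (nu) => p q /= ->.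
  move: ni ev; rewrite nuE => /inE/andP[n1 n2] ev; congr (_%:C); apply/eqP.
  have n12 : l - h <= complex.Re nu <= l + h by rewrite !ltW.
  by have := (multiplicity_gt0 (mt _ n12)).1 ev; case: eqP.
Qed.

Lemma bounded_linear_weight a b (k : R) f : bmeas a b f ->
  bounded_linear_L1 a b (fun h => k * intg a b (fun x => f x * h x)).
Proof.
move=> bf.
have l1 h : L1 a b h -> L1 a b (fun x => f x * h x).
  by move=> hh; under eq_fun do rewrite mulrC; exact: bmeas_L1M.
split=> [c g h hg hh|].
  rewrite [c * _]mulrCA -mulrDr; congr (_ * _); rewrite -intgZ; last exact: l1.
  rewrite -intgD; [|by apply: L1Z; exact: l1|exact: l1].
  by apply: eq_intg => x _; ring.
have [_ [M HM]] := bf; exists (`|k| * M) => h hh.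
rewrite normrM -mulrA ler_wpM2l//; apply: le_trans (norm_intg (l1 _ hh)) _.
rewrite -[L1norm a b h]/(intg a b (fun x => `|h x|)) -intgZ; last exact: L1_norm.
apply: le_intg; [by apply: L1_norm; exact: l1|by apply: L1Z; exact: L1_norm|].
by move=> x xab; rewrite normrM ler_wpM2r// HM.
Qed.

Section Perturbation.
Variables (a b : R) (om : sl_problem R) (n : nat) (l : R) (y u : R -> R[i]).
Hypotheses (ab : a < b) (hom : Omega a b om) (nl : nth_eigenvalue a b om n l)
  (m1 : multiplicity a b om l%:C 1) (sol : sl_solution a b om l%:C y u)
  (bc : boundary_condition a b om y u)
  (nrm : intg a b (fun x => sl_r om x * normc (y x) ^+ 2) = 1).

Local Notation increment w := (intg a b (sl_integrand om w (fun x => normc (u x) ^+ 2)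
     (fun x => 2 * complex.Re (y x * conjc (u x)))
     (fun x => normc (y x) ^+ 2) (fun x => l * normc (y x) ^+ 2))).

Lemma lambda_increment e : 0 < e -> exists2 d, 0 < d & forall w, Omega a b w ->
  same_bc w om -> sl_dist a b w om < d ->
  `|lambda a b n w - l - increment w| <= e * sl_dist a b w om.
Proof.
move=> e0; have [d1 d10 H1] := derivative_estimate ab hom m1 sol bc nrm e0.
have [d2 d20 H2] := lambda_near ab hom (spectrum_bounded_below ab hom) nl m1 d10.
exists (Num.min d1 d2); first by rewrite lt_min d10.
move=> w hw sb; rewrite lt_min => /andP[wd1 wd2]; have [near mw] := H2 w hw sb wd2.
by apply: H1 => //; apply/(multiplicity_gt0 mw).
Qed.

(** Common form of the four cases: changing one coefficient by h moves the problem by exactly the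
    L^1 norm of h, and the linearized increment becomes F h. *)
Lemma frechet_of_increment (H : set (R -> R)) (upd : (R -> R) -> sl_problem R) f0 F :
  bounded_linear_L1 a b F -> upd f0 = om ->
  (forall h, H h -> [/\ Omega a b (upd (fun x => f0 x + h x)),
     same_bc (upd (fun x => f0 x + h x)) om,
     sl_dist a b (upd (fun x => f0 x + h x)) om = L1norm a b h &
     increment (upd (fun x => f0 x + h x)) = F h]) ->
  frechet_derivative a b H (fun f => lambda a b n (upd f)) f0 F.
Proof.
move=> bF u0 HH; split => // e e0; have [d d0 Hd] := lambda_increment e0.
exists d => // h /HH[hO sb dE iE] hd.
by have := Hd _ hO sb; rewrite dE iE u0 (lambda_eq nl); exact.
Qed.

Lemma weights_bmeas : [/\ bmeas a b (fun x => normc (u x) ^+ 2),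
  bmeas a b (fun x => complex.Re (y x * conjc (u x))) & bmeas a b (fun x => normc (y x) ^+ 2)].
Proof.
have [y1 y2] := (sl_solution_real _ _ _ ab hom).1 sol.
have [by1 bu1] := slsys_bmeas (ltW ab) y1; have [by2 bu2] := slsys_bmeas (ltW ab) y2.
split; under eq_fun do rewrite ?normc2E ?[y _ * _]mulrC ?ReMconj ?expr2.
- by apply: bmeasD; exact: bmeasM.
- by apply: bmeasD; exact: bmeasM.
- by apply: bmeasD; exact: bmeasM.
Qed.

Lemma sl_dist_update w (h : R -> R) : same_bc w om ->
  (forall x, `|sl_invp w x - sl_invp om x| + `|sl_q w x - sl_q om x| +
     `|sl_r w x - sl_r om x| + `|sl_s w x - sl_s om x| = `|h x|) ->
  sl_dist a b w om = L1norm a b h.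
Proof.
move=> [eA eB] e; rewrite sl_distE eA eB !subrr !entry_norm0 !add0r.
by apply: eq_intg => x _; exact: e.
Qed.

(** Adding a nonnegative h keeps 1/p positive, so the perturbed problem stays in [Omega]; this is
    where the cone of increments enters. *)
Lemma frechet_invp : frechet_derivative a b (L1nonneg a b)
  (fun f => lambda a b n (set_invp om f)) (sl_invp om)
  (fun h => - intg a b (fun x => normc (u x) ^+ 2 * h x)).
Proof.
have [b1 b2 b3] := weights_bmeas.
have [hP hq hr hs] := L1_coef hom; have [_ [p0 r0 rk sa]] := hom.
apply: frechet_of_increment; last 1 first.
- move=> h [lh h0]; have sb : same_bc (set_invp om (fun x => sl_invp om x + h x)) om by [].
  split => //.
  + split; first by split => //; exact: L1D.
    split => //; apply: aeonS2 p0 h0 => x _; rewrite /sl_p !invr_gt0 /= => p q.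
    by rewrite ltr_wpDr.
  + apply: sl_dist_update => // x /=.
    by rewrite !subrr !normr0 !addr0 addrAC subrr add0r.
  + rewrite -intgN; last by under eq_fun do rewrite mulrC; exact: bmeas_L1M.
    by apply: eq_intg => x _; rewrite /sl_integrand /=; ring.
- under eq_fun do rewrite -mulN1r; exact: bounded_linear_weight.
- by case: (om).
Qed.

Lemma frechet_s : frechet_derivative a b (L1 a b)
  (fun f => lambda a b n (set_s om f)) (sl_s om)
  (fun h => 2 * intg a b (fun x => complex.Re (y x * conjc (u x)) * h x)).
Proof.
have [b1 b2 b3] := weights_bmeas.
have [hP hq hr hs] := L1_coef hom; have [_ [p0 r0 rk sa]] := hom.
apply: frechet_of_increment; last 1 first.
- move=> h lh; have sb : same_bc (set_s om (fun x => sl_s om x + h x)) om by [].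
  split => //.
  + by split; split => //; exact: L1D.
  + apply: sl_dist_update => // x /=.
    by rewrite !subrr !normr0 !add0r addrAC subrr add0r.
  + rewrite -intgZ; last by under eq_fun do rewrite mulrC; exact: bmeas_L1M.
    by apply: eq_intg => x _; rewrite /sl_integrand /=; ring.
- exact: bounded_linear_weight.
- by case: (om).
Qed.

Lemma frechet_q : frechet_derivative a b (L1 a b)
  (fun f => lambda a b n (set_q om f)) (sl_q om)
  (fun h => intg a b (fun x => normc (y x) ^+ 2 * h x)).
Proof.
have [b1 b2 b3] := weights_bmeas.
have [hP hq hr hs] := L1_coef hom; have [_ [p0 r0 rk sa]] := hom.
apply: frechet_of_increment; last 1 first.
- move=> h lh; have sb : same_bc (set_q om (fun x => sl_q om x + h x)) om by [].
  split => //.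
  + by split; split => //; exact: L1D.
  + apply: sl_dist_update => // x /=.
    by rewrite !subrr !normr0 !addr0 !add0r addrAC subrr add0r.
  + by apply: eq_intg => x _; rewrite /sl_integrand /=; ring.
- under eq_fun do rewrite -[intg _ _ _]mul1r; exact: bounded_linear_weight.
- by case: (om).
Qed.

Lemma frechet_r : frechet_derivative a b (L1nonneg a b)
  (fun f => lambda a b n (set_r om f)) (sl_r om)
  (fun h => - l * intg a b (fun x => normc (y x) ^+ 2 * h x)).
Proof.
have [b1 b2 b3] := weights_bmeas.
have [hP hq hr hs] := L1_coef hom; have [_ [p0 r0 rk sa]] := hom.
apply: frechet_of_increment; last 1 first.
- move=> h [lh h0]; have sb : same_bc (set_r om (fun x => sl_r om x + h x)) om by [].
  split => //.
  + split; first by split => //; exact: L1D.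
    split => //; apply: aeonS2 r0 h0 => x _ /= p q.
    by rewrite ltr_wpDr.
  + apply: sl_dist_update => // x /=.
    by rewrite !subrr !normr0 !addr0 !add0r addrAC subrr add0r.
  + rewrite -intgZ; last by under eq_fun do rewrite mulrC; exact: bmeas_L1M.
    by apply: eq_intg => x _; rewrite /sl_integrand /=; ring.
- exact: bounded_linear_weight.
- by case: (om).
Qed.

End Perturbation.
End Frechet.

Theorem theorem7p4 (R : realType) (a b : R) (hab : a < b)
    (om : sl_problem R) (hom : Omega a b om)
    (n : nat) (l : R) (hl : nth_eigenvalue a b om n l)
    (hsimple : simple_eigenvalue a b om l%:C)
    (w w1 : R -> R[i]) (hw : eigenfunction a b om l%:C w w1)
    (hnorm : \int[@lebesgue_measure R]_(x in `]a, b[)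
               (normc (w x) ^+ 2 * sl_r om x) = 1) :
  (exists (G : set R[i]) (O : set (sl_problem R)),
     [/\ simple_closed_curve G, curve_interior G l%:C, Omega_nbhs a b om O &
         forall rho, O rho ->
           exists mu : R[i],
             [/\ curve_interior G mu, simple_eigenvalue a b rho mu &
                 forall nu, curve_interior G nu -> is_eigenvalue a b rho nu ->
                   nu = mu]]) /\
  [/\ frechet_derivative a b (L1nonneg a b)
        (fun f => lambda a b n (set_invp om f)) (sl_invp om)
        (fun h => - \int[@lebesgue_measure R]_(x in `]a, b[)
                      (normc (w1 x) ^+ 2 * h x)),
      frechet_derivative a b (L1 a b)
        (fun f => lambda a b n (set_s om f)) (sl_s om)
        (fun h => 2 * \int[@lebesgue_measure R]_(x in `]a, b[)
                      (complex.Re (w x * conjc (w1 x)) * h x)),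
      frechet_derivative a b (L1 a b)
        (fun f => lambda a b n (set_q om f)) (sl_q om)
        (fun h => \int[@lebesgue_measure R]_(x in `]a, b[)
                      (normc (w x) ^+ 2 * h x)) &
      frechet_derivative a b (L1nonneg a b)
        (fun f => lambda a b n (set_r om f)) (sl_r om)
        (fun h => - l * \int[@lebesgue_measure R]_(x in `]a, b[)
                      (normc (w x) ^+ 2 * h x))].
Proof.
have [_ m1] := hsimple; have [sol bc _] := hw.
have nrm : intg a b (fun x => sl_r om x * normc (w x) ^+ 2) = 1.
  by rewrite -[RHS]hnorm; apply: eq_intg => x _; rewrite mulrC.
split; first exact: eigenvalue_isolated.
split.
- exact: frechet_invp hl m1 sol bc nrm.
- exact: frechet_s hl m1 sol bc nrm.
- exact: frechet_q hl m1 sol bc nrm.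
- exact: frechet_r hl m1 sol bc nrm.
Qed.
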